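(* Let $X,U,Y$ be complex Banach spaces, $1\le p<\infty$, and let $A$ generate a strongly continuous semigroup $\{e^{tA}\}_{t\ge0}$ on $X$. Let $B\in\mathcal L(U,X)$, $C\in\mathcal L(X,Y)$ and $\Delta\in\mathcal L(Y,U)$, and let $\{e^{t(A+B\Delta C)}\}_{t\ge0}$ be the strongly continuous semigroup generated by $A+B\Delta C$. Write $\mathcal F_{per}=L^p([0,2\pi],X)$. Then the following are equivalent: (i) $1\in\rho(e^{2\pi(A+B\Delta C)})$; (ii) $i\mathbb Z\subset\rho(A+B\Delta C)$ and $$\sup_{\{v_k\}}\frac{\|\sum_k(A-ik+B\Delta C)^{-1}v_ke^{ik(\cdot)}\|_{\mathcal F_{per}}}{\|\sum_kv_ke^{ik(\cdot)}\|_{\mathcal F_{per}}}<\infty,$$ the supremum being over finite sequences $\{v_k\}_{k=-N}^N$ in $X$; (iii) $i\mathbb Z\subset\rho(A+B\Delta C)$ and $$\inf_{\{v_k\}}\frac{\|\sum_k(A-ik+B\Delta C)v_ke^{ik(\cdot)}\|_{\mathcal F_{per}}}{\|\sum_kv_ke^{ik(\cdot)}\|_{\mathcal F_{per}}}>0,$$ the infimum being over finite sequences $\{v_k\}_{k=-N}^N$ in $\mathrm{Dom}(A)$. Further, if $\Gamma_{per}$ denotes the generator of the evolution semigroup $\{E^t_{per}\}_{t\ge0}$ on $\mathcal F_{per}$ induced by $\{e^{tA}\}_{t\ge0}$, and if $1\in\rho(e^{2\pi A})$, then $\Gamma_{per}$ is invertible and $$\|\mathcal C\Gamma_{per}^{-1}\mathcal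 B\|=\sup_{\{u_k\}}\frac{\|\sum_kC(A-ik)^{-1}Bu_ke^{ik(\cdot)}\|_{L^p([0,2\pi],Y)}}{\|\sum_ku_ke^{ik(\cdot)}\|_{L^p([0,2\pi],U)}},$$ the supremum being over finite sequences $\{u_k\}_{k=-N}^N$ in $U$, where $\mathcal C\Gamma_{per}^{-1}\mathcal B\in\mathcal L(L^p([0,2\pi],U),L^p([0,2\pi],Y))$.
   Context: Suprema and infima run over all $N$ and all not identically zero finite sequences. The evolution semigroup on $\mathcal F_{per}$ is the strongly continuous semigroup $(E^t_{per}f)(s)=e^{tA}f([s-t]\ (\mathrm{mod}\ 2\pi))$. $\mathcal B:L^p([0,2\pi],U)\to L^p([0,2\pi],X)$ and $\mathcal C:L^p([0,2\pi],X)\to L^p([0,2\pi],Y)$ are pointwise application of $B$ and $C$: $(\mathcal Bu)(s)=Bu(s)$, $(\mathcal Cf)(s)=Cf(s)$. ''Invertible'' means having a bounded everywhere-defined inverse. *)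

(* Defs.v *)
From HB Require Import structures.
From mathcomp Require Import all_boot all_order all_algebra.
From mathcomp Require Import generic_quotient ring_quotient complex.
From mathcomp Require Import all_classical all_reals all_analysis measurable_realfun.

Set Implicit Arguments.
Unset Strict Implicit.
Unset Printing Implicit Defensive.

Import Order.TTheory GRing.Theory Num.Theory.
Import numFieldNormedType.Exports.

Local Open Scope classical_set_scope.
Local Open Scope ring_scope.
Local Open Scope quotient_scope.
Local Open Scope complex_scope.

(* The norm of a normed space over R[i] takes its values in R[i]; rnorm is the
   same norm as a real number. *)
Definition rnorm (R : realType) (V : normedModType R[i]) (x : V) : R :=
  complex.Re `|x|.

Lemma Re_normr_ge0 (R : realType) (a : R[i]) : 0 <= complex.Re `|a|.
Proof. by rewrite -lecR RRe_real ?ger0_real// rmorph0. Qed.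

Section rnorm_theory.
Context (R : realType) (V : normedModType R[i]).
Implicit Types x y : V.

Lemma rnormE x : (rnorm x)%:C = `|x|.
Proof. by rewrite /rnorm RRe_real// ger0_real. Qed.

Lemma rnorm_ge0 x : 0 <= rnorm x.
Proof. by rewrite -lecR rnormE rmorph0. Qed.

Lemma rnorm0 : rnorm (0 : V) = 0.
Proof. by rewrite /rnorm normr0. Qed.

Lemma rnorm_eq0 x : rnorm x = 0 -> x = 0.
Proof. by move=> x0; apply/normr0_eq0; rewrite -rnormE x0. Qed.

Lemma rnormD x y : rnorm (x + y) <= rnorm x + rnorm y.
Proof. by rewrite -lecR rmorphD/= !rnormE ler_normD. Qed.

Lemma rnormZ (a : R[i]) x : rnorm (a *: x) = complex.Re `|a| * rnorm x.
Proof.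
by rewrite /rnorm normrZ -(rnormE x); case: `|a| => u v /=; rewrite mulr0 subr0.
Qed.

Lemma rnorm_cvg (u : nat -> V) x : u @ \oo --> x ->
  (rnorm (u n) @[n --> \oo] --> rnorm x).
Proof.
move=> ux; apply/cvgrPdist_le => /= e e0.
have e0' : 0 < e%:C by rewrite ltcR.
move/cvgrPdist_le : ux => /(_ _ e0'); apply: filterS => n xun.
rewrite -lecR; apply: le_trans xun.
have -> : (`|rnorm x - rnorm (u n)|)%:C = `| `|x| - `|u n| |.
  by rewrite -!rnormE -rmorphB/= normc_def/= expr0n addr0 sqrtr_sqr.
exact: ler_dist_dist.
Qed.

End rnorm_theory.

Section strong_measurability.
Context d (T : measurableType d) (R : realType) (V : normedModType R[i]).
Implicit Types f g : T -> V.

Definition simple_fun f :=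
  finite_set (range f) /\ forall x, measurable (f @^-1` [set x]).

(* The limit is required at every point, not only almost everywhere: this gives
   the same classes modulo equality almost everywhere. *)
Definition strongly_measurable f := exists g : nat -> T -> V,
  (forall n, simple_fun (g n)) /\ (forall t, g n t @[n --> \oo] --> f t).

Lemma simple_fun_preimage f (S : set V) :
  simple_fun f -> measurable (f @^-1` S).
Proof.
move=> [ff mf].
have -> : f @^-1` S = \bigcup_(y in range f `&` S) (f @^-1` [set y]).
  by apply/seteqP; split=> [t St|t [y [_ Sy] /= ->]//]; exists (f t).
by apply: fin_bigcup_measurable => //; exact: finite_setIl.
Qed.

Lemma simple_fun_scale f a : simple_fun f -> simple_fun (fun t => a *: f t).
Proof.
move=> sf; split=> [|x].
  apply: (@sub_finite_set _ _ [set a *: x | x in range f]).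
    by move=> _ [t _ <-]; exists (f t) => //; exists t.
  exact/finite_image/(proj1 sf).
exact: (simple_fun_preimage [set y | a *: y = x] sf).
Qed.

Lemma simple_fun_add f g : simple_fun f -> simple_fun g ->
  simple_fun (fun t => f t + g t).
Proof.
move=> sf sg; split=> [|x].
  apply: (@sub_finite_set _ _ ((fun z => z.1 + z.2) @` (range f `*` range g))).
    by move=> _ [t _ <-]; exists (f t, g t) => //; split; exists t.
  by apply: finite_image; apply: finite_setX; [exact: sf.1|exact: sg.1].
rewrite (_ : _ @^-1` _ = \bigcup_(y in range f)
    (f @^-1` [set y] `&` g @^-1` [set x - y])); last first.
  apply/seteqP; split=> [t /= <-|t [y _ [/= -> ->]]]; last by rewrite addrC subrK.
  by exists (f t) => //; split=> //=; rewrite addrAC subrr add0r.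
apply: fin_bigcup_measurable => [|y _]; first exact: sf.1.
by apply: measurableI; [exact: sf.2|exact: sg.2].
Qed.

Lemma strongly_measurable0 : strongly_measurable (0 : T -> V).
Proof.
exists (fun=> 0); split=> [_|t]; last exact: cvg_cst.
split=> [|x]; last first.
  have [->|x0] := eqVneq x 0; first by rewrite (_ : _ @^-1` _ = setT)//; apply/seteqP.
  rewrite (_ : _ @^-1` _ = set0)//; apply/seteqP; split=> // t /= E.
  by rewrite -E eqxx in x0.
apply: (@sub_finite_set _ _ [set 0]) => //.
by move=> _ [t _ <-].
Qed.

Lemma strongly_measurableD f g : strongly_measurable f ->
  strongly_measurable g -> strongly_measurable (f + g).
Proof.
move=> [f_ [sf cf]] [g_ [sg cg]]; exists (fun n t => f_ n t + g_ n t).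
by split=> [n|t]; [exact: simple_fun_add|apply: cvgD].
Qed.

Lemma strongly_measurableZ a f : strongly_measurable f ->
  strongly_measurable (a *: f).
Proof.
move=> [f_ [sf cf]]; exists (fun n t => a *: f_ n t).
by split=> [n|t]; [exact: simple_fun_scale|exact: cvgZl_tmp].
Qed.

Lemma measurable_rnorm f : strongly_measurable f ->
  measurable_fun [set: T] (fun t => rnorm (f t)).
Proof.
move=> [f_ [sf cf]].
apply: (@measurable_fun_cvg _ _ _ _ (fun n t => rnorm (f_ n t))) => [n|t _].
  move=> _ Y mY; rewrite setTI.
  exact: (simple_fun_preimage (@rnorm R V @^-1` Y) (sf n)).
exact: rnorm_cvg.
Qed.

End strong_measurability.

Section Lp_functions.
Context d (T : measurableType d) (R : realType).
Variables (mu : {measure set T -> \bar R}) (p : R) (p1 : 1 <= p).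
Variable V : normedModType R[i].
Implicit Types f g : T -> V.

Definition Lp_norm f : \bar R := 'N[mu]_p%:E[EFin \o (fun t => rnorm (f t))].

(* The proof of 1 <= p is an argument so that the vector space structure of
   Lp_pred, which depends on it, can be inferred. *)
Definition Lp_pred & 1 <= p : {pred T -> V} :=
  mem [set f | strongly_measurable f /\ (Lp_norm f < +oo)%E].

Local Notation Lp_fun := (Lp_pred p1).

Let p0 : 0 < p. Proof. exact: lt_le_trans p1. Qed.

Lemma Lp_normZ a f : strongly_measurable f ->
  Lp_norm (a *: f) = ((complex.Re `|a|)%:E * Lp_norm f)%E.
Proof.
move=> mf; rewrite /Lp_norm unlock /Lnorm/=.
have a0 := Re_normr_ge0 a.
under eq_integral => t _.
  rewrite rnormZ normrM (ger0_norm a0) powRM// EFinM. over.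
rewrite ge0_integralZl ?lee_fin ?powR_ge0//=.
- rewrite poweRM ?lee_fin ?powR_ge0 ?integral_ge0//.
  by rewrite poweR_EFin -powRrM mulfV ?gt_eqF// powRr1.
- apply/measurable_EFinP.
  apply: (measurableT_comp (measurable_powR _)).
  by apply: measurableT_comp => //; exact: measurable_rnorm.
Qed.

Lemma Lp_normD f g : strongly_measurable f -> strongly_measurable g ->
  (Lp_norm (f + g)%R <= Lp_norm f + Lp_norm g)%E.
Proof.
move=> mf mg.
have mf' := measurable_rnorm mf; have mg' := measurable_rnorm mg.
apply: le_trans (minkowski_EFin mu mf' mg' p1).
have mfg' := measurable_rnorm (strongly_measurableD mf mg).
rewrite /Lp_norm unlock /Lnorm/=.
have m h : measurable_fun [set: T] h ->
    measurable_fun [set: T] (fun t => (`|h t : R| `^ p)%:E).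
  move=> mh; apply/measurable_EFinP.
  apply: (measurableT_comp (measurable_powR _)).
  exact: measurableT_comp.
apply: gt0_ler_poweR; first by rewrite invr_ge0 ltW.
- by rewrite in_itv/= leey integral_ge0// => t _; rewrite lee_fin powR_ge0.
- by rewrite in_itv/= leey integral_ge0// => t _; rewrite lee_fin powR_ge0.
apply: ge0_le_integral => //.
- exact: (m _ mfg').
- exact: (m _ (measurable_funD mf' mg')).
move=> t _; rewrite lee_fin; apply: ge0_ler_powR; rewrite ?nnegrE//.
  exact: ltW.
rewrite !ger0_norm ?addr_ge0 ?rnorm_ge0//.
exact: (rnormD (f t) (g t)).
Qed.

Lemma Lp_norm_eq0 f : strongly_measurable f -> Lp_norm f = 0%E ->
  {ae mu, forall t, f t = 0}.
Proof.
move=> /measurable_rnorm mf f0.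
have /Lnorm_eq0_eq0 H : measurable_fun [set: T] (EFin \o (fun t => rnorm (f t))).
  exact/measurable_EFinP.
have p0' : (0 < p%:E)%E by rewrite lte_fin.
by apply: filterS (H mu p%:E p0' f0) => t /(_ I) [] /rnorm_eq0.
Qed.

Lemma ae_Lp_norm f g : strongly_measurable f -> strongly_measurable g ->
  {ae mu, forall t, f t = g t} -> Lp_norm f = Lp_norm g.
Proof.
move=> mf mg fg; rewrite /Lp_norm unlock /Lnorm/=; congr (_ `^ _)%E.
have m h : strongly_measurable h ->
    measurable_fun [set: T] (fun t => (`|rnorm (h t : V)| `^ p)%:E).
  move=> mh; apply/measurable_EFinP.
  apply: (measurableT_comp (measurable_powR _)).
  by apply: measurableT_comp => //; exact: measurable_rnorm.
apply: ae_eq_integral => //; [exact: m|exact: m|].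
by apply: filterS fg => t -> _.
Qed.

Lemma Lp_fun_submod_closed : submod_closed Lp_fun.
Proof.
split=> [|a f g].
  rewrite inE/=; split; first exact: strongly_measurable0.
  rewrite /Lp_norm (_ : (fun _ => _) = cst 0).
    by rewrite Lnorm0 ?ltry// eqe gt_eqF.
  by apply/funext => t; rewrite rnorm0.
rewrite !inE/= => -[mf ff] [mg fg].
have maf : strongly_measurable (a *: f) by exact: strongly_measurableZ.
split; first exact: strongly_measurableD.
rewrite (le_lt_trans (Lp_normD maf mg))// lte_add_pinfty//.
by rewrite Lp_normZ// lte_mul_pinfty// lee_fin Re_normr_ge0.
Qed.

HB.instance Definition _ :=
  GRing.isSubmodClosed.Build _ _ Lp_fun Lp_fun_submod_closed.

Record LpFun := MkLpFun { LpFun_fun :> T -> V; LpFun_mem : LpFun_fun \in Lp_fun }.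

HB.instance Definition _ := [isSub for LpFun_fun].
HB.instance Definition _ := [Choice of LpFun by <:].
HB.instance Definition _ := [SubChoice_isSubLmodule of LpFun by <:].

Definition Lp_null : {pred LpFun} :=
  mem [set f : LpFun | {ae mu, forall t, f t = 0}].

Lemma Lp_null_zmod_closed : zmod_closed Lp_null.
Proof.
split=> [|f g]; first by rewrite inE/=; exact: nearW.
rewrite !inE/= => f0 g0; apply: filterS2 f0 g0 => t ft gt.
by rewrite !fctE ft gt subr0.
Qed.

HB.instance Definition _ :=
  GRing.isZmodClosed.Build _ Lp_null Lp_null_zmod_closed.

End Lp_functions.

Section Lp_space.
Context d (T : measurableType d) (R : realType).
Variables (mu : {measure set T -> \bar R}) (p : R) (p1 : 1 <= p).
Variable V : normedModType R[i].

Definition Lp := {ideal_quot (@Lp_null _ _ _ mu p p1 V)}.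

HB.instance Definition _ := GRing.Zmodule.on Lp.
HB.instance Definition _ := EqQuotient.on Lp.

Implicit Types F G : Lp.

Lemma Lp_eqP (f g : LpFun mu p1 V) :
  reflect {ae mu, forall t, f t = g t} (f == g %[mod Lp]).
Proof.
rewrite -Quotient.idealrBE; apply: (iffP idP); rewrite inE/=; apply: filterS => t.
  by rewrite !fctE => /subr0_eq.
by move=> fg; rewrite !fctE fg subrr.
Qed.

Lemma Lp_reprP (f : LpFun mu p1 V) :
  {ae mu, forall t, repr (\pi_Lp f) t = f t}.
Proof. by apply/Lp_eqP; rewrite reprK. Qed.

Lemma Lp_eq F G : {ae mu, forall t, repr F t = repr G t} -> F = G.
Proof. by move/Lp_eqP/eqP; rewrite !reprK. Qed.

Lemma Lp_reprD F G : {ae mu, forall t, repr (F + G) t = repr F t + repr G t}.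
Proof.
have : {ae mu, forall t, repr (\pi_Lp (repr F + repr G)) t = (repr F + repr G) t}.
  exact: Lp_reprP.
by rewrite [\pi_Lp _]raddfD/= !reprK.
Qed.

Definition Lp_scale (a : R[i]) F : Lp := \pi_Lp (a *: repr F).

Lemma Lp_reprZ a F : {ae mu, forall t, repr (Lp_scale a F) t = a *: repr F t}.
Proof. exact: Lp_reprP. Qed.

Lemma Lp_scaleA a b F : Lp_scale a (Lp_scale b F) = Lp_scale (a * b) F.
Proof.
apply/Lp_eq; near=> t; rewrite (near (Lp_reprZ a (Lp_scale b F)) t)//.
by rewrite (near (Lp_reprZ b F) t)// (near (Lp_reprZ (a * b) F) t)// scalerA.
Unshelve. all: by end_near. Qed.

Lemma Lp_scale1 : left_id 1 Lp_scale.
Proof. by move=> F; rewrite /Lp_scale scale1r reprK. Qed.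

Lemma Lp_scaleDr : right_distributive Lp_scale +%R.
Proof.
move=> a F G; apply/Lp_eq; near=> t.
rewrite (near (Lp_reprZ a (F + G)) t)// (near (Lp_reprD F G) t)//.
rewrite (near (Lp_reprD (Lp_scale a F) (Lp_scale a G)) t)// scalerDr.
by rewrite (near (Lp_reprZ a F) t)// (near (Lp_reprZ a G) t).
Unshelve. all: by end_near. Qed.

Lemma Lp_scaleDl F : {morph Lp_scale^~ F : a b / a + b}.
Proof.
move=> a b; apply/Lp_eq; near=> t.
rewrite (near (Lp_reprZ (a + b) F) t)//.
rewrite (near (Lp_reprD (Lp_scale a F) (Lp_scale b F)) t)// scalerDl.
by rewrite (near (Lp_reprZ a F) t)// (near (Lp_reprZ b F) t).
Unshelve. all: by end_near. Qed.

HB.instance Definition _ := GRing.Zmodule_isLmodule.Build R[i] Lp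
  Lp_scaleA Lp_scale1 Lp_scaleDr Lp_scaleDl.

Definition Lp_nrm F : R[i] := (fine (Lp_norm mu p (repr F)))%:C.

Let repr_meas F : strongly_measurable (repr F).
Proof. by have := LpFun_mem (repr F); rewrite inE => -[]. Qed.

Let repr_fin F : Lp_norm mu p (repr F) \is a fin_num.
Proof.
have := LpFun_mem (repr F); rewrite inE => -[_ ?].
by rewrite ge0_fin_numE// Lnorm_ge0.
Qed.

Lemma ler_Lp_nrmD F G : Lp_nrm (F + G) <= Lp_nrm F + Lp_nrm G.
Proof.
rewrite -rmorphD lecR -fineD// fine_le ?fin_numD ?repr_fin//.
have mFG := strongly_measurableD (repr_meas F) (repr_meas G).
rewrite (ae_Lp_norm p (repr_meas _) mFG (Lp_reprD F G)).
exact: Lp_normD.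
Qed.

Lemma Lp_nrmZ a F : Lp_nrm (a *: F) = `|a| * Lp_nrm F.
Proof.
rewrite -[`|a|]RRe_real ?ger0_real// -rmorphM; congr _%:C.
have mF := strongly_measurableZ a (repr_meas F).
rewrite (ae_Lp_norm p (repr_meas _) mF (Lp_reprZ a F)) Lp_normZ//.
by rewrite fineM.
Qed.

Lemma Lp_nrm0_eq0 F : Lp_nrm F = 0 -> F = 0.
Proof.
move=> /complexI F0; apply/Lp_eq.
have {}F0 : Lp_norm mu p (repr F) = 0%E by rewrite -(fineK (repr_fin F)) F0.
have r0 : {ae mu, forall t, repr (0 : Lp) t = 0}.
  have := @Lp_reprP 0; rewrite raddf0; exact.
apply: filterS2 r0 (Lp_norm_eq0 p1 (repr_meas F) F0).
by move=> t -> ->.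
Qed.

HB.instance Definition _ := Lmodule_isNormed.Build R[i] Lp
  ler_Lp_nrmD Lp_nrmZ Lp_nrm0_eq0.

(* The class of f in the Lp space; by convention it is 0 when f is not strongly
   measurable or its norm is infinite. *)
Definition Lp_class (f : T -> V) : Lp := \pi_Lp (insubd (0 : LpFun mu p1 V) f).

Lemma Lp_classP (f : T -> V) : strongly_measurable f ->
  (Lp_norm mu p f < +oo)%E -> {ae mu, forall t, repr (Lp_class f) t = f t}.
Proof.
move=> mf ff; have Lf : f \in Lp_pred mu p1 by rewrite inE.
have := Lp_reprP (insubd (0 : LpFun mu p1 V) f); apply: filterS => t ->.
exact: (congr1 (@^~ t) (insubdK 0 Lf)).
Qed.

End Lp_space.

(* Possibly unbounded operators: the values of op_fun outside dom are junk. *)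
Record operator (V W : Type) := Operator { dom : set V; op_fun :> V -> W }.

Definition total_op (V W : Type) (f : V -> W) : operator V W := Operator setT f.

Section operators.
Context (R : realType) (V W : normedModType R[i]).

Definition op_add (A : operator V W) (K : V -> W) : operator V W :=
  Operator (dom A) (fun x => A x + K x).

Definition op_shift (A : operator V V) (z : R[i]) : operator V V :=
  Operator (dom A) (fun x => A x - z *: x).

Definition invertible (A : operator V W) := exists B : W -> V,
  [/\ linear B, continuous B, forall y, dom A (B y) /\ A (B y) = y &
      forall x, dom A x -> B (A x) = x].

Definition op_inv (A : operator V W) (y : W) : V :=
  get [set x | dom A x /\ A x = y].

Definition opnorm (f : V -> W) : \bar R :=
  ereal_sup [set (rnorm (f x))%:E | x in [set x | rnorm x <= 1]].

End operators.

Section semigroups.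
Context (R : realType) (V : normedModType R[i]).

Definition resolvent_set (A : operator V V) : set R[i] :=
  [set z | invertible (Operator (dom A) (fun x => z *: x - A x))].

Definition c0_semigroup (T : R -> V -> V) :=
  [/\ forall t, 0 <= t -> linear (T t) /\ continuous (T t),
      T 0 = id,
      forall s t, 0 <= s -> 0 <= t -> T (s + t) = T s \o T t &
      forall x, T t x @[t --> 0^'+] --> x].

Definition generator (T : R -> V -> V) : operator V V :=
  Operator [set x | cvg ((t^-1)%:C *: (T t x - x) @[t --> 0^'+])]
           (fun x => lim ((t^-1)%:C *: (T t x - x) @[t --> 0^'+])).

Definition generates (A : operator V V) (T : R -> V -> V) :=
  [/\ c0_semigroup T, dom A = dom (generator T) &
      forall x, dom A x -> A x = generator T x].

End semigroups.

Section periodic.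
Context (R : realType) (p : R) (p1 : 1 <= p).

(* Functions on [0, 2 pi] are represented by functions on R; their values
   outside [0, 2 pi] are irrelevant since this measure does not charge them. *)
Definition lebesgue_2pi : {measure set (measurableTypeR R) -> \bar R} :=
  mrestr lebesgue_measure (measurable_itv `[(0 : R), 2 * pi]).

Definition Lper (V : normedModType R[i]) := Lp lebesgue_2pi p1 V.

HB.instance Definition _ V := NormedModule.on (Lper V).

Definition Lper_class (V : normedModType R[i]) (f : R -> V) : Lper V :=
  Lp_class lebesgue_2pi p1 f.

Definition Lper_fun (V : normedModType R[i]) (F : Lper V) : R -> V :=
  repr (F : Lp lebesgue_2pi p1 V).

Definition pointwise (V W : normedModType R[i]) (B : V -> W) (F : Lper V) :
  Lper W := Lper_class (fun s => B (Lper_fun F s)).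

(* s modulo 2 pi, in [0, 2 pi[ *)
Definition mod2pi (s : R) : R :=
  s - 2 * pi * (Num.floor (s / (2 * pi)))%:~R.

Definition evolution (V : normedModType R[i]) (T : R -> V -> V) (t : R)
    (F : Lper V) : Lper V :=
  Lper_class (fun s => T t (Lper_fun F (mod2pi (s - t)))).

Definition ik (k : int) : R[i] := 0 +i* k%:~R.

Definition expik (k : int) (s : R) : R[i] :=
  cos (k%:~R * s) +i* sin (k%:~R * s).

Definition fourier_sum (V : normedModType R[i]) (N : nat) (v : int -> V)
    (s : R) : V :=
  \sum_(j < N.*2.+1) let k := (j : nat)%:Z - N%:Z in expik k s *: v k.

(* The quotients |sum_k (M_k v_k) e^(ik.)| / |sum_k v_k e^(ik.)| over all the
   not identically zero sequences (v_k), -N <= k <= N, with terms in D. *)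
Definition fourier_quotients (V W : normedModType R[i]) (D : set V)
    (M : int -> V -> W) : set (\bar R) :=
  [set r | exists (N : nat) (v : int -> V),
    [/\ forall k : int, (`|k| <= N)%N -> D (v k),
        exists2 k : int, (`|k| <= N)%N & v k != 0 &
        r = (rnorm (Lper_class (fourier_sum N (fun k => M k (v k)))) /
             rnorm (Lper_class (fourier_sum N v)))%:E]].

End periodic.

Arguments Lper_class {R p} p1 {V} f.
Arguments pointwise {R p} p1 {V W} B F.
Arguments evolution {R p} p1 {V} T t F.
Arguments ik {R} k.
Arguments fourier_quotients {R p} p1 {V W} D M.

(* The supremum of a set of nonnegative numbers in [0, +oo]: that of the empty
   set, which arises when the space is zero, is 0. *)
Definition ge0_sup (R : realType) (S : set (\bar R)) : \bar R :=
  ereal_sup ([set 0%E] `|` S).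

(* Main.v *)
(* Write D for A + B Delta C, S for its semigroup, and, for a trigonometric polynomial
   g = sum_k w_k e^(ik.) with w_k in Dom D, f = sum_k (D - ik) w_k e^(ik.). Then
   S(h) g(s - h) = g(s) + h f(s) + o(h) uniformly in s, and telescoping gives the Duhamel
   estimate relating S(t) g(s - t) - g(s) to f on [s - t, s].

   (i) => (ii): the evolution semigroup at time 2 pi acts on periodic functions as pointwise
   application of S(2 pi), so (1 - S(2 pi)) g is O(f) in L^p and 1 - S(2 pi) can be inverted.
   The inverse of D - ik is obtained the same way from the rescaled semigroup e^(-ikt) S(t).
   (ii) <=> (iii) needs only the injectivity of v |-> sum_k v_k e^(ik.).
   (iii) => (i): for x in X approximate (1 - cos s) S(s) x uniformly by Fejer polynomials f_n and
   solve for g_n. The L^p bound and Duhamel's formula make g_n(0) converge, to y say, with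
   S(2 pi) y - y = 2 pi S(2 pi) x, so x - y / (2 pi) is a preimage of x under 1 - S(2 pi).

   For the input-output norm, Gamma acts on trigonometric polynomials as the multiplier A - ik;
   these are dense in L^p, and both the inverse of Gamma and the norm identity follow by
   approximation. *)

Require Import Defs.
From HB Require Import structures.
From mathcomp Require Import all_boot all_order all_algebra.
From mathcomp Require Import complex.
From mathcomp Require Import all_classical all_reals all_analysis.
From mathcomp Require Import measurable_realfun.
From mathcomp Require Import ring lra zify ssrAC.

Set Implicit Arguments.
Unset Strict Implicit.
Unset Printing Implicit Defensive.

Import Order.TTheory GRing.Theory Num.Theory.
Import numFieldNormedType.Exports.

Local Open Scope classical_set_scope.
Local Open Scope ring_scope.
Local Open Scope complex_scope.

(** * Linear maps and inverses in real norms *)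

(** Integrals of [X]-valued functions are replaced by finite Riemann and telescoping sums with
    explicit errors, and limits of vectors are taken in the complete space [X], pointwise or
    uniformly in s. The obstacle in (iii) => (i) is that the multiplier bound controls g_n only in
    L^p, while a preimage needs its value at one point. The L^p bound controls g_n at some point of
    [0, 2 pi], and Duhamel's formula transports this control to 2 pi. The weight 1 - cos s vanishes
    at 0 and 2 pi, so the weighted orbit closes up to a continuous function on the circle, where
    Fejer sums converge uniformly; its integral is the factor 2 pi in S(2 pi) y - y = 2 pi S(2 pi)
    x. The same y gives injectivity: if S(2 pi) x = x, then every g_n(0), hence y, is fixed by S(2
    pi), so 2 pi S(2 pi) x = 0. For Gamma, inverting 1 - S(2 pi) bounds the sup norm of a
    trigonometric solution by the L^p norm of its right-hand side, so that approximate solutions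
    converge uniformly. *)

Section rnorm_facts.
Context (R : realType).
Implicit Types V W : normedModType R[i].

Lemma rnormN V (x : V) : rnorm (- x) = rnorm x.
Proof. by rewrite /rnorm normrN. Qed.

Lemma rnormB V (x y : V) : rnorm (x - y) = rnorm (y - x).
Proof. by rewrite -rnormN opprB. Qed.

Lemma rnormZr V (a : R) (x : V) : rnorm (a%:C *: x) = `|a| * rnorm x.
Proof. by rewrite rnormZ normc_def/= expr0n addr0 sqrtr_sqr. Qed.

Lemma rnorm_sum V I (r : seq I) (P : pred I) (F : I -> V) :
  rnorm (\sum_(i <- r | P i) F i) <= \sum_(i <- r | P i) rnorm (F i).
Proof.
elim/big_rec2: _ => [|i a x _ h]; first by rewrite rnorm0.
by apply: le_trans (rnormD _ _) _; rewrite lerD2l.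
Qed.

Lemma rnorm_triangle V (x y z : V) : rnorm (x - z) <= rnorm (x - y) + rnorm (y - z).
Proof. by apply: le_trans (rnormD _ _); rewrite addrA subrK. Qed.

Lemma ler_rnormB V (x y : V) : rnorm x - rnorm y <= rnorm (x - y).
Proof. by rewrite lerBlDr -{1}(subrK y x); exact: rnormD. Qed.

Lemma rnorm_le0 V (x : V) : (forall e : R, 0 < e -> rnorm x <= e) -> x = 0.
Proof.
move=> h; apply: rnorm_eq0; apply/eqP; rewrite eq_le rnorm_ge0 andbT.
by apply/ler_addgt0Pl => e /h; rewrite addr0.
Qed.

Lemma rnorm_cvgP V (T : Type) (F : set_system T) {FF : Filter F} (f : T -> V) x :
  f @ F --> x <-> forall e : R, 0 < e -> \forall t \near F, rnorm (f t - x) <= e.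
Proof.
split=> [/cvgrPdistC_le h e e0|h].
  have := h e%:C; rewrite ltcR => /(_ e0); apply: filterS => t.
  by rewrite -rnormE lecR.
apply/cvgrPdistC_le => e e0.
(* The order of [R[i]] makes every positive element real. *)
have eE : e = (complex.Re e)%:C by rewrite RRe_real// gtr0_real.
move: e0; rewrite eE ltcR => e0; apply: filterS (h _ e0) => t.
by rewrite -rnormE lecR.
Qed.

Lemma rnorm_cvgnP V (u : nat -> V) x : u @ \oo --> x <->
  forall e : R, 0 < e -> exists n0 : nat, forall n, (n0 <= n)%N -> rnorm (u n - x) <= e.
Proof.
rewrite rnorm_cvgP; split=> h e /h.
  by case=> n0 _ h0; exists n0 => n /h0.
by case=> n0 h0; exists n0.
Qed.

Lemma rnorm_cauchy (V : completeNormedModType R[i]) (u : nat -> V) :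
  (forall e : R, 0 < e -> exists n0 : nat, forall n m, (n0 <= n)%N -> (n0 <= m)%N ->
     rnorm (u n - u m) <= e) -> exists x : V, u @ \oo --> x.
Proof.
move=> h; suff : cvg (u @ \oo) by exists (lim (u @ \oo)).
apply/cauchy_cvgP/cauchy_ballP => e e0.
have eE : e = (complex.Re e)%:C by rewrite RRe_real// gtr0_real.
move: e0; rewrite eE ltcR => e0.
have [|n0 h0] := h (complex.Re e / 2); first by rewrite divr_gt0.
exists (u @` [set n | (n0 <= n)%N], u @` [set n | (n0 <= n)%N]) => /=.
  by split; exists n0 => // n nn; exists n.
move=> [_ _] [[n nn <-] [m mm <-]] /=; rewrite -ball_normE/= eE -rnormE ltcR.
by apply: le_lt_trans (h0 _ _ nn mm) _; rewrite ltr_pdivrMr// ltr_pMr// ltr1n.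
Qed.

Lemma rnorm_at_rightP V (f : R -> V) x : f t @[t --> 0^'+] --> x <->
  forall e : R, 0 < e -> exists2 d : R, 0 < d & forall t, 0 < t -> t < d -> rnorm (f t - x) <= e.
Proof.
rewrite rnorm_cvgP; split=> h e /h.
  case=> d /= d0 hd; exists d => // t t0 td; apply: hd => //=.
  by rewrite sub0r normrN gtr0_norm.
case=> d d0 hd; exists d => //= t /=; rewrite sub0r normrN => td t0.
by apply: hd => //; rewrite -(gtr0_norm t0).
Qed.

Section linear_maps.
Context V W (f : V -> W) (lf : linear f).

Lemma linfD x y : f (x + y) = f x + f y.
Proof. by have := lf 1 x y; rewrite !scale1r. Qed.

Lemma linf0 : f 0 = 0.
Proof. by apply: (addrI (f 0)); rewrite -linfD !addr0. Qed.

Lemma linfZ a x : f (a *: x) = a *: f x.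
Proof. by have := lf a x 0; rewrite !addr0 linf0 addr0. Qed.

Lemma linfN x : f (- x) = - f x.
Proof. by rewrite -scaleN1r linfZ scaleN1r. Qed.

Lemma linfB x y : f (x - y) = f x - f y.
Proof. by rewrite linfD linfN. Qed.

Lemma linf_sum I (r : seq I) (P : pred I) (F : I -> V) :
  f (\sum_(i <- r | P i) F i) = \sum_(i <- r | P i) f (F i).
Proof. by elim/big_rec2: _ => [|i y x _ <-]; rewrite ?linf0 ?linfD. Qed.

Lemma bounded_linf_continuous (K : R) :
  (forall x, rnorm (f x) <= K * rnorm x) -> continuous f.
Proof.
move=> hK x; apply/rnorm_cvgP => e e0.
have K1 : 0 < `|K| + 1 by rewrite ltr_wpDl.
have := @cvg_id _ (nbhs x) => /rnorm_cvgP /(_ (e / (`|K| + 1))).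
rewrite divr_gt0// => /(_ erefl); apply: filterS => y hy.
rewrite -linfB; apply: le_trans (hK _) _.
have : (`|K| + 1) * rnorm (y - x) <= e by rewrite mulrC -ler_pdivlMr.
apply: le_trans; apply: ler_wpM2r; first exact: rnorm_ge0.
by apply: le_trans (ler_norm K) _; rewrite lerDl.
Qed.

Lemma continuous_linf_bounded : continuous f ->
  exists2 K : R, 0 < K & forall x, rnorm (f x) <= K * rnorm x.
Proof.
move=> /(_ 0) /rnorm_cvgP /(_ 1 ltr01); rewrite linf0 => h.
have [d d0 hd] : exists2 d : R, 0 < d & forall x, rnorm x < d -> rnorm (f x) <= 1.
  case/nbhs_ballP: h => e /= e0 he; exists (complex.Re e).
    by rewrite -ltcR RRe_real// gtr0_real.
  move=> x xe; rewrite -(subr0 (f x)); apply: he; rewrite -ball_normE/= sub0r normrN.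
  by rewrite -rnormE -(RRe_real (gtr0_real e0)) ltcR.
(* Scaling x to norm d / 2, strictly inside the ball where f is bounded by 1, gives the factor 2 /
   d. *)
exists (2 / d) => [|x]; first by rewrite divr_gt0.
have [->|x0] := eqVneq x 0; first by rewrite linf0 !rnorm0 mulr0.
have x0' : 0 < rnorm x.
  by rewrite lt_neqAle rnorm_ge0 andbT eq_sym; apply: contra_neq x0 => /rnorm_eq0.
have c0 : 0 < d / 2 / rnorm x by rewrite !divr_gt0.
have := hd ((d / 2 / rnorm x)%:C *: x); rewrite linfZ !rnormZr !gtr0_norm//.
rewrite divfK ?gt_eqF// => /(_ _).
have -> : d / 2 < d by rewrite ltr_pdivrMr// ltr_pMr// ltr1n.
move=> /(_ isT) h1; rewrite -(ler_pM2l c0); apply: le_trans h1 _.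
rewrite le_eqVlt; apply/orP; left; apply/eqP.
by field; rewrite !gt_eqF.
Qed.

End linear_maps.

(* Reduces invertibility to an a priori bound on one preimage of every point. *)
Lemma invertible_bijective V W (A : operator V W) (K : R) :
  (forall a x y, dom A x -> dom A y ->
     dom A (a *: x + y) /\ A (a *: x + y) = a *: A x + A y) ->
  (forall x, dom A x -> A x = 0 -> x = 0) ->
  (forall y, exists x, [/\ dom A x, A x = y & rnorm x <= K * rnorm y]) ->
  invertible A.
Proof.
move=> lA iA sA.
pose B y := projT1 (cid (sA y)).
have BP y : [/\ dom A (B y), A (B y) = y & rnorm (B y) <= K * rnorm y].
  exact: projT2 (cid (sA y)).
have inj x y : dom A x -> dom A y -> A x = A y -> x = y.
  move=> dx dy xy; apply/eqP; rewrite -subr_eq0; apply/eqP.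
  have [d1 e1] := lA (-1) y x dy dx.
  by rewrite addrC -scaleN1r; apply: iA => //; rewrite e1 xy scaleN1r addNr.
have lB : linear B.
  move=> a x y; have [dx Ax _] := BP x; have [dy Ay _] := BP y.
  have [dxy Axy _] := BP (a *: x + y); have [dB AB] := lA a _ _ dx dy.
  by apply: inj => //; rewrite Axy AB Ax Ay.
exists B; split=> //.
- by apply: (bounded_linf_continuous lB (K := K)) => y; have [] := BP y.
- by move=> y; have [] := BP y.
- by move=> x dx; have [dB AB _] := BP (A x); exact: inj.
Qed.

Lemma invertible_injective V W (A : operator V W) : invertible A ->
  forall x y, dom A x -> dom A y -> A x = A y -> x = y.
Proof.
by move=> [B [_ _ _ BA]] x y dx dy xy; rewrite -(BA x)// xy BA.
Qed.

Lemma op_invP V W (A : operator V W) : invertible A ->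
  forall y, dom A (op_inv A y) /\ A (op_inv A y) = y.
Proof.
move=> [B [_ _ AB _]] y.
exact: (@getI _ [set x | dom A x /\ A x = y] (B y) (AB y)).
Qed.

Lemma op_invE V W (A : operator V W) : invertible A ->
  forall x, dom A x -> op_inv A (A x) = x.
Proof.
move=> iA x dx; have [d e] := op_invP iA (A x).
exact: (invertible_injective iA).
Qed.

Lemma op_inv_linear V W (A : operator V W) : invertible A -> linear (op_inv A).
Proof.
move=> iA; have [B [lB _ AB BA]] := iA.
suff -> : op_inv A = B by [].
by apply/funext => y; have [d e] := op_invP iA y; rewrite -{2}e BA.
Qed.

Lemma op_inv_bounded V W (A : operator V W) : invertible A ->
  exists2 K : R, 0 < K & forall y, rnorm (op_inv A y) <= K * rnorm y.
Proof.
move=> iA; have [B [lB cB AB BA]] := iA.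
suff -> : op_inv A = B by exact: continuous_linf_bounded.
by apply/funext => y; have [d e] := op_invP iA y; rewrite -{2}e BA.
Qed.

End rnorm_facts.

(** * The uniform boundedness principle *)

Section uniform_boundedness.
Context (R : realType) (V : completeNormedModType R[i]) (W : normedModType R[i]).
Variable f : nat -> V -> W.
Hypothesis lf : forall n, linear (f n).

(* Sokal's argument: one of f (x + y), f (x - y) is at least as large as f y. *)
Let push n (x y : V) : exists2 z, rnorm (z - x) = rnorm y & rnorm (f n y) <= rnorm (f n z).
Proof.
have [h|h] := leP (rnorm (f n y)) (rnorm (f n (x + y))).
  by exists (x + y) => //; rewrite addrC addKr.
exists (x - y); first by rewrite addrC addKr rnormN.
have : 2 * rnorm (f n y) <= rnorm (f n (x + y)) + rnorm (f n (x - y)).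
  rewrite -{1}(@ger0_norm _ (2 : R))// -rnormZr -linfZ//.
  have -> : (2 : R)%:C *: y = (x + y) - (x - y).
    by rewrite opprB addrCA addrAC subrr add0r rmorphD/= scalerDl scale1r.
  by rewrite linfB//; apply: le_trans (rnormD _ _) _; rewrite rnormN.
by move=> h2; lra.
Qed.

Hypothesis cf : forall n, continuous (f n).
Hypothesis f_pointwise : forall x, exists K : R, forall n, rnorm (f n x) <= K.

(** Gliding hump: otherwise nested balls can be chosen so that on the k-th one some [f n] is at
    least k everywhere, and their common point contradicts pointwise boundedness. *)
Theorem uniform_boundedness : exists2 K : R, 0 < K & forall n x, rnorm (f n x) <= K * rnorm x.
Proof.
apply: contrapT => nK.
have big (K r : R) : 0 < r -> exists n x, rnorm x <= r /\ K < rnorm (f n x).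
  move=> r0; apply: contrapT => h; apply: nK; exists ((`|K| + 1) / r).
    by rewrite divr_gt0// ltr_wpDl.
  move=> n x; have [->|x0] := eqVneq x 0; first by rewrite linf0// !rnorm0 mulr0.
  have x0' : 0 < rnorm x.
    by rewrite lt_neqAle rnorm_ge0 andbT eq_sym; apply: contra_neq x0 => /rnorm_eq0.
  rewrite leNgt; apply/negP => h1; apply: h.
  have c0 : 0 < r / rnorm x by rewrite divr_gt0.
  exists n, ((r / rnorm x)%:C *: x); rewrite linfZ// !rnormZr gtr0_norm//.
  split; first by rewrite divfK ?gt_eqF.
  rewrite mulrAC ltr_pdivlMr//.
  have : r * ((`|K| + 1) / r * rnorm x) < r * rnorm (f n x) by rewrite ltr_pM2l.
  apply: le_lt_trans; rewrite mulrA [r * _]mulrC divfK ?gt_eqF// ler_pM2r//.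
  by apply: le_trans (ler_norm K) _; rewrite lerDl.
(* [xr] is a ball (centre, radius). By [push], a point within half the radius has some [f n] above k
   + 1, and within 1 / K of that point [f n] varies by at most 1. The premise on the radius makes
   the step total, so that it can be iterated. *)
have step k (xr : V * R) : exists xr' : V * R, 0 < xr.2 ->
    [/\ 0 < xr'.2, rnorm (xr'.1 - xr.1) <= xr.2 / 2, xr'.2 <= xr.2 / 2 &
    exists n, forall z, rnorm (z - xr'.1) <= xr'.2 -> k%:R <= rnorm (f n z)].
  case: xr => x r /=; have [r0|] := ltP 0 r; last by exists (x, r).
  have [n [y [yr fy]]] := big (k%:R + 1) (r / 2) (divr_gt0 r0 (ltr0n _ 2)).
  have [x' x'x fx'] := push n x y.
  have [K K0 hK] := continuous_linf_bounded (lf n) (@cf n).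
  exists (x', Num.min (r / 2) K^-1) => _ /=; split.
  - by rewrite lt_min divr_gt0// invr_gt0.
  - by rewrite x'x.
  - by rewrite ge_min lexx.
  - exists n => z; rewrite le_min => /andP[_ hz].
    have h1 : rnorm (f n (z - x')) <= 1.
      by apply: le_trans (hK _) _; rewrite -ler_pdivlMl// mulr1.
    have := ler_rnormB (f n x') (f n z); rewrite rnormB -linfB// => h2.
    by lra.
have [s hs] : exists s : nat -> V * R, (s 0%N).2 = 1 /\ forall k, 0 < (s k).2 ->
    [/\ 0 < (s k.+1).2, rnorm ((s k.+1).1 - (s k).1) <= (s k).2 / 2,
      (s k.+1).2 <= (s k).2 / 2 &
    exists n, forall z, rnorm (z - (s k.+1).1) <= (s k.+1).2 -> k%:R <= rnorm (f n z)].
  pose s := fix s k := if k is k'.+1 then projT1 (cid (step k' (s k'))) else (0, 1).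
  by exists s; split=> // k; exact: (projT2 (cid (step k (s k)))).
have s0 k : 0 < (s k).2.
  by elim: k => [|k ih]; [rewrite hs.1|have [] := hs.2 k ih].
(* Each centre moves by at most half the radius, while the radius loses at least half: the closed
   balls are nested. *)
have nest k m : rnorm ((s (k + m)%N).1 - (s k).1) <= (s k).2 - (s (k + m)%N).2.
  elim: m => [|m ih]; first by rewrite addn0 !subrr rnorm0.
  rewrite addnS; have [_ h1 h2 _] := hs.2 _ (s0 (k + m)%N).
  by have := rnorm_triangle (s (k + m).+1).1 (s (k + m)%N).1 (s k).1; lra.
have small k : (s k).2 <= 2^-1 ^+ k.
  elim: k => [|k ih]; first by rewrite hs.1 expr0.
  by have [_ _ h2 _] := hs.2 _ (s0 k); rewrite exprS; lra.
have [x xl] : exists x : V, (fun k => (s k).1) @ \oo --> x.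
  apply: rnorm_cauchy => e e0.
  have [N hN] : exists N : nat, forall k, (N <= k)%N -> 2^-1 ^+ k <= (e / 2 : R).
    have : (fun k => (2^-1 : R) ^+ k) @ \oo --> (0 : R).
      by apply: cvg_expr; rewrite ger0_norm// invf_lt1// ltr1n.
    move=> /cvgrPdist_le /(_ (e / 2)); rewrite divr_gt0// => /(_ isT) [N _ hN].
    by exists N => k /hN; rewrite /= sub0r normrN ger0_norm// exprn_ge0.
  exists N => n m Nn Nm.
  have h k : (N <= k)%N -> rnorm ((s k).1 - (s N).1) <= e / 2.
    move=> Nk; have := nest N (k - N)%N; rewrite subnKC// => h.
    have := small N; have := hN N (leqnn N); have := s0 k.
    by lra.
  have := rnorm_triangle (s n).1 (s N).1 (s m).1; rewrite (rnormB (s N).1).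
  by have := h n Nn; have := h m Nm; lra.
have xin k : rnorm (x - (s k).1) <= (s k).2.
  apply/ler_addgt0Pr => e e0.
  have /rnorm_cvgnP /(_ e e0) [N hN] := xl.
  have h1 := nest k N; have := hN (k + N)%N (leq_addl _ _); rewrite rnormB => h2.
  have := rnorm_triangle x (s (k + N)%N).1 (s k).1; have := s0 (k + N)%N.
  by lra.
have [K hK] := f_pointwise x.
have [k hk] : exists k : nat, K < k%:R.
  by exists (Num.truncn `|K|).+1; apply: le_lt_trans (ler_norm K) (truncnS_gt _).
have [_ _ _ [n hn]] := hs.2 k (s0 k).
by have := hK n; have := hn x (xin k.+1); lra.
Qed.

End uniform_boundedness.

(** * Characters and trigonometric sums *)

Section expik_theory.
Context (R : realType).
Implicit Types (k l : int) (s t : R).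

Lemma expikD k s t : expik k (s + t) = expik k s * expik k t.
Proof.
rewrite /expik mulrDr cosD sinD; apply/eqP; rewrite eq_complex/=.
by apply/andP; split; apply/eqP; ring.
Qed.

Lemma expikDk k l s : expik (k + l) s = expik k s * expik l s.
Proof.
rewrite /expik intrD mulrDl cosD sinD; apply/eqP; rewrite eq_complex/=.
by apply/andP; split; apply/eqP; ring.
Qed.

Lemma expik0 k : expik k (0 : R) = 1.
Proof. by rewrite /expik mulr0 cos0 sin0. Qed.

Lemma expik0k s : expik 0 s = 1.
Proof. by rewrite /expik mul0r cos0 sin0. Qed.

Lemma expikN k s : expik k (- s) = (expik k s)^*%C.
Proof. by rewrite /expik mulrN cosN sinN. Qed.

Lemma expikNk k s : expik (- k) s = expik k (- s).
Proof. by rewrite /expik mulrNz mulNr mulrN. Qed.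

Lemma norm_expik k s : complex.Re `|expik k s| = 1.
Proof. by rewrite normc_def/= cos2Dsin2 sqrtr1. Qed.

Lemma rnorm_expikZ (V : normedModType R[i]) k s (x : V) : rnorm (expik k s *: x) = rnorm x.
Proof. by rewrite rnormZ norm_expik mul1r. Qed.

Lemma expikNM k s : expik k (- s) * expik k s = 1.
Proof. by rewrite -expikD addNr expik0. Qed.

Lemma expik2pi k : expik k (2 * pi : R) = 1.
Proof.
suff H (n : nat) : expik n%:Z (2 * pi : R) = 1.
  case: k => n; first exact: H.
  by rewrite NegzE expikNk expikN H conjc1.
elim: n => [|n ih]; first exact: expik0k.
rewrite -addn1 PoszD expikDk ih mul1r /expik mul1r.
by rewrite mulr_natl cos2pi sin2pi.
Qed.

Lemma expik_period k s (m : int) : expik k (s + 2 * pi * m%:~R) = expik k s.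
Proof.
rewrite expikD -[RHS]mulr1; congr (_ * _).
have -> : expik k (2 * pi * m%:~R) = expik (k * m) (2 * pi : R).
  by rewrite /expik intrM mulrCA mulrA [2 * pi * _]mulrC; congr (cos _ +i* sin _); ring.
exact: expik2pi.
Qed.

Lemma is_derive_estimate (f : R -> R) (a df e : R) : is_derive a 1 f df -> 0 < e ->
  exists2 d : R, 0 < d & forall h, `|h| < d -> `|f (a + h) - f a - h * df| <= e * `|h|.
Proof.
move=> [dfa <-] e0; have := dfa; rewrite /derivable -/(derive f a 1) => /cvgrPdistC_le /(_ e e0).
case=> d /= d0 hd; exists d => // h hh.
have [->|h0] := eqVneq h 0; first by rewrite addr0 subrr mul0r subr0 !normr0 mulr0.
have := hd h; rewrite /= sub0r normrN => /(_ hh h0).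
rewrite -(ler_pM2r (_ : 0 < `|h|)) ?normr_gt0// -normrM mulrBl.
rewrite /shift/= /GRing.scale/= mulr1 [h + a]addrC mulrAC mulVf// mul1r [_ * h]mulrC.
by [].
Qed.

Lemma expik_estimate k (e : R) : 0 < e -> exists2 d : R, 0 < d &
  forall t, `|t| < d -> complex.Re `|expik k t - 1 - t%:C * ik k| <= e * `|t|.
Proof.
move=> e0; pose c : R := k%:~R.
have c1 : 0 < `|c| + 1 by rewrite ltr_wpDl.
(* Real and imaginary part each get half of the error, and |k| + 1 converts |k t| into |t|. *)
have e2 : 0 < e / (`|c| + 1) / 2 by rewrite !divr_gt0.
have [d1 d10 h1] := is_derive_estimate (is_derive_cos (0 : R)) e2.
have [d2 d20 h2] := is_derive_estimate (is_derive_sin (0 : R)) e2.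
exists (Num.min d1 d2 / (`|c| + 1)); first by rewrite divr_gt0// lt_min d10.
move=> t; rewrite ltr_pdivlMr// mulrC => ht.
have ct : `|c * t| < Num.min d1 d2.
  by rewrite normrM; apply: le_lt_trans ht; rewrite ler_wpM2r// lerDl.
move: ct; rewrite lt_min => /andP[/h1 {}h1 /h2 {}h2].
move: h1 h2; rewrite !add0r cos0 sin0 oppr0 mulr0 mulr1 !subr0 ?addr0 => h1 h2.
have -> : expik k t - 1 - t%:C * ik k =
    (cos (c * t) - 1)%:C + 'i * (sin (c * t) - c * t)%:C.
  by rewrite /expik -/c; apply/eqP; rewrite eq_complex/= -/c; apply/andP; split; apply/eqP; ring.
rewrite -lecR RRe_real ?normr_real//.
apply: le_trans (ler_normD _ _) _; rewrite normrM normCi mul1r.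
have E (a : R) : `|a%:C| = `|a|%:C by rewrite normc_def/= expr0n addr0 sqrtr_sqr.
rewrite !E -rmorphD lecR.
have : e / (`|c| + 1) / 2 * `|c * t| <= e / 2 * `|t|.
  rewrite normrM mulrA ler_wpM2r// mulrAC ler_pM2r// mulrAC ler_pdivrMr// ler_pM2l//.
  by rewrite lerDl.
lra.
Qed.

Lemma expik_continuous0 k (e : R) : 0 < e -> exists2 d : R, 0 < d &
  forall t, `|t| < d -> complex.Re `|expik k t - 1| <= e.
Proof.
move=> e0; have [d d0 hd] := expik_estimate k e0.
pose c : R := complex.Re `|ik k : R[i]|.
have c0 : 0 <= c by exact: Re_normr_ge0.
have ec : 0 < e + c by rewrite ltr_wpDr.
(* The first order estimate bounds the difference by (e + c) |t|, where c = |ik|. *)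
exists (Num.min d (e / (e + c))); first by rewrite lt_min d0 divr_gt0.
move=> t; rewrite lt_min ltr_pdivlMr// => /andP[/hd h1 h2].
have : `|expik k t - 1| <= `|expik k t - 1 - t%:C * ik k| + `|t%:C * ik k|.
  by rewrite -{1}(subrK (t%:C * ik k) (expik k t - 1)) ler_normD.
have E (a : R) : `|a%:C| = `|a|%:C by rewrite normc_def/= expr0n addr0 sqrtr_sqr.
rewrite normrM E -[`|expik k t - 1|]RRe_real ?normr_real//.
rewrite -[`|_ - _ - _|]RRe_real ?normr_real// -[`|ik k|]RRe_real ?normr_real// -/c.
rewrite -rmorphM -rmorphD lecR => h; apply: le_trans h _.
by lra.
Qed.

Lemma expik_lip0 k (e s : R) : 0 < e -> exists2 d : R, 0 < d &
  forall t, `|t - s| < d -> complex.Re `|expik k t - expik k s| <= e.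
Proof.
move=> /(expik_continuous0 k) [d d0 hd]; exists d => // t /hd.
suff -> : expik k t - expik k s = expik k s * (expik k (t - s) - 1).
  by rewrite normrM -[`|expik k s|]RRe_real ?normr_real// norm_expik mul1r.
by rewrite mulrBr mulr1 -expikD [s + _]addrC subrK.
Qed.

End expik_theory.

Section fourier_sums.
Context (R : realType).

Lemma fourier_sum_continuous (V : normedModType R[i]) N (v : int -> V) :
  continuous (fourier_sum N v : R -> V).
Proof.
move=> s; rewrite /fourier_sum.
apply: cvg_big => [|j _]; first exact: add_continuous.
 set k := (_ - _ : int).
apply/rnorm_cvgP => e e0.
have v1 : 0 < rnorm (v k) + 1 by rewrite ltr_wpDl ?rnorm_ge0.
have [d d0 hd] := expik_lip0 k s (divr_gt0 e0 v1).
exists d => // t /=; rewrite distrC => /hd h.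
rewrite -scalerBl rnormZ; apply: le_trans (_ : e / (rnorm (v k) + 1) * rnorm (v k) <= _).
  by apply: ler_wpM2r => //; exact: rnorm_ge0.
by rewrite mulrAC ler_pdivrMr// ler_pM2l// lerDl.
Qed.

End fourier_sums.

(** * Strongly continuous semigroups *)

Section difference_quotients.
Context (R : realType) (V : normedModType R[i]).
Implicit Types (E : R -> V -> V) (D : operator V V).

Definition has_rderiv0 E (x y : V) :=
  (t^-1)%:C *: (E t x - x) @[t --> 0^'+] --> y.

Lemma has_rderiv0P E x y : has_rderiv0 E x y <-> forall e : R, 0 < e ->
  exists2 d : R, 0 < d & forall t, 0 < t -> t < d ->
    rnorm (E t x - x - t%:C *: y) <= e * t.
Proof.
rewrite /has_rderiv0 rnorm_at_rightP.
have E1 t : 0 < t -> rnorm (E t x - x - t%:C *: y) =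
    t * rnorm ((t^-1)%:C *: (E t x - x) - y).
  move=> t0; have H (z : V) : t * rnorm z = rnorm (t%:C *: z) by rewrite rnormZr gtr0_norm.
  rewrite H scalerBr scalerA.
  by rewrite -rmorphM/= mulfV ?gt_eqF// scale1r.
split=> h e /h [d d0 hd]; exists d => // t t0 td; have := hd t t0 td.
  by rewrite E1// mulrC ler_pM2r.
by rewrite E1// mulrC ler_pM2r.
Qed.

Lemma generatorP E x y : has_rderiv0 E x y <-> dom (generator E) x /\ generator E x = y.
Proof.
split=> [h|[h <-]]; last exact: h.
split; first by apply/cvg_ex; exists y.
by apply/cvg_lim => //; exact: norm_hausdorff.
Qed.

Lemma has_rderiv0_linear E a x y x' y' : (forall t : R, 0 < t -> linear (E t)) ->
  has_rderiv0 E x x' -> has_rderiv0 E y y' ->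
  has_rderiv0 E (a *: x + y) (a *: x' + y').
Proof.
move=> lE /has_rderiv0P hx /has_rderiv0P hy; apply/has_rderiv0P => e e0.
pose c := complex.Re `|a| + 1.
have c0 : 0 < c by rewrite ltr_wpDl// Re_normr_ge0.
have [d1 d10 h1] := hx (e / 2 / c) ltac:(by rewrite !divr_gt0).
have [d2 d20 h2] := hy (e / 2) ltac:(by rewrite divr_gt0).
exists (Num.min d1 d2) => [|t t0]; first by rewrite lt_min d10.
rewrite lt_min => /andP[/(h1 _ t0) {}h1 /(h2 _ t0) {}h2].
have -> : E t (a *: x + y) - (a *: x + y) - t%:C *: (a *: x' + y') =
    a *: (E t x - x - t%:C *: x') + (E t y - y - t%:C *: y').
  rewrite (linfD (lE t t0)) (linfZ (lE t t0)) !scalerBr scalerDr !scalerA [a * _]mulrC !opprD.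
  by rewrite [RHS]addrACA; congr (_ + _); rewrite addrACA.
apply: le_trans (rnormD _ _) _; rewrite rnormZ.
have : complex.Re `|a| * rnorm (E t x - x - t%:C *: x') <= e / 2 * t.
  apply: le_trans (_ : c * (e / 2 / c * t) <= _).
    by apply: ler_pM => //; rewrite ?Re_normr_ge0 ?rnorm_ge0 ?lerDl.
  by rewrite mulrA [c * _]mulrC divfK ?gt_eqF.
lra.
Qed.

Lemma generator_linear E a x y : (forall t : R, 0 < t -> linear (E t)) ->
  dom (generator E) x -> dom (generator E) y ->
  dom (generator E) (a *: x + y) /\
  generator E (a *: x + y) = a *: generator E x + generator E y.
Proof.
by move=> lE dx dy; apply/generatorP; apply: has_rderiv0_linear => //; apply/generatorP.
Qed.

Lemma generatesP D E : generates D E ->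
  forall x y, has_rderiv0 E x y <-> dom D x /\ D x = y.
Proof.
move=> [_ dE DE] x y; rewrite generatorP dE.
by split=> -[dx <-]; rewrite DE ?dE.
Qed.

Lemma generates_intro D E : c0_semigroup E ->
  (forall x y, has_rderiv0 E x y <-> dom D x /\ D x = y) -> generates D E.
Proof.
move=> cE hE; have dE : dom D = dom (generator E).
  by apply/seteqP; split=> x dx;
    [have /generatorP[] := (hE x (D x)).2 (conj dx erefl)|
     have /hE[] := (generatorP E x (generator E x)).2 (conj dx erefl)].
split=> // x; rewrite dE => dx.
by have /hE[] := (generatorP E x (generator E x)).2 (conj dx erefl).
Qed.

End difference_quotients.

Lemma rnorm_sum_le (R : realType) (V : normedModType R[i]) n (F : 'I_n -> V) (c : R) :
  (forall j, rnorm (F j) <= c) -> rnorm (\sum_(j < n) F j) <= n%:R * c.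
Proof.
move=> h; apply: le_trans (rnorm_sum _ _ _) _.
rewrite mulr_natl -[n in _ *+ n]card_ord -sumr_const.
by apply: ler_sum => j _; exact: h.
Qed.

Section semigroup.
Context (R : realType) (X : completeNormedModType R[i]) (S : R -> X -> X).
Hypothesis hS : c0_semigroup S.

Lemma semigroup_linear t : 0 <= t -> linear (S t).
Proof. by move=> t0; have [h _ _ _] := hS; have [] := h t t0. Qed.

Lemma semigroup0 x : S 0 x = x.
Proof. by have [_ -> _ _] := hS. Qed.

Lemma semigroupD s t x : 0 <= s -> 0 <= t -> S (s + t) x = S s (S t x).
Proof. by move=> s0 t0; have [_ _ h _] := hS; rewrite h. Qed.

(** Without a bound near 0 there would be times t_n -> 0 along which the norms of S(t_n) are
    unbounded; strong continuity bounds these operators pointwise, against the uniform boundedness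
    principle. The semigroup law then carries the bound from near 0 to [0, b]. *)
Lemma semigroup_bounded (b : R) : exists2 M : R, 1 <= M &
  forall t x, 0 <= t -> t <= b -> rnorm (S t x) <= M * rnorm x.
Proof.
have [h1 _ _ h4] := hS.
have [d d0 [K K1 hK]] : exists2 d : R, 0 < d & exists2 K : R, 1 <= K &
    forall t x, 0 < t -> t <= d -> rnorm (S t x) <= K * rnorm x.
  apply: contrapT => nh.
  have ex n : exists t : R, [/\ 0 < t, t <= n.+1%:R^-1 & exists x, n.+1%:R * rnorm x < rnorm (S t x)].
    apply: contrapT => h; apply: nh; exists n.+1%:R^-1; first by rewrite invr_gt0.
    exists n.+1%:R; first by rewrite ler1n.
    move=> t x t0 tn; rewrite leNgt; apply/negP => h'; apply: h.
    by exists t; split=> //; exists x.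
  pose t n := projT1 (cid (ex n)).
  have tP n : [/\ 0 < t n, t n <= n.+1%:R^-1 & exists x, n.+1%:R * rnorm x < rnorm (S (t n) x)].
    exact: projT2 (cid (ex n)).
  have t0 n : 0 <= t n by have [/ltW] := tP n.
  have [|||K K0 hK] := @uniform_boundedness _ X X (fun n => S (t n)).
  - by move=> n; exact: semigroup_linear.
  - by move=> n; have [] := h1 _ (t0 n).
  - move=> x; have /rnorm_at_rightP /(_ 1 ltr01) [d d0 hd] := h4 x.
    have [N hN] : exists N : nat, forall n, (N <= n)%N -> n.+1%:R^-1 < d.
      exists (Num.truncn d^-1) => n Nn; rewrite invf_plt ?posrE//.
      by apply: lt_le_trans (truncnS_gt _) _; rewrite ler_nat.
    (* Strong continuity only bounds the terms n >= N; the finitely many earlier ones are added to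
       the constant. *)
    exists (1 + rnorm x + \sum_(i < N) rnorm (S (t i) x)) => n.
    have s0 : 0 <= \sum_(i < N) rnorm (S (t i) x) by apply: sumr_ge0 => i _; exact: rnorm_ge0.
    have [nN|Nn] := ltnP n N.
      rewrite (bigD1 (Ordinal nN))//= addrCA lerDl addr_ge0 ?addr_ge0 ?rnorm_ge0//.
      by apply: sumr_ge0 => i _; exact: rnorm_ge0.
    have [t0' tn _] := tP n.
    have := hd (t n) t0' (le_lt_trans tn (hN n Nn)).
    have := ler_rnormB (S (t n) x) x; lra.
  have [n hn] : exists n : nat, K < n.+1%:R by exists (Num.truncn K); exact: truncnS_gt.
  have [_ _ [x hx]] := tP n.
  have := le_lt_trans (ler_wpM2r (rnorm_ge0 x) (ltW hn)) hx.
  by rewrite ltNge hK.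
(* Splitting off one time step d at a time costs a factor K each. *)
have H n t x : 0 <= t -> t <= n%:R * d -> rnorm (S t x) <= K ^+ n * rnorm x.
  elim: n t x => [|n ih] t x t0.
    rewrite mul0r => tl0; have -> : t = 0 by apply/eqP; rewrite eq_le tl0.
    by rewrite semigroup0 expr0 mul1r.
  rewrite -natr1 mulrDl mul1r => tn.
  have [td|td] := leP t d.
    have [->|tn0] := eqVneq t 0.
      by rewrite semigroup0 ler_peMl ?rnorm_ge0// exprn_ege1.
    have t0' : 0 < t by rewrite lt_neqAle eq_sym tn0.
    apply: le_trans (hK _ _ t0' td) _; apply: ler_wpM2r; first exact: rnorm_ge0.
    by rewrite exprS ler_peMr ?exprn_ege1// (le_trans ler01).
  have -> : t = (t - d) + d by rewrite subrK.
  rewrite semigroupD ?subr_ge0 ?(ltW td) ?(ltW d0)//.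
  have h : rnorm (S (t - d) (S d x)) <= K ^+ n * rnorm (S d x) by apply: ih; lra.
  apply: le_trans h _; rewrite exprSr -mulrA ler_wpM2l ?exprn_ge0 ?(le_trans ler01)//.
  exact: hK.
pose n := (Num.truncn (b / d)).+1.
exists (K ^+ n) => [|t x t0 tb]; first by rewrite exprn_ege1.
apply: H => //; apply: le_trans tb _.
by rewrite -ler_pdivrMr//; apply/ltW/truncnS_gt.
Qed.

Lemma semigroup_cvg0 x (e : R) : 0 < e -> exists2 d : R, 0 < d &
  forall t, 0 <= t -> t < d -> rnorm (S t x - x) <= e.
Proof.
have [_ _ _ h] := hS; move=> e0; have /rnorm_at_rightP /(_ e e0) [d d0 hd] := h x.
exists d => // t; rewrite le_eqVlt => /predU1P[<- _|]; last exact: hd.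
by rewrite semigroup0 subrr rnorm0 ltW.
Qed.

(* Discrete substitute for the fundamental theorem of calculus along r |-> S r (g (s - r)). *)
Lemma semigroup_telescope (g : R -> X) (s d : R) n : 0 <= d ->
  S (n%:R * d) (g (s - n%:R * d)) - g s =
  \sum_(j < n) S (j%:R * d) (S d (g (s - j%:R * d - d)) - g (s - j%:R * d)).
Proof.
move=> d0; elim: n => [|n ih].
  by rewrite big_ord0 mul0r semigroup0 subr0 subrr.
rewrite big_ord_recr/= -ih (linfB (semigroup_linear _)) ?mulr_ge0//.
have -> : n.+1%:R * d = n%:R * d + d by rewrite -natr1 mulrDl mul1r.
rewrite semigroupD ?mulr_ge0// opprD addrA [RHS]addrC addrA addrAC.
by rewrite subrK.
Qed.

Section riemann.
Variables (b M : R) (b0 : 0 < b) (M1 : 1 <= M).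
Hypothesis hM : forall t x, 0 <= t -> t <= b -> rnorm (S t x) <= M * rnorm x.

Let M0 : 0 <= M. Proof. exact: le_trans M1. Qed.
Variable dl : nat -> R.
Hypothesis dlE : forall n, dl n = b / n.+1%:R.
Let dl0 n : 0 < dl n. Proof. by rewrite dlE divr_gt0. Qed.
Let dlN n : n.+1%:R * dl n = b. Proof. by rewrite dlE mulrC divfK. Qed.
Let jdl0 j n : 0 <= j%:R * dl n. Proof. by rewrite mulr_ge0// ltW. Qed.
Let jdl j n : (j <= n.+1)%N -> j%:R * dl n <= b.
Proof. by move=> jn; rewrite -(dlN n) ler_pM2r// ler_nat. Qed.

(** Left Riemann sum, with n + 1 cells, of the integral of S r x over [0, b]. *)
Let rsum n x : X := (dl n)%:C *: \sum_(j < n.+1) S (j%:R * dl n) x.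

Let rsum_le n x c : (forall t, 0 <= t -> t <= b -> rnorm (S t x) <= c) -> rnorm (rsum n x) <= b * c.
Proof.
move=> h; rewrite /rsum rnormZr gtr0_norm// -(dlN n) [_ * dl n]mulrC -mulrA ler_pM2l//.
apply: rnorm_sum_le => j; apply: h => //; apply: jdl; exact: ltnW.
Qed.

(** The grid with (n + 1)(m + 1) cells refines both the n-th and the m-th grid; comparing both sums
    with this common refinement makes the sequence Cauchy. *)
Let rsum_refine n m x e : (forall t, 0 <= t -> t <= dl n -> rnorm (S t x - x) <= e) ->
  rnorm (rsum (n.+1 * m.+1).-1 x - rsum n x) <= b * M * e.
Proof.
move=> h; have Nm : (n.+1 * m.+1).-1.+1 = (n.+1 * m.+1)%N by [].
set N := (n.+1 * m.+1).-1 in Nm *.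
have dlmE : dl n = m.+1%:R * dl N by rewrite !dlE Nm natrM; field; rewrite !nat1r !pnatr_eq0.
have split (F : nat -> X) : \sum_(j < N.+1) F j = \sum_(j < n.+1) \sum_(i < m.+1) F (j * m.+1 + i)%N.
  rewrite Nm; elim: (n.+1) => [|k ih]; first by rewrite !big_ord0.
  rewrite [RHS]big_ord_recr/= -ih -!(big_mkord xpredT) mulSn addnC.
  rewrite (@big_cat_nat _ _ _ (k * m.+1)) ?leq_addr//=; congr (_ + _).
  rewrite -{1}[(k * m.+1)%N]add0n big_addn addKn.
  by rewrite big_mkord; apply: eq_bigr => i _; rewrite addnC.
have -> : rsum N x - rsum n x = (dl N)%:C *:
    \sum_(j < n.+1) \sum_(i < m.+1) S (j%:R * dl n) (S (i%:R * dl N) x - x).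
  rewrite /rsum (split (fun j => S (j%:R * dl N) x)).
  rewrite {1}dlmE [m.+1%:R * _]mulrC rmorphM/= -scalerA -scalerBr; congr (_ *: _).
  rewrite scaler_sumr -sumrB; apply: eq_bigr => j _.
  have -> : m.+1%:R%:C *: S (j%:R * dl n) x = \sum_(i < m.+1) S (j%:R * dl n) x.
    by rewrite sumr_const card_ord rmorph_nat scaler_nat.
  rewrite -sumrB; apply: eq_bigr => i _.
  rewrite (linfB (semigroup_linear _))// -semigroupD// dlmE mulrA -natrM -mulrDl -natrD.
  by [].
rewrite rnormZr gtr0_norm//; apply: le_trans (_ : dl N * (N.+1%:R * (M * e)) <= _); last first.
  by rewrite mulrA [dl N * _]mulrC dlN mulrA.
rewrite ler_pM2l// Nm natrM -mulrA; apply: rnorm_sum_le => j; apply: rnorm_sum_le => i.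
apply: le_trans (hM _ (jdl0 _ _) _) _; first by apply: jdl; exact: ltnW.
rewrite ler_wpM2l// h// dlmE ler_pM2r// ler_nat; exact: ltnW.
Qed.

(** Shifting by i cells drops the first i terms and adds i terms past b; the terms at r and at b + r
    pair up. *)
Let rsum_shift n i x : rsum n (S (i%:R * dl n) x) - rsum n x =
  (dl n)%:C *: \sum_(j < i) S (j%:R * dl n) (S b x - x).
Proof.
rewrite /rsum -scalerBr; congr (_ *: _).
elim: i => [|i ih]; first by rewrite mul0r semigroup0 subrr big_ord0.
rewrite [RHS]big_ord_recr/= -ih.
rewrite (linfB (semigroup_linear _))// -semigroupD ?(ltW b0)// -(dlN n) -mulrDl -natrD.
pose F j := S (j%:R * dl n) x.
have E k : \sum_(j < n.+1) S (j%:R * dl n) (S (k%:R * dl n) x) = \sum_(0 <= j < n.+1) F (k + j)%N.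
  by rewrite big_mkord; apply: eq_bigr => j _; rewrite -semigroupD// -mulrDl -natrD addnC.
rewrite !E big_nat_recr//= [in RHS]big_nat_recl//= addn0 addnS.
rewrite (eq_bigr (fun j => F (i + j.+1)%N)) => [|j _]; last by rewrite addSn addnS.
rewrite -/(F i) -/(F (i + n).+1) addSn; set a := \sum_(_ <= _ < _) _.
set z := \sum_(_ < _) _; rewrite [F i + a]addrC [a + F i - z]addrAC -[RHS]addrA [F i + _]addrC subrK.
by rewrite addrAC.
Qed.

(** w is the integral of S r x over [0, b]. Formally, S h w - w is the integral over [b, b + h]
    minus that over [0, h], that is, the integral of S r (S b x - x) over [0, h]. *)
Lemma orbit_integral x : exists w : X, rnorm w <= b * (M * rnorm x) /\
  has_rderiv0 S w (S b x - x).
Proof.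
have dl_small (e : R) : 0 < e -> exists n0 : nat, forall n, (n0 <= n)%N -> dl n < e.
  move=> e0; exists (Num.truncn (b / e)) => n nn; rewrite dlE ltr_pdivrMr// mulrC -ltr_pdivrMr//.
  by apply: lt_le_trans (truncnS_gt _) _; rewrite ler_nat.
have [w hw] : exists w : X, rsum ^~ x @ \oo --> w.
  apply: rnorm_cauchy => e e0.
  have bM : 0 < 2 * (b * M) by rewrite !mulr_gt0// (lt_le_trans ltr01).
  have [d d0 hd] := semigroup_cvg0 x (divr_gt0 e0 bM).
  have [n0 hn0] := dl_small d d0.
  have H n m : (n0 <= n)%N -> rnorm (rsum (n.+1 * m.+1).-1 x - rsum n x) <= e / 2.
    move=> nn; have -> : e / 2 = b * M * (e / (2 * (b * M))).
      by field; rewrite !gt_eqF// (lt_le_trans ltr01).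
    apply: rsum_refine => t t0 tn; apply: hd => //.
    exact: le_lt_trans tn (hn0 n nn).
  exists n0 => n m nn mm; have h1 := H n m nn; have := H m n mm; rewrite mulnC => h2.
  have := rnorm_triangle (rsum n x) (rsum (n.+1 * m.+1).-1 x) (rsum m x).
  by rewrite [in X in _ <= X](rnormB (rsum n x)); lra.
exists w; split.
  apply/ler_addgt0Pr => e e0; have /rnorm_cvgnP /(_ e e0) [n /(_ n (leqnn n))] := hw.
  rewrite rnormB; have := ler_rnormB w (rsum n x).
  have : rnorm (rsum n x) <= b * (M * rnorm x) by apply: rsum_le => t t0 tb; exact: hM.
  lra.
set z := S b x - x; apply/has_rderiv0P => e e0.
have [d d0 hd] := semigroup_cvg0 z e0.
exists (Num.min d b) => [|h h0]; first by rewrite lt_min d0.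
(* For this fixed h, [eta] absorbs the discretization: [eta1] bounds the errors around w, at most (3
   M + 1) eta1 = eta / 2 in total, and [eta2] is for replacing h by a multiple of the mesh. *)
rewrite lt_min => /andP[hd' hb]; apply/ler_addgt0Pr => eta eta0.
have M21 : 0 < 2 * (3 * M + 1) by rewrite mulr_gt0// addr_gt0// mulr_gt0// (lt_le_trans ltr01).
have z1 : 0 < 2 * (rnorm z + 1) by have := rnorm_ge0 z; lra.
have h1 : 0 < eta / (2 * (3 * M + 1)) by rewrite divr_gt0.
have h2 : 0 < eta / (2 * (rnorm z + 1)) by rewrite divr_gt0.
set eta1 := eta / (2 * (3 * M + 1)) in h1; set eta2 := eta / _ in h2.
have [d1 d10 hd1] := semigroup_cvg0 w h1.
have [n1 hn1] := dl_small (Num.min d1 eta2) ltac:(by rewrite lt_min d10).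
have /rnorm_cvgnP /(_ _ h1) [n2 hn2] := hw.
pose n := maxn n1 n2.
have := hn1 n (leq_maxl _ _); rewrite lt_min => /andP[dd1 deta].
have {hn2} hr : rnorm (rsum n x - w) <= eta1 by apply: hn2; exact: leq_maxr.
(* t = i dl is the last node not after h, so 0 <= h - t < dl. *)
pose i := Num.truncn (h / dl n).
have ih : i%:R * dl n <= h.
  by rewrite -ler_pdivlMr// truncn_le divr_ge0// ltW.
have hi : h < i%:R * dl n + dl n.
  by rewrite -[X in _ + X]mul1r -mulrDl -ltr_pdivrMr// natr1; exact: truncnS_gt.
have hdl := dl0 n.
set t := i%:R * dl n in ih hi *.
have t0 : 0 <= t by exact: jdl0.
have lS := semigroup_linear t0.
have comm : S t (rsum n x) = rsum n (S t x).
  rewrite /rsum (linfZ lS) (linf_sum lS); congr (_ *: _); apply: eq_bigr => j _.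
  by rewrite -!semigroupD// addrC.
have E : S h w - w - h%:C *: z = (S t (S (h - t) w - w)) + S t (w - rsum n x)
    - (w - rsum n x) + ((S t (rsum n x) - rsum n x - t%:C *: z) + (t - h)%:C *: z).
  rewrite !(linfB lS) -semigroupD ?subr_ge0// [t + (h - t)]addrC subrK rmorphB/= scalerBl.
  rewrite !subrKA opprB [RHS](AC ((2*2)*3) ((1*4*7)*((3*6)*(2*5)))).
  by rewrite /= subrr addNr !addr0.
have n1' : rnorm (S t (S (h - t) w - w)) <= M * eta1.
  apply: le_trans (hM _ t0 _) _; first by lra.
  by rewrite ler_wpM2l// hd1//; lra.
have n2' : rnorm (S t (w - rsum n x)) <= M * eta1.
  apply: le_trans (hM _ t0 _) _; first by lra.
  by rewrite ler_wpM2l// rnormB.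
have n3 : rnorm (S t (rsum n x) - rsum n x - t%:C *: z) <= e * h.
  rewrite comm rsum_shift.
  have -> : t%:C *: z = (dl n)%:C *: \sum_(j < i) z.
    by rewrite sumr_const card_ord -scaler_nat -(rmorph_nat (real_complex R)) scalerA -rmorphM/= mulrC.
  rewrite -scalerBr -sumrB rnormZr gtr0_norm//.
  apply: le_trans (_ : dl n * (i%:R * e) <= _); last first.
    by have -> : dl n * (i%:R * e) = e * t by [rewrite /t; ring]; rewrite ler_wpM2l// ltW.
  rewrite ler_pM2l//; apply: rnorm_sum_le => j; apply: hd => //.
  by apply: le_lt_trans hd'; apply: le_trans ih; rewrite ler_pM2r// ler_nat ltnW.
have n4 : rnorm ((t - h)%:C *: z) <= eta / 2.
  rewrite rnormZr distrC ger0_norm ?subr_ge0//.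
  apply: le_trans (_ : eta2 * (rnorm z + 1) <= _); last first.
    by rewrite /eta2 invfM mulrA mulfVK// gt_eqF// ltr_wpDl ?rnorm_ge0.
  by apply: ler_pM; rewrite ?rnorm_ge0 ?subr_ge0 ?lerDl//; lra.
have n5 : M * eta1 + M * eta1 + M * eta1 + eta1 = eta / 2.
  by rewrite /eta1; field; apply/eqP => h'; move: M21; rewrite mulrC h' mul0r ltxx.
have etaM : eta1 <= M * eta1 by rewrite ler_peMl// ltW.
rewrite E; apply: le_trans (rnormD _ _) _.
have := rnormD (S t (S (h - t) w - w) + S t (w - rsum n x)) (- (w - rsum n x)).
have := rnormD (S t (S (h - t) w - w)) (S t (w - rsum n x)).
have := rnormD (S t (rsum n x) - rsum n x - t%:C *: z) ((t - h)%:C *: z).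
have n6 : rnorm (- (w - rsum n x)) <= eta1 by rewrite rnormN rnormB.
by lra.
Qed.

End riemann.
End semigroup.

(** * Rescaled semigroups and the resolvent at ik *)

Section rescaled_semigroup.
Context (R : realType) (X : completeNormedModType R[i]).

Definition rescale (k : int) (S : R -> X -> X) (t : R) (x : X) : X := expik k (- t) *: S t x.

Lemma rescaleK k S : rescale (- k) (rescale k S) = S.
Proof.
apply/funext => t; apply/funext => x.
by rewrite /rescale scalerA expikNk opprK mulrC expikNM scale1r.
Qed.

(** All rescaled semigroups share one period map, so a single inverse of 1 - S(2 pi) serves every
    k. *)
Lemma rescale2pi k S : rescale k S (2 * pi) = S (2 * pi).
Proof. by apply/funext => x; rewrite /rescale expikN expik2pi conjc1 scale1r. Qed.

Lemma rescale_c0 k S : c0_semigroup S -> c0_semigroup (rescale k S).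
Proof.
move=> hS; have [h1 _ _ h4] := hS; split.
- move=> t t0; have [lS /(continuous_linf_bounded lS) [K K0 hK]] := h1 t t0.
  have lr : linear (rescale k S t).
    by move=> a x y; rewrite /rescale lS scalerDr !scalerA [_ * a]mulrC.
  split=> //; apply: (bounded_linf_continuous lr (K := K)) => x.
  by rewrite rnorm_expikZ.
- by apply/funext => x; rewrite /rescale oppr0 expik0 scale1r (semigroup0 hS).
- move=> s t s0 t0; apply/funext => x; rewrite /rescale/=.
  by rewrite (linfZ (semigroup_linear hS s0)) (semigroupD hS)// scalerA -expikD opprD.
- move=> x; apply/rnorm_at_rightP => e e0.
  have e2 : 0 < e / 2 by rewrite divr_gt0.
  have [d1 d10 hd1] := semigroup_cvg0 hS x e2.
  have x1 : 0 < rnorm x + 1 by rewrite ltr_wpDl ?rnorm_ge0.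
  have [d2 d20 hd2] := expik_continuous0 k (divr_gt0 e2 x1).
  exists (Num.min d1 d2) => [|t t0]; first by rewrite lt_min d10.
  rewrite lt_min => /andP[td1 td2].
  have -> : rescale k S t x - x = expik k (- t) *: (S t x - x) + (expik k (- t) - 1) *: x.
    by rewrite scalerBr scalerBl scale1r subrKA.
  apply: le_trans (rnormD _ _) _; rewrite rnorm_expikZ rnormZ.
  have := hd1 t (ltW t0) td1; have := hd2 (- t); rewrite normrN gtr0_norm// => /(_ td2) h.
  have : complex.Re `|expik k (- t) - 1| * rnorm x <= e / 2 / (rnorm x + 1) * (rnorm x + 1).
    by apply: ler_pM => //; rewrite ?Re_normr_ge0 ?rnorm_ge0 ?lerDl.
  by rewrite divfK ?gt_eqF//; lra.
Qed.

Lemma rescale_rderiv0 k S x y : has_rderiv0 S x y ->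
  has_rderiv0 (rescale k S) x (y - ik k *: x).
Proof.
move=> /has_rderiv0P h; apply/has_rderiv0P => e e0.
pose c := rnorm x + rnorm y + 1.
have c0 : 0 < c by rewrite ltr_wpDl ?addr_ge0 ?rnorm_ge0.
have e2 : 0 < e / 2 by rewrite divr_gt0.
have ec : 0 < e / 2 / c by rewrite divr_gt0.
have [d1 d10 hd1] := h _ e2.
have [d2 d20 hd2] := expik_continuous0 k ec.
have [d3 d30 hd3] := expik_estimate k ec.
exists (Num.min d1 (Num.min d2 d3)) => [|t t0]; first by rewrite !lt_min d10 d20.
rewrite !lt_min => /and3P[/(hd1 _ t0) {}hd1 td2 td3].
have := hd2 (- t); have := hd3 (- t); rewrite normrN gtr0_norm// => /(_ td3) {}hd3 /(_ td2) {}hd2.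
(* Product rule: the remainder of S at x, the change of the factor on y, and the remainder of the
   factor on x. *)
have -> : rescale k S t x - x - t%:C *: (y - ik k *: x) =
    expik k (- t) *: (S t x - x - t%:C *: y) + t%:C *: ((expik k (- t) - 1) *: y)
     + (expik k (- t) - 1 - (- t)%:C * ik k) *: x.
  rewrite /rescale !scalerBr !scalerBl !scalerBr scale1r !scalerA rmorphN/= mulNr scaleNr !opprK.
  rewrite [t%:C * expik _ _]mulrC.
  set a := _ *: S t x; set b := _ *: x; set c' := _ *: y; set d' := _ *: y; set g := _ *: x.
  rewrite opprB subrKA scale1r !addrA.
  by rewrite [RHS](AC 6 ((1*5*6*3)*(2*4)))/= addNr addr0.
apply: le_trans (rnormD _ _) _; apply: le_trans (lerD (rnormD _ _) (lexx _)) _.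
rewrite rnorm_expikZ rnormZr gtr0_norm// !rnormZ.
have hx : complex.Re `|expik k (- t) - 1 - (- t)%:C * ik k| * rnorm x <= e / 2 / c * t * rnorm x.
  by rewrite ler_wpM2r ?rnorm_ge0.
have hy : t * (complex.Re `|expik k (- t) - 1| * rnorm y) <= t * (e / 2 / c * rnorm y).
  by rewrite ler_wpM2l ?(ltW t0)// ler_wpM2r ?rnorm_ge0.
have hq : e / 2 / c * t * c = e / 2 * t by field; rewrite gt_eqF.
have q0 : 0 < e / 2 / c * t by rewrite mulr_gt0.
have hyE : t * (e / 2 / c * rnorm y) = e / 2 / c * t * rnorm y by ring.
have : e / 2 / c * t * c = e / 2 / c * t * rnorm x + e / 2 / c * t * rnorm y + e / 2 / c * t.
  by rewrite {2}/c !mulrDr mulr1.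
by move: hx hy hq q0 hyE hd1; set q := e / 2 / c * t; lra.
Qed.

(** Rescaling back by - k turns a derivative of the rescaled orbit into one of the original orbit;
    this gives the reverse inclusion of the domains. *)
Lemma rescale_generates k D S : generates D S -> generates (op_shift D (ik k)) (rescale k S).
Proof.
move=> gS; have [cS _ _] := gS; apply: generates_intro; first exact: rescale_c0.
move=> x y; split=> [|[dx <-]].
  move=> /(@rescale_rderiv0 (- k)); rewrite rescaleK => /(generatesP gS)[dx Dx].
  split=> //=; rewrite Dx; have -> : ik (- k) = - ik k :> R[i].
    by rewrite /ik mulrNz; apply/eqP; rewrite eq_complex/= oppr0 !eqxx.
  by rewrite scaleNr opprK addrK.
by apply: rescale_rderiv0; apply/(generatesP gS).
Qed.

End rescaled_semigroup.

Section resolvent.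
Context (R : realType) (X : completeNormedModType R[i]).
Variables (D : operator X X) (S : R -> X -> X).
Hypothesis gS : generates D S.

Let cS : c0_semigroup S. Proof. by have [] := gS. Qed.

Lemma generates_linear a x y : dom D x -> dom D y ->
  dom D (a *: x + y) /\ D (a *: x + y) = a *: D x + D y.
Proof.
move=> dx dy; apply/(generatesP gS); apply: has_rderiv0_linear.
- by move=> t t0; apply: semigroup_linear cS _ _; exact: ltW.
- exact/(generatesP gS).
- exact/(generatesP gS).
Qed.

(** When the right derivative at x is zero, each of n steps of length b / n moves x by o(1 / n), and
    telescoping bounds the total. *)
Lemma semigroup_fixed x b : 0 <= b -> dom D x -> D x = 0 -> S b x = x.
Proof.
move=> b0 dx Dx; apply/eqP; rewrite -subr_eq0; apply/eqP; apply: rnorm_le0 => e e0.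
have [M M1 hM] := semigroup_bounded cS b.
have b1' : 0 < b + 1 by rewrite ltr_wpDl.
have M0 : 0 < M by exact: lt_le_trans M1.
have bM : 0 < (b + 1) * M by rewrite mulr_gt0.
have /has_rderiv0P /(_ _ (divr_gt0 e0 bM)) [d d0 hd] : has_rderiv0 S x 0.
  exact/(generatesP gS).
pose n := Num.truncn (b / d); pose h := b / n.+1%:R.
have h0 : 0 <= h by rewrite divr_ge0.
have hb : n.+1%:R * h = b by rewrite mulrC divfK.
have hd' : h < d.
  by rewrite /h ltr_pdivrMr// mulrC -ltr_pdivrMr//; exact: truncnS_gt.
have Sh : rnorm (S h x - x) <= e / ((b + 1) * M) * h.
  have [->|hn0] := eqVneq h 0; first by rewrite (semigroup0 cS) subrr rnorm0 mulr0.
  by have := hd h; rewrite scaler0 subr0; apply=> //; rewrite lt_neqAle eq_sym hn0.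
have := semigroup_telescope cS (fun=> x) 0 n.+1 h0; rewrite hb => ->.
apply: le_trans (_ : n.+1%:R * (M * (e / ((b + 1) * M) * h)) <= _).
  apply: rnorm_sum_le => j; apply: le_trans (hM _ _ _ _) _.
  - by rewrite mulr_ge0.
  - by rewrite -hb ler_wpM2r// ler_nat ltnW.
  - by rewrite ler_wpM2l// (le_trans ler01).
have b1 : b + 1 != 0 by rewrite gt_eqF// ltr_wpDl.
have Mn0 : M != 0 by rewrite gt_eqF// (lt_le_trans ltr01).
have -> : n.+1%:R * (M * (e / ((b + 1) * M) * h)) = e * (n.+1%:R * h / (b + 1)).
  by field; rewrite ?Mn0 ?b1.
rewrite hb.
by rewrite ger_pMr// ler_pdivrMr ?ltr_wpDl// mul1r lerDl.
Qed.

(** Vectors in the kernel of D are fixed by S b. For surjectivity, solve S b z - z = y; D maps the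
    orbit integral of z to S b z - z. *)
Theorem period_invertible b : 0 < b ->
  invertible (total_op (fun x => x - S b x)) -> invertible D.
Proof.
move=> b0 iS; have [M M1 hM] := semigroup_bounded cS b.
have [K K0 hK] := op_inv_bounded iS.
apply: (invertible_bijective (K := b * (M * K))); first exact: generates_linear.
  move=> x dx Dx; apply: (invertible_injective iS) => //=.
  have lS := semigroup_linear cS (ltW b0).
  by rewrite (semigroup_fixed (ltW b0) dx Dx) (linf0 lS) !subrr.
move=> y; have [_ /= hz] := op_invP iS (- y); set z := op_inv _ _ in hz.
have [w [wz /(generatesP gS)[dw Dw]]] := orbit_integral cS b0 M1 hM (fun n => erefl) z.
exists w; split=> //; first by rewrite Dw -opprB hz opprK.
apply: le_trans wz _; rewrite -mulrA ler_pM2l// -mulrA ler_pM2l ?(lt_le_trans ltr01)//.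
by apply: le_trans (hK _) _; rewrite rnormN.
Qed.

End resolvent.

Section resolvent_set.
Context (R : realType).

Lemma invertible_opp (V W : normedModType R[i]) (d : set V) (f g : V -> W) :
  (forall x, g x = - f x) -> invertible (Operator d f) -> invertible (Operator d g).
Proof.
move=> gf [B [lB cB fB Bf]].
have lB' : linear (fun y => B (- y)) by move=> a x y; rewrite opprD -scalerN lB.
exists (fun y => B (- y)); split=> //.
- have [K _ hK] := continuous_linf_bounded lB cB.
  by apply: (bounded_linf_continuous lB' (K := K)) => y; rewrite -(rnormN y).
- by move=> y /=; have [d1 e1] := fB (- y); split=> //=; rewrite gf; move: e1 => /= ->; rewrite opprK.
- by move=> x dx /=; rewrite gf opprK; exact: Bf.
Qed.

Lemma resolvent_setP (V : normedModType R[i]) (D : operator V V) z :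
  resolvent_set D z <-> invertible (op_shift D z).
Proof.
by split; apply: invertible_opp => x; rewrite opprB.
Qed.

Lemma resolvent_set1P (V : normedModType R[i]) (f : V -> V) :
  resolvent_set (total_op f) 1 <-> invertible (total_op (fun x => x - f x)).
Proof.
rewrite /resolvent_set/= /total_op.
by rewrite (_ : (fun x => 1 *: x - f x) = (fun x => x - f x))//; apply/funext => x; rewrite scale1r.
Qed.

Lemma period_resolvent (X : completeNormedModType R[i]) (D : operator X X) S :
  generates D S -> invertible (total_op (fun x => x - S (2 * pi) x)) ->
  forall k, invertible (op_shift D (ik k)).
Proof.
move=> gS iS k; apply: (period_invertible (rescale_generates k gS) (b := 2 * pi)).
  by rewrite mulr_gt0 ?pi_gt0.
by rewrite rescale2pi.
Qed.

End resolvent_set.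

(** * Algebra of trigonometric sums *)

Section fourier_sum_algebra.
Context (R : realType).
Implicit Types (V W : normedModType R[i]) (N : nat) (s : R).

Lemma eq_fourier_sum V N (v w : int -> V) s : (forall k : int, (`|k| <= N)%N -> v k = w k) ->
  fourier_sum N v s = fourier_sum N w s.
Proof.
move=> h; rewrite /fourier_sum; apply: eq_bigr => j _ /=; congr (_ *: _); apply: h.
by have := ltn_ord j; lia.
Qed.

Lemma fourier_sum_linear V N a (v w : int -> V) s :
  fourier_sum N (fun k => a *: v k + w k) s = a *: fourier_sum N v s + fourier_sum N w s.
Proof.
rewrite /fourier_sum scaler_sumr -big_split; apply: eq_bigr => j _ /=.
by rewrite scalerDr !scalerA mulrC.
Qed.

Lemma fourier_sum0 V N s : fourier_sum N (fun=> 0 : V) s = 0.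
Proof. by rewrite /fourier_sum big1// => j _; rewrite scaler0. Qed.

Lemma linf_fourier_sum V W (L : V -> W) N (v : int -> V) s : linear L ->
  L (fourier_sum N v s) = fourier_sum N (L \o v) s.
Proof.
by move=> lL; rewrite /fourier_sum (linf_sum lL); apply: eq_bigr => j _; rewrite (linfZ lL).
Qed.

Lemma fourier_sum_period V N (v : int -> V) s (m : int) :
  fourier_sum N v (s + 2 * pi * m%:~R) = fourier_sum N v s.
Proof. by rewrite /fourier_sum; apply: eq_bigr => j _ /=; rewrite expik_period. Qed.

(** Several indices may carry the same frequency, as in the double sum of the Fejer kernel; the
    coefficient at k collects them. *)
Lemma fourier_sum_family V (I : finType) (kap : I -> int) (v : I -> V) N s :
  (forall i, (`|kap i| <= N)%N) ->
  fourier_sum N (fun k => \sum_(i | kap i == k) v i) s = \sum_i expik (kap i) s *: v i.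
Proof.
move=> hk; pose q i : 'I_(N.*2.+1) := inord `|(kap i + N%:Z)%R|%N.
rewrite [RHS](partition_big q xpredT)//= /fourier_sum; apply: eq_bigr => j _.
rewrite scaler_sumr; apply: congr_big => // i; last by move/eqP ->.
have hi := hk i; have hj := ltn_ord j.
have qE : q i = `|(kap i + N%:Z)%R|%N :> nat by rewrite inordK//; lia.
by apply/eqP/eqP => [e|e]; [apply/val_inj; rewrite /= qE|move/(congr1 val): e => /=; rewrite qE]; lia.
Qed.

Lemma fourier_sum_widen V N N' (v : int -> V) s : (N <= N')%N ->
  (forall k : int, (N < `|k|)%N -> v k = 0) -> fourier_sum N v s = fourier_sum N' v s.
Proof.
move=> NN' v0; pose kap (i : 'I_(N.*2.+1)) : int := (i : nat)%:Z - N%:Z.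
have -> : fourier_sum N v s = \sum_i expik (kap i) s *: v (kap i) by [].
rewrite -(@fourier_sum_family V _ kap (v \o kap) N'); last first.
  by move=> i; have := ltn_ord i; rewrite /kap; lia.
apply: eq_fourier_sum => k kN' /=.
have [kN|kN] := leqP `|k|%N N; last first.
  rewrite v0// big1// => i /eqP h; move: kN; rewrite -h.
  by have := ltn_ord i; rewrite /kap; lia.
have h : (`|(k + N%:Z)%R| < N.*2.+1)%N by lia.
rewrite (big_pred1 (Ordinal h)); first by congr v; rewrite /kap/=; lia.
move=> i; apply/eqP/eqP => [e|->]; last by rewrite /kap/=; lia.
by apply/val_inj => /=; move: e; rewrite /kap; lia.
Qed.

(** Sums of different degrees are added at a common degree, after zeroing the coefficients that each
    of them does not read. *)
Definition truncate V N (v : int -> V) : int -> V := fun k => if (`|k| <= N)%N then v k else 0.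

Lemma fourier_sum_truncate V N N' (v : int -> V) s : (N <= N')%N ->
  fourier_sum N' (truncate N v) s = fourier_sum N v s.
Proof.
move=> NN'; rewrite -(@fourier_sum_widen _ N N')//.
  by apply: eq_fourier_sum => k; rewrite /truncate => ->.
by move=> k; rewrite /truncate ltnNge => /negbTE ->.
Qed.

End fourier_sum_algebra.

(** * Discrete Fourier inversion on equispaced nodes *)

Section discrete_orthogonality.
Context (R : realType).

Definition node (M j : nat) : R := 2 * pi * (j%:R / M%:R).

Lemma expik_node (k : int) M j : expik k (node M j) = expik k (node M 1) ^+ j.
Proof.
elim: j => [|j ih]; first by rewrite /node mul0r mulr0 expik0 expr0.
by rewrite exprSr -ih -expikD; congr expik; rewrite /node -mulrDr -mulrDl natr1.
Qed.

Lemma expik_node_neq1 (k : int) M : k != 0 -> (`|k| < M)%N -> expik k (node M 1) != 1.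
Proof.
move=> k0 kM; apply/eqP => /(congr1 (@complex.Re R)) /= h.
have M0 : (0 : R) < M%:R by rewrite ltr0n; lia.
(* Half the angle: cos 2t = 1 would force sin t = 0, but 0 < t < pi. *)
pose t : R := pi * (`|k|%:R / M%:R).
have k0' : (0 : R) < `|k|%:R by rewrite ltr0n absz_gt0.
have t0 : 0 < t by rewrite mulr_gt0 ?pi_gt0// divr_gt0.
have st : 0 < sin t.
  apply: sin_gt0_pi; rewrite t0/= gtr_pMr ?pi_gt0//.
  by rewrite ltr_pdivrMr// mul1r ltr_nat.
have c1 : cos (t + t) = 1.
  have -> : t + t = `|k%:~R * node M 1|.
    rewrite normrM [`|node _ _|]ger0_norm; last by rewrite /node !mulr_ge0// ?pi_ge0 ?invr_ge0 ?ltW.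
    have -> : `|k%:~R : R| = `|k|%N%:R by rewrite -intr_norm -abszE.
    by rewrite /t /node; field; rewrite gt_eqF.
  by rewrite cos_norm.
move: c1; rewrite cosD => c1.
have := cos2Dsin2 t; have : 0 < sin t * sin t by exact: mulr_gt0.
by rewrite !expr2; lra.
Qed.

Lemma sum_expik_node (k : int) M : (`|k| < M)%N ->
  \sum_(j < M) expik k (node M j) = (if k == 0 then M%:R else 0 : R[i]).
Proof.
move=> kM; under eq_bigr do rewrite expik_node.
have [->|k0] := eqVneq k 0.
  by rewrite expik0k; under eq_bigr do rewrite expr1n; rewrite sumr_const card_ord.
have := subrX1 (expik k (node M 1 : R)) M.
have -> : expik k (node M 1) ^+ M = 1 :> R[i].
  by rewrite -expik_node /node mulfV ?mulr1 ?expik2pi// pnatr_eq0; lia.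
rewrite subrr => /esym/eqP; rewrite mulf_eq0 subr_eq0 (negbTE (expik_node_neq1 k0 kM))/=.
by move/eqP.
Qed.

(** Frequencies in [-N, N] differ by at most 2 N, so they stay distinct modulo 2 N + 1 and sampling
    at that many nodes recovers each coefficient. *)
Lemma fourier_coef (V : normedModType R[i]) N (v : int -> V) (k : int) : (`|k| <= N)%N ->
  \sum_(j < N.*2.+1) expik (- k) (node N.*2.+1 j) *: fourier_sum N v (node N.*2.+1 j)
  = N.*2.+1%:R *: v k.
Proof.
move=> kN; set M := N.*2.+1.
rewrite /fourier_sum; under eq_bigr do rewrite scaler_sumr.
rewrite exchange_big/= -/M.
have h : (`|(k + N%:Z)%R| < M)%N by rewrite /M; lia.
rewrite (bigD1 (Ordinal h))//= [X in _ + X]big1 ?addr0 => [|i ik].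
  under eq_bigr do rewrite scalerA -expikDk.
  rewrite -scaler_suml sum_expik_node ?/M; last by lia.
  have E : (`|(k + N%:Z)%R|%N%:Z - N%:Z)%R = k by lia.
  by rewrite E addNr eqxx.
under eq_bigr do rewrite scalerA -expikDk.
rewrite -scaler_suml sum_expik_node; last by have := ltn_ord i; rewrite /M; lia.
case: ifP => [/eqP e|_]; last by rewrite scale0r.
by move/eqP: ik; case; apply/val_inj => /=; lia.
Qed.

Lemma fourier_sum_inj (V : normedModType R[i]) N (v : int -> V) :
  (forall s, 0 <= s -> s < 2 * pi -> fourier_sum N v s = 0) ->
  forall k : int, (`|k| <= N)%N -> v k = 0.
Proof.
move=> h k kN; have := fourier_coef v kN; rewrite big1 => [/esym/eqP|j _].
  by rewrite scaler_eq0 pnatr_eq0/= => /eqP.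
rewrite h ?scaler0// /node; first by rewrite !mulr_ge0 ?pi_ge0 ?invr_ge0.
by rewrite gtr_pMr ?mulr_gt0 ?pi_gt0// ltr_pdivrMr// mul1r ltr_nat ltn_ord.
Qed.

End discrete_orthogonality.

(** * Fejer approximation *)

Section fejer.
Context (R : realType).

Lemma conjc_expik (k : int) (s : R) : (expik k s)^*%C = expik (- k) s.
Proof. by rewrite expikNk expikN. Qed.

Section kernel.
Variable N : nat.
(** Triples (a, b, j): a - b is a frequency of the kernel and j numbers the node. *)
Let I : finType := ('I_N.+1 * 'I_N.+1 * 'I_N.+2)%type.
Let kap (i : I) : int := (i.1.1 : nat)%:Z - (i.1.2 : nat)%:Z.
Let c : R := N.+1%:R^-1 * N.+2%:R^-1.

(* Fourier coefficients of the discrete convolution of f with the Fejer kernel. *)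
Definition fejer (V : normedModType R[i]) (f : R -> V) (k : int) : V :=
  \sum_(i : I | kap i == k) c%:C *: (expik (- kap i) (node R N.+2 i.2) *: f (node R N.+2 i.2)).

(** The Fejer kernel of degree N divided by N + 2, the number of nodes. The squared modulus makes
    positivity immediate; [fejer_kernelE] recovers the frequencies. *)
Definition fejer_kernel (s : R) : R :=
  c * complex.Re `|\sum_(a < N.+1) expik (a : nat)%:Z s| ^+ 2.

Lemma fejer_kernel_ge0 s : 0 <= fejer_kernel s.
Proof.
by apply: mulr_ge0; [rewrite mulr_ge0 ?invr_ge0|exact/exprn_ge0/Re_normr_ge0].
Qed.

Lemma fejer_kernelE s : (fejer_kernel s)%:C =
  c%:C * \sum_(ab : 'I_N.+1 * 'I_N.+1) expik ((ab.1 : nat)%:Z - (ab.2 : nat)%:Z) s.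
Proof.
have E (z : R[i]) : (complex.Re `|z| ^+ 2)%:C = z * z^*%C.
  by rewrite rmorphXn/= -normCK; congr (_ ^+ 2).
rewrite /fejer_kernel rmorphM/= E.
have -> : (\sum_(a < N.+1) expik (a : nat)%:Z s)^*%C = \sum_(a < N.+1) expik (- (a : nat)%:Z) s.
  by rewrite (rmorph_sum (@conjc R)); apply: eq_bigr => a _; exact: conjc_expik.
congr (_ * _); rewrite big_distrlr/= pair_big/=; apply: eq_bigr => -[a b] _ /=.
by rewrite expikDk.
Qed.

Lemma linf_fejer (V W : normedModType R[i]) (L : V -> W) (f : R -> V) k : linear L ->
  L (fejer f k) = fejer (L \o f) k.
Proof.
by move=> lL; rewrite /fejer (linf_sum lL); apply: eq_bigr => i _; rewrite !(linfZ lL).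
Qed.

Lemma fejer_sumE (V : normedModType R[i]) (f : R -> V) s :
  fourier_sum N (fejer f) s =
  \sum_(j < N.+2) (fejer_kernel (s - node R N.+2 j))%:C *: f (node R N.+2 j).
Proof.
rewrite /fejer fourier_sum_family; last first.
  by move=> [[a b] j]; rewrite /kap/=; have := ltn_ord a; have := ltn_ord b; lia.
transitivity (\sum_(ab : 'I_N.+1 * 'I_N.+1) \sum_(j < N.+2)
   expik ((ab.1 : nat)%:Z - (ab.2 : nat)%:Z) (s - node R N.+2 j) *: (c%:C *: f (node R N.+2 j))).
  rewrite pair_big/=; apply: eq_bigr => -[[a b] j] _ /=.
  by rewrite !scalerA expikNk expikD /kap/=; congr (_ *: _); ring.
rewrite exchange_big/=; apply: eq_bigr => j _.
by rewrite fejer_kernelE -scaler_suml scalerA mulrC.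
Qed.

(** Summation over the nodes keeps the pairs with a - b + l = 0, of which there are N + 1 - l. N + 2
    nodes suffice because |a - b + l| <= N + 1 for l <= 1. *)
Let moment (l : nat) s : (l <= 1)%N ->
  \sum_(j < N.+2) (fejer_kernel (s - node R N.+2 j))%:C * expik l%:Z (s - node R N.+2 j)
  = ((N.+1 - l)%:R / N.+1%:R)%:C.
Proof.
move=> l1; under eq_bigr do rewrite fejer_kernelE mulrAC mulr_sumr.
rewrite exchange_big/=.
transitivity (\sum_(ab : 'I_N.+1 * 'I_N.+1)
   (if (ab.1 + l == ab.2)%N then (N.+1%:R^-1)%:C else 0 : R[i])).
  apply: eq_bigr => -[a b] _ /=; have ha := ltn_ord a; have hb := ltn_ord b.
  pose m : int := (a : nat)%:Z - (b : nat)%:Z + l%:Z.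
  transitivity (c%:C * expik m s * \sum_(j < N.+2) expik (- m) (node R N.+2 j)).
    rewrite mulr_sumr; apply: eq_bigr => j _.
    by rewrite expikNk -[in RHS]mulrA -expikD /m (expikDk _ l%:Z); ring.
  rewrite sum_expik_node; last by rewrite /m; lia.
  rewrite oppr_eq0; have -> : (m == 0) = (a + l == b)%N by rewrite /m; lia.
  case: ifP => [ab|]; last by rewrite mulr0.
  have -> : m = 0 by rewrite /m; move/eqP: ab; lia.
  by rewrite expik0k mulr1 -(rmorph_nat (real_complex R)) -rmorphM/= /c mulfVK// pnatr_eq0.
rewrite -big_mkcond/= sumr_const.
suff -> : #|[pred ab : 'I_N.+1 * 'I_N.+1 | (ab.1 + l == ab.2)%N]| = (N.+1 - l)%N.
  by rewrite -[LHS]mulr_natl -(rmorph_nat (real_complex R)) -rmorphM.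
rewrite -[RHS]card_ord.
have hw (i : 'I_(N.+1 - l)) : (i < N.+1)%N by have := ltn_ord i; lia.
have hw' (i : 'I_(N.+1 - l)) : (i + l < N.+1)%N by have := ltn_ord i; lia.
rewrite -(card_codom (f := fun i => (Ordinal (hw i), Ordinal (hw' i)))); last first.
  by move=> i j [] e _; apply: val_inj.
apply: eq_card => -[a b]; rewrite unfold_in/=; apply/eqP/codomP => [e|[i [-> ->]]//].
have h : (a < N.+1 - l)%N by have := ltn_ord b; lia.
by exists (Ordinal h); congr pair; apply/val_inj => /=.
Qed.

Lemma fejer_kernel_sum s : \sum_(j < N.+2) fejer_kernel (s - node R N.+2 j) = 1.
Proof.
have := @moment 0 s (leq0n _); under eq_bigr do rewrite expik0k mulr1.
rewrite -rmorph_sum/= => /complexI ->.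
by rewrite subn0 divff// pnatr_eq0.
Qed.

Lemma fejer_kernel_cos s : \sum_(j < N.+2) fejer_kernel (s - node R N.+2 j) *
  cos (s - node R N.+2 j) = 1 - N.+1%:R^-1.
Proof.
have := congr1 (@complex.Re R) (@moment 1 s (leqnn _)); rewrite (raddf_sum (@complex.Re R))/=.
have -> : (N.+1 - 1)%:R / N.+1%:R = 1 - N.+1%:R^-1 :> R.
  by rewrite subn1/= -natr1; field; rewrite natr1 pnatr_eq0.
by move=> <-; apply: eq_bigr => j _; rewrite mul0r subr0 mul1r.
Qed.

End kernel.

Lemma node_itv M j : (j < M)%N -> 0 <= node R M j <= 2 * pi.
Proof.
move=> jM; have M0 : (0 : R) < M%:R by rewrite ltr0n; lia.
rewrite /node !mulr_ge0 ?pi_ge0 ?invr_ge0//= ger_pMr ?mulr_gt0 ?pi_gt0//.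
by rewrite ler_pdivrMr// mul1r ler_nat ltnW.
Qed.

(** Uniform continuity on the circle in Korovkin's form: 1 - cos (s - r) vanishes only when s and r
    agree modulo 2 pi, and its average against the kernel is explicit. *)
Definition periodic_modulus (V : normedModType R[i]) (f : R -> V) := forall e : R, 0 < e ->
  exists2 C : R, 0 <= C & forall s r, 0 <= s <= 2 * pi -> 0 <= r <= 2 * pi ->
    rnorm (f s - f r) <= e + C * (1 - cos (s - r)).

(* Korovkin: positivity of the kernel reduces convergence to its first moment. *)
Theorem fejer_uniform_cvg (V : normedModType R[i]) (f : R -> V) (e : R) :
  periodic_modulus f -> 0 < e ->
  exists N0 : nat, forall N s, (N0 <= N)%N -> 0 <= s <= 2 * pi ->
    rnorm (fourier_sum N (fejer N f) s - f s) <= e.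
Proof.
move=> hf e0; have e2 : 0 < e / 2 by rewrite divr_gt0.
have [C C0 hC] := hf _ e2.
(* The kernel average of C (1 - cos) is C / (N + 1); from this index on it is at most e / 2. *)
exists (Num.truncn (C / (e / 2))) => N s hN s2.
have -> : fourier_sum N (fejer N f) s - f s =
    \sum_(j < N.+2) (fejer_kernel N (s - node R N.+2 j))%:C *: (f (node R N.+2 j) - f s).
  under eq_bigr do rewrite scalerBr.
  rewrite sumrB -scaler_suml -rmorph_sum/= fejer_kernel_sum scale1r.
  by rewrite fejer_sumE.
apply: le_trans (rnorm_sum _ _ _) _.
apply: le_trans (_ : \sum_(j < N.+2) (fejer_kernel N (s - node R N.+2 j) * (e / 2 + C) -
    C * (fejer_kernel N (s - node R N.+2 j) * cos (s - node R N.+2 j))) <= _).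
  apply: ler_sum => j _; rewrite rnormZr ger0_norm ?fejer_kernel_ge0//.
  have := hC s (node R N.+2 j) s2 (node_itv (ltn_ord j)); rewrite rnormB => h.
  have := ler_wpM2l (fejer_kernel_ge0 N (s - node R N.+2 j)) h.
  by move/le_trans; apply; rewrite le_eqVlt; apply/orP; left; apply/eqP; ring.
rewrite sumrB -mulr_suml fejer_kernel_sum -mulr_sumr fejer_kernel_cos.
have : C / N.+1%:R <= e / 2.
  rewrite ler_pdivrMr// mulrC -ler_pdivrMr//; apply: ltW; apply: lt_le_trans (truncnS_gt _) _.
  by rewrite ler_nat.
by rewrite mulrBr mul1r mulr1; move: (C / _) => q; lra.
Qed.

Lemma cos_le_gap (d t : R) : 0 < d -> d <= pi -> d <= t -> t <= 2 * pi - d -> cos t <= cos d.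
Proof.
move=> d0 dpi dt td.
have le_cos (a : R) : d <= a -> a <= pi -> cos a <= cos d.
  move=> da api; rewrite leNgt ltr_cos ?in_itv/= ?api ?dpi ?(ltW d0) ?(le_trans (ltW d0) da)//.
  by rewrite -leNgt.
have [tpi|tpi] := leP t pi; first exact: le_cos.
have -> : cos t = cos (2 * pi - t).
  by rewrite [2 * pi - t]addrC mulr_natl cosD2pi cosN.
by apply: le_cos; lra.
Qed.

(** Take r <= s. If s - r <= d, uniform continuity applies. If d < s - r <= 2 pi - d, then 1 - cos
    (s - r) >= 1 - cos d and the constant 2 K / (1 - cos d) covers the trivial bound 2 K. Otherwise
    s is near 2 pi and r near 0, and the path through f (2 pi) = f 0 costs e / 2 twice. *)
Lemma uniform_periodic_modulus (V : normedModType R[i]) (f : R -> V) :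
  (forall e : R, 0 < e -> exists2 d : R, 0 < d & forall s r, 0 <= s <= 2 * pi ->
     0 <= r <= 2 * pi -> `|s - r| <= d -> rnorm (f s - f r) <= e) ->
  (exists K : R, forall s, 0 <= s <= 2 * pi -> rnorm (f s) <= K) ->
  f 0 = f (2 * pi) -> periodic_modulus f.
Proof.
move=> fu [K hK] f2 e e0; have pi0 := pi_gt0 R.
have e2 : 0 < e / 2 by rewrite divr_gt0.
have [d0 d00 hd0] := fu _ e2.
pose d := Num.min d0 pi.
have d_gt0 : 0 < d by rewrite lt_min d00.
have dd0 : d <= d0 by rewrite ge_min lexx.
have dpi : d <= pi by rewrite ge_min lexx orbT.
have cd : 0 < 1 - cos d.
  rewrite subr_gt0 -[X in _ < X]cos0 ltr_cos ?in_itv/= ?lexx ?(ltW pi0) ?dpi ?(ltW d_gt0)//.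
have K0 : 0 <= K by apply: le_trans (rnorm_ge0 (f 0)) _; apply: hK; rewrite lexx/= mulr_ge0 ?pi_ge0.
exists (2 * K / (1 - cos d)); first by rewrite divr_ge0 ?mulr_ge0// ltW.
have C0 : 0 <= 2 * K / (1 - cos d) by rewrite divr_ge0 ?mulr_ge0// ltW.
have cosB (a : R) : 0 <= 2 * K / (1 - cos d) * (1 - cos a).
  by rewrite mulr_ge0// subr_ge0 cos_le1.
suff H s r : 0 <= s <= 2 * pi -> 0 <= r <= 2 * pi -> r <= s ->
    rnorm (f s - f r) <= e + 2 * K / (1 - cos d) * (1 - cos (s - r)).
  move=> s r hs hr; have [rs|/ltW sr] := leP r s; first exact: H.
  by rewrite rnormB -(cosN (s - r)) opprB; exact: H.
move=> hs hr rs; have := cosB (s - r).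
have [sr|sr] := leP (s - r) d.
  have : rnorm (f s - f r) <= e / 2.
    by apply: hd0 => //; rewrite ger0_norm ?subr_ge0//; lra.
  by lra.
have [sr2|sr2] := leP (s - r) (2 * pi - d).
  have := cos_le_gap d_gt0 dpi (ltW sr) sr2 => h _.
  have : 2 * K <= 2 * K / (1 - cos d) * (1 - cos (s - r)).
    rewrite mulrAC ler_pdivlMr// ler_wpM2l ?mulr_ge0//; lra.
  have := rnormD (f s) (- f r); rewrite rnormN; have := hK s hs; have := hK r hr.
  by lra.
move=> _; have z0 : 0 <= (0 : R) <= 2 * pi by lra.
have z2 : 0 <= (2 * pi : R) <= 2 * pi by lra.
have h1 : rnorm (f s - f (2 * pi)) <= e / 2.
  by apply: hd0 => //; rewrite distrC ger0_norm; lra.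
have h2 : rnorm (f 0 - f r) <= e / 2.
  by apply: hd0 => //; rewrite distrC subr0 ger0_norm; lra.
have := rnorm_triangle (f s) (f (2 * pi)) (f r); rewrite -{2}f2.
by have := cosB (s - r); lra.
Qed.

End fejer.

(** * The spaces L^p *)

Section linear_strong_measurability.
Context d (T : measurableType d) (R : realType).
Implicit Types V W : normedModType R[i].

Lemma strongly_measurable_linf V W (L : V -> W) (f : T -> V) : linear L -> continuous L ->
  strongly_measurable f -> strongly_measurable (fun t => L (f t)).
Proof.
move=> lL cL [g [sg cg]]; exists (fun n t => L (g n t)); split=> [n|t].
  split=> [|x]; last exact: (simple_fun_preimage [set y | L y = x] (sg n)).
  apply: (@sub_finite_set _ _ [set L x | x in range (g n)]).
    by move=> _ [t _ <-]; exists (g n t) => //; exists t.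
  exact/finite_image/(proj1 (sg n)).
exact: (cvg_comp _ _ (cg t) (cL (f t))).
Qed.

Lemma strongly_measurable_comp d' (T' : measurableType d') V (f : T -> V) (h : T' -> T) :
  measurable_fun setT h -> strongly_measurable f -> strongly_measurable (f \o h).
Proof.
move=> mh [g [sg cg]]; exists (fun n => g n \o h); split=> [n|t]; last exact: cg.
split=> [|x].
  apply: (@sub_finite_set _ _ (range (g n))); last exact: (proj1 (sg n)).
  by move=> _ [t _ <-]; exists (h t).
by have := mh measurableT _ (proj2 (sg n) x); rewrite setTI.
Qed.

End linear_strong_measurability.

Section Lp_classes.
Context d (T : measurableType d) (R : realType).
Variables (mu : {measure set T -> \bar R}) (p : R) (p1 : 1 <= p).
Local Notation Lp := (Lp mu p1).
Implicit Types V W : normedModType R[i].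

Let p0 : 0 < p. Proof. exact: lt_le_trans p1. Qed.

Definition in_Lp V (f : T -> V) :=
  strongly_measurable f /\ (Lp_norm mu p f < +oo)%E.

Definition normLp V (f : T -> V) : R := fine (Lp_norm mu p f).

Lemma normLpE V (f : T -> V) : in_Lp f -> Lp_norm mu p f = (normLp f)%:E.
Proof. by move=> [_ h]; rewrite /normLp fineK// ge0_fin_numE// Lnorm_ge0. Qed.

Lemma normLp_ge0 V (f : T -> V) : 0 <= normLp f.
Proof. by rewrite fine_ge0// Lnorm_ge0. Qed.

Lemma repr_in_Lp V (F : Lp V) : in_Lp (repr F).
Proof. by have := LpFun_mem (repr (F : Lp V)); rewrite inE. Qed.

Lemma rnorm_LpE V (F : Lp V) : rnorm F = normLp (repr F).
Proof. by []. Qed.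

Lemma in_LpB V (f g : T -> V) : in_Lp f -> in_Lp g -> in_Lp (f - g).
Proof.
move=> [mf ff] [mg fg]; have mg' := strongly_measurableZ (-1) mg.
rewrite -[- g]scaleN1r; split; first exact: strongly_measurableD.
apply: le_lt_trans (Lp_normD mu p1 mf mg') _; rewrite lte_add_pinfty//.
by rewrite Lp_normZ// lte_mul_pinfty// lee_fin Re_normr_ge0.
Qed.

Lemma in_LpD V (f g : T -> V) : in_Lp f -> in_Lp g -> in_Lp (f + g).
Proof.
move=> [mf ff] [mg fg]; split; first exact: strongly_measurableD.
by apply: le_lt_trans (Lp_normD mu p1 mf mg) _; rewrite lte_add_pinfty.
Qed.

Lemma in_LpZ V a (f : T -> V) : in_Lp f -> in_Lp (a *: f).
Proof.
move=> [mf ff]; split; first exact: strongly_measurableZ.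
by rewrite Lp_normZ// lte_mul_pinfty// lee_fin Re_normr_ge0.
Qed.

Lemma normLpD V (f g : T -> V) : in_Lp f -> in_Lp g ->
  normLp (f + g) <= normLp f + normLp g.
Proof.
move=> mf mg; rewrite -lee_fin EFinD -!normLpE//; last exact: in_LpD.
exact: Lp_normD mf.1 mg.1.
Qed.

Lemma normLpZ V a (f : T -> V) : in_Lp f ->
  normLp (a *: f) = complex.Re `|a| * normLp f.
Proof.
move=> mf; apply: EFin_inj; rewrite EFinM -!normLpE//; last exact: in_LpZ.
exact: Lp_normZ mf.1.
Qed.

Lemma Lp_class_aeE V (f : T -> V) : in_Lp f ->
  {ae mu, forall t, repr (Lp_class mu p1 f) t = f t}.
Proof. by move=> [mf ff]; exact: Lp_classP. Qed.

Lemma Lp_class_eq V (f g : T -> V) : in_Lp f -> in_Lp g ->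
  {ae mu, forall t, f t = g t} -> Lp_class mu p1 f = Lp_class mu p1 g.
Proof.
move=> mf mg fg; apply: Lp_eq.
by apply: filterS3 (Lp_class_aeE mf) (Lp_class_aeE mg) fg => t -> ->.
Qed.

Lemma Lp_classK V (F : Lp V) : Lp_class mu p1 (repr F) = F.
Proof. by apply: Lp_eq; exact: Lp_class_aeE (repr_in_Lp F). Qed.

Lemma Lp_class_linear V a (f g : T -> V) : in_Lp f -> in_Lp g ->
  Lp_class mu p1 (a *: f + g) = a *: Lp_class mu p1 f + Lp_class mu p1 g.
Proof.
move=> mf mg; apply: Lp_eq.
have maf := in_LpZ a mf.
have h1 := Lp_class_aeE (in_LpD maf mg).
have h2 := Lp_reprD (a *: Lp_class mu p1 f : Lp V) (Lp_class mu p1 g).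
have h3 := Lp_reprZ a (Lp_class mu p1 f : Lp V).
apply: filterS3 h1 h2 (filterI h3 (filterI (Lp_class_aeE mf) (Lp_class_aeE mg))) => t.
by move=> e1 e2 [e3 [e4 e5]]; rewrite e1 [RHS]e2 [in RHS]e3 [in RHS]e4 [in RHS]e5.
Qed.

Lemma Lp_classZ V a (f : T -> V) : in_Lp f -> Lp_class mu p1 (a *: f) = a *: Lp_class mu p1 f.
Proof.
move=> Lf; apply: (addIr (Lp_class mu p1 f)).
rewrite -Lp_class_linear//; have := Lp_class_linear 1 (in_LpZ a Lf) Lf.
by rewrite !scale1r.
Qed.

Lemma Lp_classB V (f g : T -> V) : in_Lp f -> in_Lp g ->
  Lp_class mu p1 (f - g) = Lp_class mu p1 f - Lp_class mu p1 g.
Proof.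
by move=> Lf Lg; have := Lp_class_linear (-1) Lg Lf; rewrite !scaleN1r addrC [RHS]addrC.
Qed.

Lemma ae_normLp V (f g : T -> V) : in_Lp f -> in_Lp g ->
  {ae mu, forall t, f t = g t} -> normLp f = normLp g.
Proof. by move=> mf mg fg; rewrite /normLp (ae_Lp_norm p mf.1 mg.1 fg). Qed.

Lemma rnorm_Lp_class V (f : T -> V) : in_Lp f -> rnorm (Lp_class mu p1 f) = normLp f.
Proof.
move=> mf; rewrite rnorm_LpE; apply: ae_normLp => //; first exact: repr_in_Lp.
exact: Lp_class_aeE.
Qed.

Lemma normLpBC V (f g : T -> V) : in_Lp f -> in_Lp g -> normLp (f - g) = normLp (g - f).
Proof.
move=> Lf Lg; rewrite -[f - g]opprB -scaleN1r normLpZ ?normrN1 ?mul1r//.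
exact: in_LpB.
Qed.

Lemma normLpB V (f g : T -> V) : in_Lp f -> in_Lp g ->
  normLp (f - g) <= normLp f + normLp g.
Proof.
move=> Lf Lg; have := normLpD Lf (in_LpZ (-1) Lg).
by rewrite normLpZ// normrN1 mul1r scaleN1r.
Qed.

Lemma normLp_triangle V (f g h : T -> V) : in_Lp f -> in_Lp g -> in_Lp h ->
  normLp (f - h) <= normLp (f - g) + normLp (g - h).
Proof.
by move=> Lf Lg Lh; rewrite -(subrKA g f); apply: normLpD; exact: in_LpB.
Qed.

Lemma normLp_eq0 V (f : T -> V) : in_Lp f -> normLp f = 0 ->
  {ae mu, forall t, f t = 0}.
Proof.
by move=> mf f0; apply: (Lp_norm_eq0 p1 mf.1); rewrite normLpE// f0.
Qed.

Lemma Lnorm_le_ae (h k : T -> R) : measurable_fun setT h -> measurable_fun setT k ->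
  {ae mu, forall t, `|h t| <= `|k t|} ->
  ('N[mu]_p%:E[EFin \o h] <= 'N[mu]_p%:E[EFin \o k])%E.
Proof.
move=> mh mk hk; rewrite unlock /Lnorm/=.
have m u : measurable_fun [set: T] u ->
    measurable_fun [set: T] (fun t => (`|u t : R| `^ p)%:E).
  move=> mu'; apply/measurable_EFinP.
  apply: (measurableT_comp (measurable_powR _)).
  exact: measurableT_comp.
apply: gt0_ler_poweR; first by rewrite invr_ge0 ltW.
- by rewrite in_itv/= leey integral_ge0// => t _; rewrite lee_fin powR_ge0.
- by rewrite in_itv/= leey integral_ge0// => t _; rewrite lee_fin powR_ge0.
apply: ae_ge0_le_integral => //; [exact: m|exact: m|].
apply: filterS hk => t htk _; rewrite lee_fin; apply: ge0_ler_powR; rewrite ?nnegrE//.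
exact: ltW.
Qed.

Lemma in_Lp_le V W (K : R) (f : T -> V) (g : T -> W) : 0 <= K ->
  strongly_measurable f -> in_Lp g -> {ae mu, forall t, rnorm (f t) <= K * rnorm (g t)} ->
  in_Lp f /\ normLp f <= K * normLp g.
Proof.
move=> K0 mf Lg fg; have LKg := in_LpZ K%:C Lg.
have le : (Lp_norm mu p f <= Lp_norm mu p (K%:C *: g))%E.
  apply: Lnorm_le_ae; [exact: measurable_rnorm|exact: measurable_rnorm LKg.1|].
  apply: filterS fg => t; rewrite !ger0_norm ?rnorm_ge0//.
  by rewrite -{1}(ger0_norm K0) -rnormZr.
have Lf : in_Lp f by split=> //; apply: le_lt_trans le LKg.2.
split=> //; move: le; rewrite !normLpE// lee_fin normLpZ//.
by rewrite normc_def/= expr0n addr0 sqrtr_sqr ger0_norm.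
Qed.

Lemma in_Lp_linf V W (L : V -> W) (K : R) (f : T -> V) : linear L -> 0 <= K ->
  (forall x, rnorm (L x) <= K * rnorm x) -> in_Lp f ->
  in_Lp (L \o f) /\ normLp (L \o f) <= K * normLp f.
Proof.
move=> lL K0 hK Lf; apply: in_Lp_le => //; last by apply: nearW => t; exact: hK.
by apply: strongly_measurable_linf => //; [exact: (bounded_linf_continuous lL hK)|exact: Lf.1].
Qed.

End Lp_classes.

Section lebesgue_2pi.
Context (R : realType).
Implicit Types V W : normedModType R[i].

Local Notation mu := (lebesgue_2pi R).
Local Notation T := (measurableTypeR R).

Let pi2 : 0 < 2 * pi :> R. Proof. by rewrite mulr_gt0 ?pi_gt0. Qed.

Lemma lebesgue_2piT : mu setT = (2 * pi)%:E.
Proof.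
rewrite /lebesgue_2pi/= /mrestr setTI lebesgue_measure_itv/= lte_fin pi2.
by rewrite -EFinB subr0.
Qed.

(** The end point 2 pi is a null set; leaving it out matches the range [0, 2 pi[ of [mod2pi]. *)
Lemma ae_2pi (P : R -> Prop) : (forall s, 0 <= s -> s < 2 * pi -> P s) -> {ae mu, forall s, P s}.
Proof.
move=> h; exists ((~` `[0, 2 * pi[%classic) : set T); split.
- by apply: measurableC; exact: measurable_itv.
- rewrite /lebesgue_2pi/= /mrestr.
  apply: (@subset_measure0 _ _ _ lebesgue_measure _ [set (2 * pi : R)]).
  + by apply: measurableI; [apply: measurableC|]; exact: measurable_itv.
  + exact: measurable_set1.
  + move=> s [/= h1]; rewrite in_itv/= => /andP[s0 s2]; apply/eqP; rewrite eq_le s2 leNgt/=.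
    by apply/negP => s2'; apply: h1; rewrite in_itv/= s0.
  + exact: lebesgue_measure_set1.
- move=> s /= nP; rewrite in_itv/= => /andP[s0 s2]; apply: nP; exact: h.
Qed.

Lemma measurable_floor (h : T -> R) (Y : set int) : measurable_fun setT h ->
  measurable [set s | Y (Num.floor (h s))].
Proof.
move=> mh; rewrite (_ : [set s | _] =
    \bigcup_(k : int) (if k \in Y then h @^-1` `[k%:~R, (k + 1)%:~R[%classic else set0)).
  apply: countable_bigcupT_measurable => // k; case: ifP => // _.
  by rewrite -[X in measurable X]setTI; apply: mh => //; exact: measurable_itv.
apply/seteqP; split=> s /=.
  move=> Ys; exists (Num.floor (h s)) => //; rewrite mem_set//=.
  by rewrite in_itv/=; exact: (real_floor_itv (num_real _)).
move=> [k _]; case: ifPn => // /set_mem Yk /=; rewrite in_itv/= => hk.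
by rewrite (floor_def hk).
Qed.

(** f is sampled on the grid of mesh 1 / (n + 1) and replaced by 0 beyond (n + 1)^2 samples on
    either side, which keeps the range finite and eventually leaves every fixed s inside. *)
Lemma continuous_strongly_measurable V (f : R -> V) : continuous f ->
  strongly_measurable (f : T -> V).
Proof.
move=> cf; pose q (n : nat) (s : R) : int := Num.floor (s * n.+1%:R).
pose G n (k : int) : V := if (`|k| <= n.+1 * n.+1)%N then f (k%:~R / n.+1%:R) else 0.
exists (fun n s => G n (q n s)); split=> [n|s].
  split=> [|x]; last first.
    apply: (measurable_floor (h := fun s => s * n.+1%:R) [set k | G n k = x]).
    exact: measurable_funM.
  apply: (@sub_finite_set _ _ ([set 0] `|`
      [set G n ((j : nat)%:Z - (n.+1 * n.+1)%N%:Z) | j in `I_(2 * (n.+1 * n.+1)).+1])).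
    move=> _ [s _ <-]; have [h|h] := leqP `|q n s|%N (n.+1 * n.+1)%N; last first.
      by left; rewrite /G leqNgt h.
    right; exists `|(q n s + (n.+1 * n.+1)%N%:Z)%R|%N => /=; first by lia.
    by congr (G n _); lia.
  by rewrite finite_setU; split; [exact: finite_set1|exact/finite_image/finite_II].
apply/rnorm_cvgnP => e e0.
have /rnorm_cvgP /(_ e e0) := cf s; case=> d /= d0 hd.
exists (Num.truncn (Num.max d^-1 (`|s| + 1))) => n hn.
have : Num.max d^-1 (`|s| + 1) < n.+1%:R.
  by apply: lt_le_trans (truncnS_gt _) _; rewrite ler_nat.
rewrite gt_max => /andP[h1 h2].
have /andP[q1 q2] := real_floor_itv (num_real (s * n.+1%:R)).
rewrite -/(q n s) in q1 q2; rewrite intrD1 in q2.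
have n0 : (0 : R) < n.+1%:R by [].
have n1 : (1 : R) <= n.+1%:R by rewrite ler1n.
rewrite /G ifT; last first.
  have sn : `|s * n.+1%:R| <= `|s| * n.+1%:R by rewrite normrM [`|n.+1%:R|]ger0_norm.
  have hq : `|(q n s)%:~R : R| <= (`|s| + 1) * n.+1%:R.
    have := ler_norm (s * n.+1%:R); have := ler_norm (- (s * n.+1%:R)); rewrite normrN.
    rewrite mulrDl mul1r ler_norml => h3 h4; apply/andP; split; lra.
  have : `|(q n s)%:~R : R| <= n.+1%:R * n.+1%:R by apply: le_trans hq _; rewrite ler_wpM2r// ltW.
  by rewrite -intr_norm -abszE -natrM pmulrn ler_int lez_nat.
apply: hd => /=; have -> : s - (q n s)%:~R / n.+1%:R = (s * n.+1%:R - (q n s)%:~R) / n.+1%:R.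
  by field; rewrite ?nat1r ?natr1 pnatr_eq0.
rewrite normrM normfV [`|n.+1%:R|]ger0_norm// ltr_pdivrMr// ger0_norm ?subr_ge0//.
have : 1 < d * n.+1%:R by rewrite -ltr_pdivrMl// mulr1.
lra.
Qed.

Lemma measurable_mod2pi : measurable_fun setT (@mod2pi R : T -> T).
Proof.
apply: measurable_funB => //; apply: measurable_funM => //.
move=> _ Y mY; rewrite setTI.
apply: (measurable_floor (h := fun s => s / (2 * pi)) [set k : int | Y k%:~R]).
exact: measurable_funM.
Qed.

End lebesgue_2pi.

Section interval_2pi.
Context (R : realType) (p : R) (p1 : 1 <= p).
Implicit Types V W : normedModType R[i].

Local Notation mu := (lebesgue_2pi R).
Local Notation T := (measurableTypeR R).
Local Notation in_Lp := (in_Lp mu p).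
Local Notation normLp := (normLp mu p).

Let p0 : 0 < p. Proof. exact: lt_le_trans p1. Qed.
Let pi2 : 0 < 2 * pi :> R. Proof. by rewrite mulr_gt0 ?pi_gt0. Qed.

(** The L^p norm of the constant 1 on [0, 2 pi]. *)
Definition w2pi : R := (2 * pi) `^ p^-1.

Lemma w2pi_gt0 : 0 < w2pi. Proof. by rewrite powR_gt0. Qed.

Lemma Lnorm_2pi_cst (c : R) : 0 <= c -> 'N[mu]_p%:E[EFin \o cst c]%E = (c * w2pi)%:E.
Proof.
move=> c0; rewrite unlock /Lnorm/= integral_cst// lebesgue_2piT ger0_norm//.
by rewrite -EFinM poweR_EFin powRM ?powR_ge0 ?(ltW pi2)// -powRrM mulfV ?gt_eqF// powRr1.
Qed.

Lemma in_Lp_bounded V (f : T -> V) (c : R) : strongly_measurable f -> 0 <= c ->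
  (forall s, 0 <= s <= 2 * pi -> rnorm (f s) <= c) -> in_Lp f /\ normLp f <= c * w2pi.
Proof.
move=> mf c0 hc.
have le : (Lp_norm mu p f <= (c * w2pi)%:E)%E.
  rewrite -Lnorm_2pi_cst//; apply: Lnorm_le_ae => //; first exact: measurable_rnorm.
  by apply: ae_2pi => s s0 s2; rewrite !ger0_norm ?rnorm_ge0// hc// s0 ltW.
have Lf : in_Lp f by split=> //; apply: le_lt_trans le (ltry _).
by split=> //; rewrite -lee_fin -normLpE.
Qed.

Lemma normLp_bounded_below V (f : T -> V) (c : R) : in_Lp f -> 0 <= c ->
  (forall s, 0 <= s <= 2 * pi -> c <= rnorm (f s)) -> c * w2pi <= normLp f.
Proof.
move=> Lf c0 hc; rewrite -lee_fin -normLpE// -Lnorm_2pi_cst//.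
apply: Lnorm_le_ae => //; first exact: measurable_rnorm Lf.1.
by apply: ae_2pi => s s0 s2; rewrite !ger0_norm ?rnorm_ge0// hc// s0 ltW.
Qed.

End interval_2pi.

(** * Rotations of the circle preserve the measure *)

Section mod2pi_theory.
Context (R : realType).
Local Notation mu := (lebesgue_2pi R).
Local Notation T := (measurableTypeR R).
Implicit Types (s t : R).

Let pi2 : 0 < 2 * pi :> R. Proof. by rewrite mulr_gt0 ?pi_gt0. Qed.

Lemma mod2pi_itv s : 0 <= mod2pi s < 2 * pi.
Proof.
have /andP[h1 h2] := real_floor_itv (num_real (s / (2 * pi))).
rewrite /mod2pi subr_ge0 ltrBlDr; move: h1 h2; rewrite intrD1 ler_pdivlMr// ltr_pdivrMr//.
by move=> h1 h2; apply/andP; split; lra.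
Qed.

Lemma mod2pi_uniq s t (m : int) : s = t + 2 * pi * m%:~R -> 0 <= t -> t < 2 * pi -> mod2pi s = t.
Proof.
move=> -> t0 t2; rewrite /mod2pi (_ : Num.floor _ = m) ?addrK//.
apply: floor_def; rewrite intrD1 ler_pdivlMr// ltr_pdivrMr//.
by apply/andP; split; lra.
Qed.

Lemma mod2piP s : exists m : int, mod2pi s = s + 2 * pi * m%:~R.
Proof.
exists (- Num.floor (s / (2 * pi))).
by rewrite /mod2pi rmorphN/= mulrN.
Qed.

Lemma mod2pi_small s : 0 <= s -> s < 2 * pi -> mod2pi s = s.
Proof. by move=> s0 s2; apply: (@mod2pi_uniq s s 0) => //; rewrite mulr0 addr0. Qed.

Lemma mod2pi_period s (m : int) : mod2pi (s + 2 * pi * m%:~R) = mod2pi s.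
Proof.
have /andP[h1 h2] := mod2pi_itv s; have [n hn] := mod2piP s.
apply: (@mod2pi_uniq _ _ (m - n)) => //.
by rewrite hn rmorphB/=; ring.
Qed.

Lemma mod2pi_modB s t : mod2pi (mod2pi s - t) = mod2pi (s - t).
Proof.
have [n ->] := mod2piP s; rewrite -[RHS](mod2pi_period _ n); congr mod2pi; ring.
Qed.

Lemma mod2piB_mod s t : mod2pi (s - mod2pi t) = mod2pi (s - t).
Proof.
have [n ->] := mod2piP t; rewrite -[LHS](mod2pi_period _ n); congr mod2pi; ring.
Qed.

Lemma fourier_sum_mod2pi (V : normedModType R[i]) N (v : int -> V) s :
  fourier_sum N v (mod2pi s) = fourier_sum N v s.
Proof. by have [n ->] := mod2piP s; exact: fourier_sum_period. Qed.

Definition pushforward_measure d1 d2 (T1 : measurableType d1) (T2 : measurableType d2)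
    (nu : {measure set T1 -> \bar R}) (f : T1 -> T2) (mf : measurable_fun setT f) :
    {measure set T2 -> \bar R} :=
  measure_function_pushforward__canonical__measure_function_Measure nu mf.

(** The image measure agrees with Lebesgue measure on half-open intervals, which determine it. *)
Lemma lebesgue_measure_shift (c : R) (A : set T) : measurable A ->
  lebesgue_measure ((fun s : R => s - c) @^-1` A) = lebesgue_measure A.
Proof.
move=> mA; have ms : measurable_fun setT ((fun s : R => s - c) : T -> T) by exact: measurable_funB.
apply/esym; apply: (lebesgue_measure_unique (mu := pushforward_measure lebesgue_measure ms)) => //.
move=> _ [[a b] _ <-]; rewrite /pushforward_measure/= /pushforward/=.
rewrite (_ : _ @^-1` _ = `]a + c, b + c]%classic); last first.
  by apply/seteqP; split=> s /=; rewrite !in_itv/= ltrBrDr lerBlDr.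
by rewrite !lebesgue_measure_itv/= !lte_fin ltrD2r -!EFinB opprD addrACA subrr addr0.
Qed.

Lemma lebesgue_2pi_co (A : set T) : measurable A ->
  mu A = lebesgue_measure (A `&` `[0, 2 * pi[%classic).
Proof.
move=> mA; rewrite /lebesgue_2pi/= /mrestr.
have mI : measurable (A `&` `[(0 : R), 2 * pi[%classic) by apply: measurableI => //; exact: measurable_itv.
have mJ : measurable (A `&` `[(0 : R), 2 * pi]%classic) by apply: measurableI => //; exact: measurable_itv.
apply/eqP; rewrite eq_le; apply/andP; split; last first.
  by apply: le_measure; rewrite ?inE// => s [As]; rewrite /= !in_itv/= => /andP[-> /ltW].
have h2 : lebesgue_measure [set (2 * pi : R)] = 0%E by rewrite lebesgue_measure_set1.
rewrite -(measureU0 mI (measurable_set1 (2 * pi)) h2).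
apply: le_measure; rewrite ?inE//.
  by apply: measurableU => //; exact: measurable_set1.
move=> s [As]; rewrite /= in_itv/= => /andP[s0]; rewrite le_eqVlt => /predU1P[->|s2]; first by right.
by left; split=> //; rewrite /= in_itv/= s0.
Qed.

(** Modulo 2 pi, subtracting t translates [t, 2 pi[ onto [0, 2 pi - t[ and [0, t[ onto [2 pi - t, 2
    pi[; each piece is handled by invariance under translations. *)
Lemma lebesgue_2pi_shift t (A : set T) : measurable A ->
  mu ((fun s : R => mod2pi (s - t)) @^-1` A) = mu A.
Proof.
wlog /andP[t0 t2] : t / 0 <= t < 2 * pi.
  move=> h mA; rewrite -(h (mod2pi t) (mod2pi_itv t) mA).
  by congr (mu _); apply/seteqP; split=> s /=; rewrite mod2piB_mod.
move=> mA.
have mi (i : interval R) : measurable ([set` i] : set T) by exact: measurable_itv.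
have mt : measurable_fun setT ((fun s : R => mod2pi (s - t)) : T -> T).
  by apply: (measurableT_comp (@measurable_mod2pi R)); exact: measurable_funB.
have mtA : measurable ((fun s : R => mod2pi (s - t)) @^-1` A : set T).
  by rewrite -[X in measurable X]setTI; exact: mt.
rewrite !lebesgue_2pi_co//.
have disj (B : set T) (a b c : R) : measurable B -> a <= b -> b <= c ->
    lebesgue_measure (B `&` `[a, c[%classic) =
    (lebesgue_measure (B `&` `[a, b[%classic) + lebesgue_measure (B `&` `[b, c[%classic))%E.
  move=> mB ab bc; rewrite -measureU//.
  - congr lebesgue_measure; rewrite -setIUr; congr (_ `&` _).
    apply/seteqP; split=> s /=; rewrite !in_itv/=.
      by move=> /andP[-> ->]; rewrite andbT; case: (ltP s b); [left|right].
    by case=> /andP[h1 h2]; rewrite ?h1 ?h2 ?andbT/=; [exact: lt_le_trans bc|exact: le_trans h1].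
  - exact: measurableI.
  - exact: measurableI.
  - apply/seteqP; split=> s //= [[_]]; rewrite /= !in_itv/= => /andP[_ h1] [_ /andP[h2 _]].
    by have := lt_le_trans h1 h2; rewrite ltxx.
rewrite (disj _ 0 t (2 * pi))// ?(ltW t2)// (disj A 0 (2 * pi - t) (2 * pi))//; last 2 first.
- by rewrite subr_ge0 ltW.
- by rewrite gerBl.
rewrite addeC; congr (_ + _)%E.
- rewrite -(lebesgue_measure_shift t (measurableI _ _ mA (mi `[0, 2 * pi - t[))).
  congr lebesgue_measure; apply/seteqP; split=> s /=; rewrite !in_itv/=.
    by move=> [As /andP[h1 h2]]; rewrite mod2pi_small in As; [split=> //; lra|lra|lra].
  by move=> [As /andP[h1 h2]]; rewrite mod2pi_small; [split=> //; lra|lra|lra].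
- rewrite -(lebesgue_measure_shift (t - 2 * pi) (measurableI _ _ mA (mi `[2 * pi - t, 2 * pi[))).
  have E s : 0 <= s -> s < t -> mod2pi (s - t) = s - (t - 2 * pi).
    by move=> h1 h2; apply: (@mod2pi_uniq _ _ (-1)); [rewrite mulrN1; ring|lra|lra].
  congr lebesgue_measure; apply/seteqP; split=> s /=; rewrite !in_itv/=.
    by move=> [As /andP[h1 h2]]; rewrite E// in As; split=> //; lra.
  by move=> [As /andP[h1 h2]]; rewrite E; [split=> //; lra|lra|lra].
Qed.

Lemma ae_mod2pi_shift t (P : R -> Prop) : {ae mu, forall s, P s} ->
  {ae mu, forall s, P (mod2pi (s - t))}.
Proof.
have mt : measurable_fun setT ((fun s : R => mod2pi (s - t)) : T -> T).
  by apply: (measurableT_comp (@measurable_mod2pi R)); exact: measurable_funB.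
move=> [N [mN N0 PN]]; exists ((fun s : R => mod2pi (s - t)) @^-1` N); split.
- by rewrite -[X in measurable X]setTI; exact: mt.
- by rewrite lebesgue_2pi_shift.
- by move=> s /= nP; apply: PN.
Qed.

Section shift_norm.
Variables (p : R) (p1 : 1 <= p) (V : normedModType R[i]).

Lemma in_Lp_shift t (f : T -> V) : in_Lp mu p f ->
  in_Lp mu p (fun s => f (mod2pi (s - t))) /\
  normLp mu p (fun s => f (mod2pi (s - t))) = normLp mu p f.
Proof.
have mt : measurable_fun setT ((fun s : R => mod2pi (s - t)) : T -> T).
  by apply: (measurableT_comp (@measurable_mod2pi R)); exact: measurable_funB.
move=> [mf ff].
have E : Lp_norm mu p (fun s => f (mod2pi (s - t))) = Lp_norm mu p f.
  rewrite /Lp_norm unlock /Lnorm/=; congr (_ `^ _)%E.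
  have mh : measurable_fun setT (fun s : T => (`|rnorm (f s)| `^ p)%:E).
    apply/measurable_EFinP; apply: (measurableT_comp (measurable_powR _)).
    by apply: measurableT_comp => //; exact: measurable_rnorm.
  have := @ge0_integral_pushforward _ _ _ _ R _ mt mu setT _ measurableT mh.
  rewrite preimage_setT => <-; last by move=> s _; rewrite lee_fin powR_ge0.
  apply: (eq_measure_integral mu (m1 := pushforward_measure mu mt)) => A mA _.
  by rewrite /pushforward_measure/= /pushforward lebesgue_2pi_shift.
split; last by rewrite /normLp E.
by split; [exact: (strongly_measurable_comp mt)|rewrite E].
Qed.

End shift_norm.

End mod2pi_theory.

Section Lp_convergence.
Context d (T : measurableType d) (R : realType).
Variables (mu : {measure set T -> \bar R}) (p : R) (p1 : 1 <= p).
Variable V : normedModType R[i].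

Let p0 : 0 < p. Proof. exact: lt_le_trans p1. Qed.

Lemma normLp_dominated_cvg (f : nat -> T -> V) (g : T -> V) (e : R) :
  (forall n, strongly_measurable (f n)) -> in_Lp mu p g ->
  (forall n t, rnorm (f n t) <= rnorm (g t)) ->
  (forall t, f n t @[n --> \oo] --> (0 : V)) -> 0 < e ->
  exists n, normLp mu p (f n) <= e.
Proof.
move=> mf Lg fg f0 e0.
have Lf n : in_Lp mu p (f n).
  have h : {ae mu, forall t, rnorm (f n t) <= 1 * rnorm (g t)}.
    by apply: nearW => t; rewrite mul1r.
  exact: (in_Lp_le p1 ler01 (mf n) Lg h).1.
have m (h : T -> V) : strongly_measurable h ->
    measurable_fun [set: T] (fun t => (`|rnorm (h t)| `^ p)%:E).
  move=> mh; apply/measurable_EFinP; apply: (measurableT_comp (measurable_powR _)).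
  by apply: measurableT_comp => //; exact: measurable_rnorm.
have ig : mu.-integrable setT (fun t => (`|rnorm (g t)| `^ p)%:E).
  apply/integrableP; split; first exact: m Lg.1.
  under eq_integral do rewrite gee0_abs ?lee_fin ?powR_ge0//.
  have := Lg.2; rewrite /Lp_norm unlock /Lnorm/=.
  by apply: lty_poweRy; rewrite invr_eq0 gt_eqF.
have [||_ _] := @dominated_convergence _ _ _ mu setT measurableT
  (fun n t => (`|rnorm (f n t)| `^ p)%:E) (cst 0%E) (fun t => (`|rnorm (g t)| `^ p)%:E)
  (fun n => m _ (mf n)) (measurable_cst _) _ ig _.
- apply: nearW => t _; apply/fine_cvgP; split; first exact: nearW.
  (* The minimum with 1 is taken because a number in [0, 1] dominates its p-th power, as p >= 1. *)
  apply/cvgrPdist_le => e' e'0; have e1 : 0 < Num.min 1 e' by rewrite lt_min ltr01.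
  have /rnorm_cvgP /(_ _ e1) := f0 t; apply: filterS => n.
  rewrite subr0 le_min => /andP[n1 ne]; rewrite /= sub0r normrN.
  rewrite (ger0_norm (powR_ge0 _ _)) (ger0_norm (rnorm_ge0 _)).
  have [->|r0] := eqVneq (rnorm (f n t)) 0; first by rewrite powR0 ?gt_eqF// ltW.
  apply: le_trans ne; apply: ge1r_powR => //.
  by rewrite n1 andbT lt_neqAle eq_sym r0 rnorm_ge0.
- apply: nearW => t n _; rewrite gee0_abs ?lee_fin ?powR_ge0//.
  apply: ge0_ler_powR; rewrite ?nnegrE ?(ltW p0)//.
  by rewrite !ger0_norm ?rnorm_ge0.
rewrite integral_cst// mul0e => /fine_cvgP[hfin /cvgrPdist_le /(_ (e `^ p))].
rewrite powR_gt0// => /(_ isT) hle.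
have [n [hn1 hn2]] := filter_ex (filterI hfin hle).
exists n; rewrite -lee_fin -normLpE// /Lp_norm unlock /Lnorm/=.
move: hn2; rewrite sub0r normrN => /(le_trans (ler_norm _)) hn2.
rewrite -[X in (X `^ _)%E](fineK hn1) poweR_EFin lee_fin.
have -> : e = (e `^ p) `^ p^-1 by rewrite -powRrM mulfV ?gt_eqF// powRr1// ltW.
apply: ge0_ler_powR; rewrite ?nnegrE ?powR_ge0 ?invr_ge0 ?(ltW p0)//.
by rewrite fine_ge0// integral_ge0// => t _; rewrite lee_fin powR_ge0.
Qed.

Lemma simple_fun_strongly_measurable (f : T -> V) : simple_fun f -> strongly_measurable f.
Proof. by move=> sf; exists (fun=> f); split=> // t; exact: cvg_cst. Qed.

Lemma simple_fun_restrict (f : T -> V) (A : set T) : simple_fun f -> measurable A ->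
  simple_fun (fun t => if t \in A then f t else 0).
Proof.
move=> sf mA; split=> [|x].
  apply: (@sub_finite_set _ _ ([set 0] `|` range f)).
    by move=> _ [t _ <-]; case: ifP => _; [right; exists t|left].
  by rewrite finite_setU; split; [exact: finite_set1|exact: sf.1].
rewrite (_ : _ @^-1` _ = (A `&` f @^-1` [set x]) `|` (~` A `&` (fun=> 0 : V) @^-1` [set x])).
  apply: measurableU; apply: measurableI => //; first exact: sf.2.
    exact: measurableC.
  by rewrite preimage_cst; case: ifP.
apply/seteqP; split=> t /=.
  by case: ifPn => [/set_mem At ftx|/negP nA x0]; [left|right; split=> // At; apply: nA; exact/mem_set].
by case=> -[At ftx]; [rewrite mem_set|rewrite memNset].
Qed.

(** The simple functions converging to f pointwise are cut off where they exceed 2 |f|, so that the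
    errors are dominated by 3 |f|. Where f is nonzero the cut is eventually inactive; where f is
    zero it forces the value 0. *)
Theorem simple_fun_dense (f : T -> V) (e : R) : in_Lp mu p f -> 0 < e ->
  exists g : T -> V, [/\ simple_fun g, in_Lp mu p g & normLp mu p (f - g) <= e].
Proof.
move=> Lf e0; have [g [sg cg]] := Lf.1.
pose B n : set T := [set t | rnorm (g n t) <= 2 * rnorm (f t)].
have mB n : measurable (B n).
  have mfg : measurable_fun setT (fun t => 2 * rnorm (f t) - rnorm (g n t)).
    apply: measurable_funB; last exact/measurable_rnorm/simple_fun_strongly_measurable.
    by apply: measurable_funM => //; exact: measurable_rnorm Lf.1.
  rewrite (_ : B n = (fun t => 2 * rnorm (f t) - rnorm (g n t)) @^-1` `[0, +oo[%classic).
    by rewrite -[X in measurable X]setTI; apply: mfg => //; exact: measurable_itv.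
  by apply/seteqP; split=> t; rewrite /B/= in_itv/= andbT subr_ge0.
pose h n t := if t \in B n then g n t else 0.
have sh n : simple_fun (h n) by exact: simple_fun_restrict.
have hle n t : rnorm (h n t) <= 2 * rnorm (f t).
  by rewrite /h; case: ifPn => [/set_mem//|_]; rewrite rnorm0 mulr_ge0 ?rnorm_ge0.
have Lh n : in_Lp mu p (h n).
  have h2 : {ae mu, forall t, rnorm (h n t) <= 2 * rnorm (f t)} by exact: nearW.
  exact: (in_Lp_le p1 (ler0n _ 2) (simple_fun_strongly_measurable (sh n)) Lf h2).1.
have [|||||n hn] := @normLp_dominated_cvg (fun n => f - h n) (3%:C *: f) e.
- by move=> n; exact: (in_LpB p1 Lf (Lh n)).1.
- exact: in_LpZ.
- move=> n t; rewrite rnormZr ger0_norm//.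
  by have := rnormD (f t) (- h n t); rewrite rnormN; have := hle n t; rewrite /=; lra.
- move=> t; apply/rnorm_cvgnP => e' e'0.
  have [ft0|ft0] := eqVneq (f t) 0.
    exists 0%N => n _; rewrite subr0 !fctE ft0 sub0r rnormN.
    by have := hle n t; rewrite ft0 rnorm0 mulr0; lra.
  have rf0 : 0 < rnorm (f t).
    by rewrite lt_neqAle rnorm_ge0 andbT eq_sym; apply: contra_neq ft0 => /rnorm_eq0.
  have e1 : 0 < Num.min e' (rnorm (f t)) by rewrite lt_min e'0.
  have /rnorm_cvgnP /(_ _ e1) [n0 hn0] := cg t.
  exists n0 => n /hn0; rewrite le_min => /andP[h1 h2]; rewrite subr0.
  have Bt : B n t by have := ler_rnormB (g n t) (f t); rewrite /B/=; lra.
  have hg : h n t = g n t by rewrite /h (mem_set Bt).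
  by change (rnorm (f t - h n t) <= e'); rewrite hg rnormB.
- exact: e0.
by exists (h n).
Qed.

End Lp_convergence.

(** * Density of trigonometric polynomials *)

Section set_distance.
Context (R : realType) (K : set R) (K0 : K !=set0).

Definition set_dist (s : R) : R := inf [set `|s - k| | k in K].

Let has_inf_dist s : has_inf [set `|s - k| | k in K].
Proof.
case: K0 => k Kk; split; first by exists `|s - k|, k.
by exists 0 => _ [k' _ <-].
Qed.

Lemma set_dist_ge0 s : 0 <= set_dist s.
Proof. by apply: lb_le_inf; [exact: (has_inf_dist s).1|move=> _ [k _ <-]]. Qed.

Lemma set_dist_le s k : K k -> set_dist s <= `|s - k|.
Proof. by move=> Kk; apply: ge_inf; [exact: (has_inf_dist s).2|exists k]. Qed.

Lemma set_dist_lip s r : set_dist s - set_dist r <= `|s - r|.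
Proof.
rewrite lerBlDl -lerBlDr; apply: lb_le_inf; first exact: (has_inf_dist r).1.
move=> _ [k Kk <-]; rewrite lerBlDr; apply: le_trans (set_dist_le s Kk) _.
by rewrite -[s - k](subrKA r) addrC ler_normD.
Qed.

Lemma set_dist_gt0 s : closed K -> ~ K s -> 0 < set_dist s.
Proof.
move=> cK nK; have : nbhs s (~` K) by apply: open_nbhs_nbhs; split=> //; exact: closed_openC.
case=> d /= d0 hd; apply: lt_le_trans d0 _; apply: lb_le_inf; first exact: (has_inf_dist s).1.
by move=> _ [k Kk <-]; rewrite leNgt; apply/negP => /hd.
Qed.

End set_distance.

Section fourier_density.
Context (R : realType) (p : R) (p1 : 1 <= p) (V : normedModType R[i]).
Local Notation mu := (lebesgue_2pi R).
Local Notation T := (measurableTypeR R).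
Local Notation in_Lp := (in_Lp mu p).
Local Notation normLp := (normLp mu p).

Let p0 : 0 < p. Proof. exact: lt_le_trans p1. Qed.

Lemma fourier_sum_in_Lp N (v : int -> V) : in_Lp (fourier_sum N v : T -> V).
Proof.
have m := continuous_strongly_measurable (@fourier_sum_continuous R V N v).
pose c : R := \sum_(j < N.*2.+1) rnorm (v ((j : nat)%:Z - N%:Z)).
apply: (in_Lp_bounded p1 m (c := c) _ _).1.
  by apply: sumr_ge0 => j _; exact: rnorm_ge0.
move=> s _; apply: le_trans (rnorm_sum _ _ _) _; apply: ler_sum => j _ /=.
by rewrite rnorm_expikZ.
Qed.

Definition fourier_approx (f : T -> V) := forall e : R, 0 < e ->
  exists N (v : int -> V), normLp (f - (fourier_sum N v : T -> V)) <= e.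

Lemma fourier_approx_lim (f : T -> V) : in_Lp f ->
  (forall e : R, 0 < e -> exists g : T -> V, [/\ in_Lp g, fourier_approx g & normLp (f - g) <= e]) ->
  fourier_approx f.
Proof.
move=> Lf h e e0; have e2 : 0 < e / 2 by rewrite divr_gt0.
have [g [Lg ag fg]] := h _ e2; have [N [v hv]] := ag _ e2.
exists N, v; have -> : f - (fourier_sum N v : T -> V) = (f - g) + (g - (fourier_sum N v : T -> V)).
  by rewrite subrKA.
apply: le_trans (normLpD p1 (in_LpB p1 Lf Lg) (in_LpB p1 Lg (fourier_sum_in_Lp N v))) _.
by lra.
Qed.

Lemma fourier_sum_max N N' (v w : int -> V) (a : R[i]) :
  exists N'' u, forall s, fourier_sum N'' u s = a *: fourier_sum N v s + fourier_sum N' w s.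
Proof.
exists (maxn N N'), (fun k => a *: truncate N v k + truncate N' w k) => s.
by rewrite fourier_sum_linear !fourier_sum_truncate ?leq_maxl ?leq_maxr.
Qed.

Lemma fourier_approxD (f g : T -> V) : in_Lp f -> in_Lp g ->
  fourier_approx f -> fourier_approx g -> fourier_approx (f + g).
Proof.
move=> Lf Lg af ag e e0; have e2 : 0 < e / 2 by rewrite divr_gt0.
have [N [v hv]] := af _ e2; have [N' [w hw]] := ag _ e2.
have [N'' [u hu]] := fourier_sum_max N N' v w 1; exists N'', u.
have -> : f + g - (fourier_sum N'' u : T -> V) =
    (f - (fourier_sum N v : T -> V)) + (g - (fourier_sum N' w : T -> V)).
  rewrite addrACA -opprD; congr (_ - _); apply/funext => s.
  by rewrite hu scale1r.
apply: le_trans (normLpD p1 (in_LpB p1 Lf (fourier_sum_in_Lp N v))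
  (in_LpB p1 Lg (fourier_sum_in_Lp N' w))) _.
by lra.
Qed.

Lemma fourier_approx_modulus (f : T -> V) : strongly_measurable f ->
  periodic_modulus f -> in_Lp f /\ fourier_approx f.
Proof.
move=> mf hf.
have Lf : in_Lp f.
  have [C C0 hC] := hf 1 ltr01.
  apply: (in_Lp_bounded p1 mf (c := rnorm (f 0) + 1 + C * 2) _ _).1.
    by rewrite !addr_ge0 ?rnorm_ge0 ?mulr_ge0.
  move=> s hs; have := hC s 0 hs; rewrite lexx/= mulr_ge0 ?pi_ge0// => /(_ isT).
  have := ler_rnormB (f s) (f 0); have := cos_geN1 (s - 0) => h1 h2 h3.
  have : C * (1 - cos (s - 0)) <= C * 2 by rewrite ler_wpM2l//; lra.
  by lra.
split=> // e e0; have w0 := w2pi_gt0 p.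
have ew : 0 < e / w2pi p by rewrite divr_gt0.
have [N0 hN] := fejer_uniform_cvg hf ew.
exists N0, (fejer N0 f).
have L := in_LpB p1 Lf (fourier_sum_in_Lp N0 (fejer N0 f)).
have := (in_Lp_bounded p1 L.1 (ltW ew) _).2; rewrite divfK ?gt_eqF//; apply.
by move=> s hs; rewrite !fctE rnormB; exact: hN.
Qed.

Definition indic_vec (A : set T) (x : V) : T -> V := fun s => if s \in A then x else 0.

Lemma indic_vec_simple (A : set T) x : measurable A -> simple_fun (indic_vec A x).
Proof.
move=> mA; apply: (simple_fun_restrict (f := fun=> x)) => //; split=> [|y].
  exact: finite_image_cst.
by rewrite preimage_cst; case: ifP.
Qed.

Lemma indic_vec_in_Lp (A : set T) x : measurable A -> in_Lp (indic_vec A x).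
Proof.
move=> mA; apply: (in_Lp_bounded p1 _ (rnorm_ge0 x) _).1.
  exact/simple_fun_strongly_measurable/indic_vec_simple.
by move=> s _; rewrite /indic_vec; case: ifP => // _; rewrite rnorm0 rnorm_ge0.
Qed.

Lemma normLp_indic_vec (A : set T) x (c : R) : measurable A -> 0 <= c -> (mu A <= (c `^ p)%:E)%E ->
  normLp (indic_vec A x) <= rnorm x * c.
Proof.
move=> mA c0 hc; rewrite -lee_fin -normLpE; last exact: indic_vec_in_Lp.
rewrite /Lp_norm unlock /Lnorm/=.
have x0 := rnorm_ge0 x.
rewrite (eq_integral (fun s : T => ((rnorm x `^ p)%:E * (\1_A s)%:E)%E)); last first.
  move=> s _; rewrite /indic_vec indicE; case: ifP => _.
    by rewrite mule1 ger0_norm.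
  by rewrite rnorm0 normr0 powR0 ?mule0// gt_eqF.
rewrite ge0_integralZl//; last 2 first.
- by apply/measurable_EFinP; exact: measurable_indic.
- by rewrite lee_fin powR_ge0.
rewrite integral_indic// setIT.
have -> : rnorm x * c = (rnorm x `^ p * c `^ p) `^ p^-1.
  by rewrite -powRM// -powRrM mulfV ?gt_eqF// powRr1// mulr_ge0.
rewrite -[X in (_ <= X)%E]poweR_EFin; apply: gt0_ler_poweR; rewrite ?invr_ge0 ?(ltW p0)//.
- by rewrite in_itv/= leey andbT mule_ge0// lee_fin powR_ge0.
- by rewrite in_itv/= leey andbT lee_fin mulr_ge0 ?powR_ge0.
- by rewrite EFinM; apply: lee_wpmul2l => //; rewrite lee_fin powR_ge0.
Qed.

(** The indicator of K is a limit of Lipschitz bumps built from the distance to K. As K avoids 0 and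
    2 pi, steep bumps vanish at both ends, and Fejer's theorem applies to them. *)
Lemma fourier_approx_compact (K : set R) x : compact K -> K `<=` `]0, 2 * pi[ ->
  fourier_approx (indic_vec K x).
Proof.
move=> cK K2; have [->|/set0P K0] := eqVneq K set0.
  move=> e e0; exists 0%N, (fun=> 0).
  have -> : indic_vec set0 x - (fourier_sum 0 (fun=> 0) : T -> V) = 0.
    by apply/funext => s; rewrite !fctE/= fourier_sum0 subr0 /indic_vec in_set0.
  have := normLpZ p1 0 (fourier_sum_in_Lp 0 (fun=> 0 : V)).
  by rewrite scale0r normr0 /= mul0r => ->; exact: ltW.
have clK : closed K by apply: compact_closed => //; exact: Rhausdorff.
have mK : measurable (K : set T) by exact: closed_measurable.
have d0 : 0 < set_dist K 0 by apply: set_dist_gt0 => // /K2; rewrite /= in_itv/= ltxx.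
have d2 : 0 < set_dist K (2 * pi) by apply: set_dist_gt0 => // /K2; rewrite /= in_itv/= ltxx andbF.
pose D := Num.min (set_dist K 0) (set_dist K (2 * pi)).
have D0 : 0 < D by rewrite lt_min d0.
(* Slope above 1 / D, so that [phi n] vanishes at 0 and 2 pi, and tending to infinity with n. *)
pose m n : R := (Num.truncn D^-1 + n).+1%:R.
have m0 n : 0 < m n by [].
pose phi n s := Num.max 0 (1 - m n * set_dist K s).
have phi_le1 n s : phi n s <= 1.
  by rewrite ge_max ler01/= gerBl mulr_ge0 ?(ltW (m0 n)) ?set_dist_ge0.
have phi_ge0 n s : 0 <= phi n s by rewrite le_max lexx.
have phi_lip n s r : `|phi n s - phi n r| <= m n * `|s - r|.
  have := ler_wpM2l (ltW (m0 n)) (set_dist_lip K0 s r).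
  have := ler_wpM2l (ltW (m0 n)) (set_dist_lip K0 r s).
  rewrite distrC !mulrBr /phi /Num.max => h1 h2; rewrite ler_norml.
  by case: ltP => h3; case: ltP => h4; apply/andP; split; lra.
have mD n : 1 <= m n * D.
  rewrite -ler_pdivrMr// mul1r; apply: ltW; apply: lt_le_trans (truncnS_gt _) _.
  by rewrite ler_nat ltnS leq_addr.
pose f n (s : R) : V := (phi n s)%:C *: x.
have f_lip n s r : rnorm (f n s - f n r) <= m n * `|s - r| * rnorm x.
  by rewrite -scalerBl -rmorphB rnormZr; apply: ler_wpM2r (phi_lip n s r); exact: rnorm_ge0.
have f_uc n (e : R) : 0 < e -> exists2 d : R, 0 < d &
    forall s r, `|s - r| <= d -> rnorm (f n s - f n r) <= e.
  move=> e0; have x1 : 0 < m n * (rnorm x + 1) by rewrite mulr_gt0// ltr_wpDl// rnorm_ge0.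
  exists (e / (m n * (rnorm x + 1))); first by rewrite divr_gt0.
  move=> s r; rewrite ler_pdivlMr// => h; apply: le_trans (f_lip n s r) _.
  apply: le_trans h; rewrite mulrAC mulrC ler_wpM2l// ler_pM2l// lerDl//.
have f_mod n : periodic_modulus (f n).
  apply: uniform_periodic_modulus.
  - by move=> e /(f_uc n)[d d00 hd]; exists d => // s r _ _; exact: hd.
  - exists (rnorm x) => s _; rewrite rnormZr ger0_norm// -[X in _ <= X]mul1r.
    by apply: ler_wpM2r => //; exact: rnorm_ge0.
  - have phi0 s : D <= set_dist K s -> phi n s = 0.
      move=> h; apply/max_idPl; rewrite subr_le0; apply: le_trans (mD n) _.
      by rewrite ler_pM2l.
    by rewrite /f !phi0// ge_min lexx ?orbT.
have f_sm n : strongly_measurable (f n : T -> V).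
  apply: continuous_strongly_measurable => s; apply/rnorm_cvgP => e /(f_uc n)[d d00 hd].
  by exists d => // r /= /ltW; rewrite distrC; exact: hd.
apply: fourier_approx_lim; first exact: indic_vec_in_Lp.
move=> e e0.
have LK := indic_vec_in_Lp x mK.
have Lf n : in_Lp (f n) by exact: (fourier_approx_modulus (f_sm n) (f_mod n)).1.
have Lx : in_Lp (fun=> x : V).
  have := indic_vec_in_Lp x (@measurableT _ T); rewrite (_ : indic_vec setT x = fun=> x)//.
  by apply/funext => s; rewrite /indic_vec in_setT.
have phiK n s : K s -> phi n s = 1.
  move=> Ks; have := set_dist_le K0 s Ks; rewrite subrr normr0 => h.
  rewrite /phi; have -> : set_dist K s = 0 by apply/eqP; rewrite eq_le h set_dist_ge0.
  by rewrite mulr0 subr0; apply/max_idPr; exact: ler01.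
have diffE n s : (indic_vec K x - (f n : T -> V)) s = if s \in K then 0 else - f n s.
  rewrite !fctE/= /indic_vec; case: ifPn => [/set_mem Ks|_]; last by rewrite sub0r.
  by rewrite /f phiK// scale1r subrr.
have [|||||n hn] := @normLp_dominated_cvg _ _ _ mu p p1 V
  (fun n => indic_vec K x - (f n : T -> V)) (fun=> x) e.
- by move=> n; exact: (in_LpB p1 LK (Lf n)).1.
- exact: Lx.
- move=> n s; rewrite diffE; case: ifP => _; rewrite ?rnorm0 ?rnorm_ge0// rnormN.
  rewrite rnormZr ger0_norm// -[X in _ <= X]mul1r.
  by apply: ler_wpM2r => //; exact: rnorm_ge0.
- move=> s; apply/rnorm_cvgnP => e' e'0; have [Ks|nKs] := pselect (K s).
    by exists 0%N => n _; rewrite diffE mem_set// subr0 rnorm0 ltW.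
  have ds := set_dist_gt0 K0 clK nKs.
  exists (Num.truncn (set_dist K s)^-1) => n hn; rewrite diffE memNset// subr0 rnormN.
  have -> : f n s = 0; last by rewrite rnorm0 ltW.
  rewrite /f (_ : phi n s = 0) ?scale0r//; apply/max_idPl; rewrite subr_le0.
  rewrite -ler_pdivrMr// mul1r; apply: ltW; apply: lt_le_trans (truncnS_gt _) _.
  by rewrite ler_nat ltnS (leq_trans hn)// leq_addl.
- exact: e0.
by exists (f n); split=> //; exact: (fourier_approx_modulus (f_sm n) (f_mod n)).2.
Qed.

(** Inner regularity is applied inside the open interval, as the compact case requires; the end
    points have measure zero. *)
Lemma fourier_approx_indic (A : set T) x : measurable A -> fourier_approx (indic_vec A x).
Proof.
move=> mA; apply: fourier_approx_lim; first exact: indic_vec_in_Lp.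
move=> e e0; have x1 : 0 < rnorm x + 1 by rewrite ltr_wpDl ?rnorm_ge0.
(* An indicator times x, on a set of measure at most c^p, has norm at most |x| c <= e. *)
have c0 : 0 < e / (rnorm x + 1) by rewrite divr_gt0.
set c := e / _ in c0.
have mI : measurable (A `&` `]0, (2 * pi)[%classic : set T).
  by apply: measurableI => //; exact: measurable_itv.
have fin : (lebesgue_measure (A `&` `]0%R, (2 * pi)%R[%classic) < +oo)%E.
  apply: le_lt_trans (_ : lebesgue_measure (`]0%R, (2 * pi)%R[%classic) < +oo)%E.
    by apply: le_measure; rewrite ?inE//.
  by rewrite lebesgue_measure_itv/=; case: ifP => _; rewrite -?EFinB ltry.
have [K [cK KA hK]] := lebesgue_regularity_inner mI fin (powR_gt0 p c0).
have clK : closed K by apply: compact_closed => //; exact: Rhausdorff.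
have mK : measurable (K : set T) by exact: closed_measurable.
exists (indic_vec K x); split; first exact: indic_vec_in_Lp.
  by apply: fourier_approx_compact => // s /KA[].
have mAK : measurable (A `\` K : set T) by exact: measurableD.
have -> : indic_vec A x - indic_vec K x = indic_vec (A `\` K) x.
  apply/funext => s; rewrite !fctE /indic_vec in_setD.
  have [/set_mem Ks|/negP nK] := boolP (s \in K).
    by rewrite (mem_set (KA _ Ks).1)/= subrr.
  by rewrite andbT subr0.
apply: le_trans (normLp_indic_vec x mAK (ltW c0) _) _.
  rewrite lebesgue_2pi_co//; apply: le_trans (ltW hK).
  have n0 : lebesgue_measure [set (0 : R)] = 0%E by rewrite lebesgue_measure_set1.
  have mD : measurable ((A `&` `]0, (2 * pi)[%classic) `\` K : set T) by exact: measurableD.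
  rewrite -(measureU0 mD (measurable_set1 0) n0).
  apply: le_measure; rewrite ?inE//.
  - by apply: measurableI => //; exact: measurable_itv.
  - by apply: measurableU => //; exact: measurable_set1.
  move=> s [[As nK]]; rewrite /= in_itv/= le_eqVlt => /andP[/predU1P[<-|s0] s2]; first by right.
  by left; split=> //; split=> //; rewrite /= in_itv/= s0.
rewrite /c mulrA ler_pdivrMr// mulrC ler_pM2l// lerDl//.
Qed.

Theorem fourier_sum_dense (f : T -> V) : in_Lp f -> fourier_approx f.
Proof.
move=> Lf; apply: fourier_approx_lim => // e e0.
have [g [sg Lg hg]] := simple_fun_dense p1 Lf e0; exists g; split=> //.
have [s /= hs] := (finite_seqP _).1 sg.1.
(* Induction on the list of values. The value 0 is allowed outside the list because removing a value
   y resets the function to 0 there. *)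
have : range g `<=` [set` s] `|` [set 0] by rewrite hs; exact: subsetUl.
elim: s g sg Lg {hg hs} => [|y s ih] g sg Lg hr.
  have -> : g = indic_vec set0 0; last exact: fourier_approx_indic.
  apply/funext => t; rewrite /indic_vec in_set0.
  by have [//|//] : ([set` [::]] `|` [set 0]) (g t) by apply: hr; exists t.
have mY : measurable (g @^-1` [set y]) by exact: sg.2.
pose h : T -> V := fun t => if t \in ~` (g @^-1` [set y]) then g t else 0.
have sh : simple_fun h by apply: simple_fun_restrict => //; exact: measurableC.
have gE : g = indic_vec (g @^-1` [set y]) y + h.
  apply/funext => t; rewrite !fctE /indic_vec /h in_setC.
  by case: ifPn => [/set_mem <-|_]; rewrite ?addr0 ?add0r.
have Lh : in_Lp h.
  have -> : h = g - indic_vec (g @^-1` [set y]) y by rewrite {1}gE addrAC subrr add0r.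
  by apply: in_LpB => //; exact: indic_vec_in_Lp.
rewrite gE; apply: fourier_approxD => //; [exact: indic_vec_in_Lp|exact: fourier_approx_indic|].
apply: ih => // _ [t _ <-]; rewrite /h; case: ifPn => [/set_mem /= nty|_]; last by right.
have : ([set` y :: s] `|` [set 0]) (g t) by apply: hr; exists t.
case=> [|g0]; last by right.
by rewrite /= inE => /orP[/eqP//|gs]; left.
Qed.

End fourier_density.

(** * The Duhamel formula *)

Lemma common_delta (R : realType) n (P : 'I_n -> R -> Prop) :
  (forall j, exists2 d : R, 0 < d & forall h, `|h| < d -> P j h) ->
  exists2 d : R, 0 < d & forall h, `|h| < d -> forall j, P j h.
Proof.
move=> H; pose d j := projT1 (cid2 (H j)).
have dP j : 0 < d j /\ forall h, `|h| < d j -> P j h.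
  by rewrite /d; case: (cid2 (H j)).
exists (\big[Num.min/1]_(j < n) d j).
  by apply/bigmin_gtP; split=> // j _; have [] := dP j.
move=> h hd j; apply: (dP j).2; apply: lt_le_trans hd _; exact: bigmin_le_cond.
Qed.

Section riemann_sums.
Context (R : realType) (p : R) (p1 : 1 <= p) (V : normedModType R[i]).
Local Notation mu := (lebesgue_2pi R).
Local Notation T := (measurableTypeR R).
Local Notation in_Lp := (in_Lp mu p).
Local Notation normLp := (normLp mu p).

Let p0 : 0 < p. Proof. exact: lt_le_trans p1. Qed.

(** Sums of L^1 type are compared with the L^p norm through x + 1 <= x^p + 2, where the 1 on the
    left absorbs the oscillation over a cell. Integrating the right side over [0, 2 pi] gives at
    most 1 + 4 pi. *)
Let unit_bound (f : R -> V) (s h : R) n : continuous f -> in_Lp f -> normLp f <= 1 -> 0 < h ->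
  0 <= s - n%:R * h -> s <= 2 * pi ->
  (forall r t, `|r - t| <= h -> rnorm (f r - f t) <= 1) ->
  \sum_(j < n) h * rnorm (f (s - j%:R * h)) <= 1 + 4 * pi.
Proof.
move=> cf Lf f1 h0 sn s2 osc.
pose q (r : T) : R := rnorm (f r) `^ p + 2.
have mf : measurable_fun setT (fun r : T => rnorm (f r)).
  exact/measurable_rnorm/continuous_strongly_measurable.
have mq : measurable_fun setT (EFin \o q).
  apply/measurable_EFinP; apply: measurable_funD => //.
  exact: (measurableT_comp (measurable_powR _)).
have q0 r : (0 <= (q r)%:E)%E by rewrite lee_fin addr_ge0 ?powR_ge0.
have young r : rnorm (f r) + 1 <= q r.
  rewrite /q; have [h1|h1] := leP (rnorm (f r)) 1; first by have := powR_ge0 (rnorm (f r)) p; lra.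
  by have := le1r_powR (ltW h1) p1; lra.
have tot : (\int[mu]_r (q r)%:E <= (1 + 4 * pi)%:E)%E.
  rewrite /q; under eq_integral do rewrite EFinD.
  rewrite ge0_integralD//; last 2 first.
  - by move=> r _; rewrite lee_fin powR_ge0.
  - by apply/measurable_EFinP; exact: (measurableT_comp (measurable_powR _)).
  rewrite integral_cst// lebesgue_2piT (EFinD 1 (4 * pi)); apply: leeD; last by rewrite -EFinM lee_fin; lra.
  have := f1; rewrite -lee_fin -normLpE// /Lp_norm unlock /Lnorm/=.
  under eq_integral do rewrite ger0_norm ?rnorm_ge0//.
  set I := (\int[mu]_x _)%E => hI.
  have I0 : (0 <= I)%E by apply: integral_ge0 => r _; rewrite lee_fin powR_ge0.
  rewrite leNgt; apply/negP => I1; move: hI; rewrite leNgt => /negP; apply.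
  have Ifin : I \is a fin_num.
    rewrite ge0_fin_numE//; apply: (@lty_poweRy _ _ p^-1); first by rewrite invr_eq0 gt_eqF.
    have := Lf.2; rewrite /Lp_norm unlock /Lnorm/=.
    by under eq_integral do rewrite ger0_norm ?rnorm_ge0//.
  rewrite -(fineK Ifin) poweR_EFin lte_fin.
  have I1' : 1 < fine I by rewrite -lte_fin fineK.
  have E1 : 1 = 1 `^ p^-1 :> R by rewrite powR1.
  by rewrite [X in X < _]E1; apply: gt0_ltr_powR; rewrite ?invr_gt0 ?nnegrE// (le_trans ler01) ?ltW.
have mi (i : interval R) : measurable ([set` i] : set T) by exact: measurable_itv.
(* The term at s - j h is charged to the cell of length h on its left; these cells are disjoint and
   contained in [0, 2 pi]. *)
suff H m : (m <= n)%N -> ((\sum_(j < m) (h * rnorm (f (s - j%:R * h))))%R%:E <=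
    \int[mu]_(r in `](s - m%:R * h)%R, s]) (q r)%:E)%E.
  rewrite -lee_fin; apply: le_trans (H n (leqnn _)) _; apply: le_trans tot.
  by apply: ge0_subset_integral => //.
elim: m => [_|m ih mn].
  by rewrite big_ord0; apply: integral_ge0.
have sm : 0 <= s - m.+1%:R * h.
  by apply: le_trans sn _; rewrite lerD2l lerN2 ler_pM2r// ler_nat.
have sE : s - m.+1%:R * h = s - m%:R * h - h by rewrite -natr1; ring.
have mh : 0 <= m%:R * h by rewrite mulr_ge0// ltW.
rewrite big_ord_recr/= (_ : [set` `]s - m.+1%:R * h, s]] =
   `]s - m%:R * h - h, s - m%:R * h]%classic `|` `]s - m%:R * h, s]%classic); last first.
  rewrite sE; apply/seteqP; split=> r /=; rewrite !in_itv/=.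
    by move=> /andP[h1 h2]; case: (leP r (s - m%:R * h)) => h3; [left; apply/andP|right].
  by move=> [/andP[h1 h2]|/andP[h1 h2]]; apply/andP; split; lra.
rewrite ge0_integral_setU//=; last 2 first.
- by apply: measurable_funTS.
- apply/disj_setPS => r [] /=; rewrite !in_itv/= => /andP[_ h1] /andP[h2 _].
  by have := lt_le_trans h2 h1; rewrite ltxx.
rewrite addrC EFinD; apply: leeD; last exact: ih (ltnW mn).
set r0 := s - m%:R * h in sE *.
have r0s : r0 <= s by rewrite /r0 gerBl.
have mu_itv : mu `]r0 - h, r0]%classic = h%:E.
  rewrite /lebesgue_2pi/= /mrestr setIidl; last first.
    move=> r /=; rewrite !in_itv/= => /andP[h1 h2]; move: sm; rewrite sE => sm.
    by apply/andP; split; lra.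
  by rewrite lebesgue_measure_itv/= lte_fin gtrBl h0 -EFinB opprB addrC subrK.
have -> : ((h * rnorm (f r0))%:E = \int[mu]_(r in `](r0 - h)%R, r0]) (cst (rnorm (f r0))%:E r))%E.
  by rewrite integral_cst// EFinM mu_itv muleC.
apply: ge0_le_integral => //.
- by move=> r _; rewrite lee_fin rnorm_ge0.
- exact: measurable_funTS.
move=> r; rewrite /= in_itv/= => /andP[h1 h2]; rewrite lee_fin.
apply: le_trans (young r); have := ler_rnormB (f r0) (f r).
have : rnorm (f r0 - f r) <= 1 by apply: osc; rewrite ger0_norm; lra.
lra.
Qed.

(** By homogeneity the unit bound is applied to f / a; the strict inequality keeps a positive even
    when f has norm 0. *)
Lemma riemann_sum_le (f : R -> V) (s t a : R) : continuous f -> in_Lp f ->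
  (forall e : R, 0 < e -> exists2 d : R, 0 < d &
     forall r t : R, `|r - t| <= d -> rnorm (f r - f t) <= e) ->
  0 <= s - t -> 0 < t -> s <= 2 * pi -> normLp f < a ->
  exists n0 : nat, forall n, (n0 <= n)%N ->
    \sum_(j < n.+1) t / n.+1%:R * rnorm (f (s - j%:R * (t / n.+1%:R))) <= a * (1 + 4 * pi).
Proof.
move=> cf Lf uf st t0 s2 fa.
have a0 : 0 < a by apply: le_lt_trans fa; exact: normLp_ge0.
pose g : R -> V := a^-1%:C *: f.
have gE r : rnorm (g r) = a^-1 * rnorm (f r) by rewrite rnormZr ger0_norm// invr_ge0 ltW.
have cg : continuous g.
  move=> r; apply: cvgZl_tmp; exact: cf.
have Lg : in_Lp g by exact: in_LpZ.
have g1 : normLp g <= 1.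
  rewrite normLpZ// normc_def/= expr0n addr0 sqrtr_sqr ger0_norm ?invr_ge0 ?(ltW a0)//.
  by rewrite ler_pdivrMl// mulr1 ltW.
have [d d0 hd] := uf a a0.
exists (Num.truncn (t / d)) => n hn.
have h0 : 0 < t / n.+1%:R by rewrite divr_gt0.
have hd' : t / n.+1%:R <= d.
  rewrite ler_pdivrMr// mulrC -ler_pdivrMr//; apply: ltW; apply: lt_le_trans (truncnS_gt _) _.
  by rewrite ler_nat.
have := @unit_bound g s (t / n.+1%:R) n.+1 cg Lg g1 h0.
rewrite [n.+1%:R * _]mulrC divfK// => /(_ st s2) H.
rewrite -ler_pdivrMl//; apply: le_trans (H _).
  rewrite mulr_sumr; apply: ler_sum => j _; rewrite gE.
  by rewrite le_eqVlt; apply/orP; left; apply/eqP; ring.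
move=> r u ru; rewrite -scalerBr rnormZr ger0_norm ?invr_ge0 ?(ltW a0)//.
by rewrite ler_pdivrMl// mulr1; apply: hd; exact: le_trans ru hd'.
Qed.

End riemann_sums.

Lemma fourier_sum_uniform_continuous (R : realType) (V : normedModType R[i]) N (v : int -> V) (e : R) :
  0 < e -> exists2 d : R, 0 < d & forall r t : R, `|r - t| <= d ->
    rnorm (fourier_sum N v r - fourier_sum N v t) <= e.
Proof.
move=> e0; pose k (j : 'I_N.*2.+1) : int := (j : nat)%:Z - N%:Z.
pose c : R := \sum_j rnorm (v (k j)) + 1.
have c0 : 0 < c by rewrite ltr_wpDl// sumr_ge0// => j _; exact: rnorm_ge0.
have [d d0 hd] := common_delta (fun j => expik_continuous0 (k j) (divr_gt0 e0 c0)).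
exists (d / 2) => [|r t rt]; first by rewrite divr_gt0.
have {}hd := hd (r - t) ltac:(by lra).
rewrite /fourier_sum -sumrB; apply: le_trans (rnorm_sum _ _ _) _.
apply: le_trans (_ : \sum_j e / c * rnorm (v (k j)) <= _); last first.
  by rewrite -mulr_sumr mulrAC ler_pdivrMr// ler_pM2l// lerDl.
apply: ler_sum => j _ /=; rewrite -scalerBl.
have -> : expik (k j) r - expik (k j) t = expik (k j) t * (expik (k j) (r - t) - 1).
  by rewrite mulrBr mulr1 -expikD [t + _]addrC subrK.
rewrite -scalerA rnorm_expikZ rnormZ.
by apply: ler_wpM2r; [exact: rnorm_ge0|exact: hd].
Qed.

Section duhamel.
Context (R : realType) (X : completeNormedModType R[i]).
Variable S : R -> X -> X.
Hypothesis cS : c0_semigroup S.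

(* f is the right derivative of h |-> S h (g (s - h)) at 0, uniformly in s. *)
Definition uniform_rderiv (g f : R -> X) := forall e : R, 0 < e ->
  exists2 d : R, 0 < d & forall h s : R, 0 < h -> h < d ->
    rnorm (S h (g (s - h)) - g s - h%:C *: f s) <= e * h.

(** On a single mode, S h (e^(ik(s - h)) w) is e^(iks) times the rescaled semigroup at w; since
    |e^(iks)| = 1, the derivative estimate is uniform in s. *)
Lemma fourier_sum_rderiv D N (w : int -> X) : generates D S ->
  (forall k : int, (`|k| <= N)%N -> dom D (w k)) ->
  uniform_rderiv (fourier_sum N w) (fourier_sum N (fun k => op_shift D (ik k) (w k))).
Proof.
move=> gS dw e e0; pose k (j : 'I_N.*2.+1) : int := (j : nat)%:Z - N%:Z.
have n0 : (0 : R) < N.*2.+1%:R by [].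
have [|d d0 hd] := @common_delta R N.*2.+1 (fun j h => 0 < h ->
    rnorm (rescale (k j) S h (w (k j)) - w (k j) - h%:C *: op_shift D (ik (k j)) (w (k j)))
    <= e / N.*2.+1%:R * h).
  move=> j; have dj : dom D (w (k j)) by apply: dw; have := ltn_ord j; rewrite /k; lia.
  have /has_rderiv0P /(_ _ (divr_gt0 e0 n0)) [d d0 hd] :
      has_rderiv0 (rescale (k j) S) (w (k j)) (op_shift D (ik (k j)) (w (k j))).
    exact/(generatesP (rescale_generates (k j) gS)).
  by exists d => // h hh h0; apply: hd => //; rewrite -(gtr0_norm h0).
exists d => // h s h0 hdh.
have {}hd j := hd h ltac:(by rewrite gtr0_norm) j h0.
have lS := semigroup_linear cS (ltW h0).
have -> : S h (fourier_sum N w (s - h)) - fourier_sum N w s -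
    h%:C *: fourier_sum N (fun k => op_shift D (ik k) (w k)) s =
    \sum_j expik (k j) s *: (rescale (k j) S h (w (k j)) - w (k j) -
      h%:C *: op_shift D (ik (k j)) (w (k j))).
  rewrite /fourier_sum (linf_sum lS) scaler_sumr -!sumrB; apply: eq_bigr => j _ /=.
  by rewrite (linfZ lS) /rescale !scalerBr !scalerA -expikD [_%:C * expik _ _]mulrC.
apply: le_trans (_ : N.*2.+1%:R * (e / N.*2.+1%:R * h) <= _); last first.
  by rewrite mulrA [_ * (e / _)]mulrC divfK ?gt_eqF.
by apply: rnorm_sum_le => j; rewrite rnorm_expikZ.
Qed.

Variables (b M : R) (M1 : 1 <= M).
Hypothesis hM : forall t x, 0 <= t -> t <= b -> rnorm (S t x) <= M * rnorm x.

Let M0 : 0 < M. Proof. exact: lt_le_trans M1. Qed.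

(** The left difference telescopes into n + 1 increments with step h = t / (n + 1), each equal to h
    f up to e h / (t M); S costs a factor M, and (n + 1) h = t makes the total error e. *)
Lemma duhamel (g f : R -> X) (t e : R) : uniform_rderiv g f -> 0 < t -> t <= b -> 0 < e ->
  exists n0 : nat, forall n s, (n0 <= n)%N ->
    rnorm (S t (g (s - t)) - g s - (t / n.+1%:R)%:C *:
      \sum_(j < n.+1) S (j%:R * (t / n.+1%:R)) (f (s - j%:R * (t / n.+1%:R)))) <= e.
Proof.
move=> gf t0 tb e0; have tM : 0 < t * M by rewrite mulr_gt0.
have [d d0 hd] := gf _ (divr_gt0 e0 tM).
exists (Num.truncn (t / d)) => n s hn; set h := t / n.+1%:R.
have h0 : 0 < h by rewrite divr_gt0.
have hN : n.+1%:R * h = t by rewrite mulrC divfK.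
have hdh : h < d.
  rewrite ltr_pdivrMr// mulrC -ltr_pdivrMr//; apply: lt_le_trans (truncnS_gt _) _.
  by rewrite ler_nat.
have := semigroup_telescope cS g s n.+1 (ltW h0); rewrite hN => ->.
rewrite scaler_sumr -sumrB.
apply: le_trans (_ : n.+1%:R * (M * (e / (t * M) * h)) <= _).
  apply: rnorm_sum_le => j.
  have jh : 0 <= j%:R * h by rewrite mulr_ge0// ltW.
  have lS := semigroup_linear cS jh.
  rewrite -(linfZ lS) -(linfB lS); apply: le_trans (hM _ jh _) _.
    by apply: le_trans tb; rewrite -hN ler_pM2r// ler_nat ltnW.
  by rewrite ler_pM2l//; exact: hd.
rewrite -[X in X * _]mulr1 -mulrA mul1r.
have -> : n.+1%:R * (M * (e / (t * M) * h)) = e * (n.+1%:R * h / t).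
  by field; rewrite !gt_eqF.
by rewrite hN divff ?gt_eqF// mulr1.
Qed.

Lemma duhamel_sup (g f : R -> X) (s t c : R) : uniform_rderiv g f -> 0 <= t -> t <= b ->
  (forall r, s - t <= r -> r <= s -> rnorm (f r) <= c) ->
  rnorm (S t (g (s - t)) - g s) <= t * M * c.
Proof.
move=> gf; rewrite le_eqVlt => /predU1P[<- _ _|t0 tb hc].
  by rewrite subr0 (semigroup0 cS) subrr rnorm0 !mul0r.
apply/ler_addgt0Pr => e e0; have [n0 hn] := duhamel gf t0 tb e0.
have := hn n0 s (leqnn _); set h := t / _; set z := _ *: _ => h1.
have h0 : 0 < h by rewrite divr_gt0.
have hN : n0.+1%:R * h = t by rewrite mulrC divfK.
have : rnorm z <= h * (n0.+1%:R * (M * c)).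
  rewrite rnormZr gtr0_norm// ler_pM2l//; apply: rnorm_sum_le => j.
  have jh : 0 <= j%:R * h by rewrite mulr_ge0// ltW.
  have jt : j%:R * h <= t by rewrite -hN ler_pM2r// ler_nat ltnW.
  apply: le_trans (hM _ jh (le_trans jt tb)) _.
  by rewrite ler_pM2l// hc//; lra.
rewrite mulrA [h * _]mulrC hN mulrA.
by have := ler_rnormB (S t (g (s - t)) - g s) z; lra.
Qed.

(** Since S(r) S(2 pi - r) x = S(2 pi) x, the Duhamel sum for the exact weighted orbit is a scalar
    multiple of the single vector S(2 pi) x. *)
Lemma duhamel_orbit (g f : R -> X) (x : X) (c : R) : uniform_rderiv g f -> 2 * pi <= b ->
  (forall r, 0 <= r <= 2 * pi -> rnorm (f r - (1 - cos r)%:C *: S r x) <= c) ->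
  rnorm (S (2 * pi) (g 0) - g (2 * pi) - (2 * pi)%:C *: S (2 * pi) x) <= 2 * pi * M * c.
Proof.
move=> gf tb hc; have t0 : 0 < 2 * pi :> R by rewrite mulr_gt0 ?pi_gt0.
apply/ler_addgt0Pr => e e0; have [n0 hn] := duhamel gf t0 tb e0.
(* One index beyond n0 guarantees at least two nodes, which the vanishing of the sum of e^(i.) over
   them needs. *)
have := hn n0.+1 (2 * pi) (leqnSn _); rewrite subrr; set h := _ / _; set z := _ *: _ => h1.
have h0 : 0 < h by rewrite divr_gt0.
have hN : n0.+2%:R * h = 2 * pi by rewrite mulrC divfK.
(* the Riemann sums of 1 - cos at equispaced nodes are exact *)
have csum : \sum_(j < n0.+2) (1 - cos (2 * pi - j%:R * h)) = n0.+2%:R :> R.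
  have := @sum_expik_node R 1 n0.+2 ltac:(by []); rewrite /= => /(congr1 (@complex.Re R)) /=.
  rewrite (raddf_sum (@complex.Re R))/= => cs0.
  rewrite sumrB sumr_const card_ord [X in _ - X](_ : _ = 0) ?subr0// -[RHS]cs0.
  apply: eq_bigr => j _; rewrite [2 * pi - _]addrC [2 * pi]mulr_natl cosD2pi cosN mul1r; congr cos.
  by rewrite /node /h; field; rewrite -!natr1; have := ler0n R n0; lra.
have : rnorm (z - (2 * pi)%:C *: S (2 * pi) x) <= h * (n0.+2%:R * (M * c)).
  have -> : (2 * pi)%:C *: S (2 * pi) x =
      h%:C *: \sum_(j < n0.+2) (1 - cos (2 * pi - j%:R * h))%:C *: S (2 * pi) x.
    by rewrite -scaler_suml -(rmorph_sum (real_complex R)) csum scalerA -rmorphM/= [h * _]mulrC hN.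
  rewrite -scalerBr rnormZr gtr0_norm// ler_pM2l// -sumrB; apply: rnorm_sum_le => j.
  have jh : 0 <= j%:R * h by rewrite mulr_ge0// ltW.
  have jt : j%:R * h <= 2 * pi by rewrite -hN ler_pM2r// ler_nat ltnW.
  have lS := semigroup_linear cS jh.
  have -> : S (2 * pi) x = S (j%:R * h) (S (2 * pi - j%:R * h) x).
    by rewrite -(semigroupD cS) ?subr_ge0// addrC subrK.
  rewrite -(linfZ lS) -(linfB lS); apply: le_trans (hM _ jh (le_trans jt tb)) _.
  by rewrite ler_pM2l// hc// subr_ge0 jt/=; lra.
have -> : h * (n0.+2%:R * (M * c)) = 2 * pi * M * c by rewrite -hN; ring.
by have := rnorm_triangle (S (2 * pi) (g 0) - g (2 * pi)) z ((2 * pi)%:C *: S (2 * pi) x); lra.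
Qed.

(** The Duhamel sum is bounded through [riemann_sum_le], which turns L^p data on f into a pointwise
    estimate for g. *)
Lemma duhamel_normLp (p : R) (p1 : 1 <= p) (g f : R -> X) (s t : R) : uniform_rderiv g f ->
  continuous f -> in_Lp (lebesgue_2pi R) p f ->
  (forall e : R, 0 < e -> exists2 d : R, 0 < d &
     forall r t : R, `|r - t| <= d -> rnorm (f r - f t) <= e) ->
  0 <= t -> t <= b -> 0 <= s - t -> s <= 2 * pi ->
  rnorm (S t (g (s - t)) - g s) <= M * (1 + 4 * pi) * normLp (lebesgue_2pi R) p f.
Proof.
move=> gf cf Lf uf; rewrite le_eqVlt => /predU1P[<- _ _ _|t0 tb st s2].
  rewrite subr0 (semigroup0 cS) subrr rnorm0 !mulr_ge0 ?normLp_ge0 ?(ltW M0)//.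
  by rewrite addr_ge0 ?mulr_ge0 ?pi_ge0.
have pi0 := pi_ge0 R.
have K0 : 0 < M * (1 + 4 * pi) by rewrite mulr_gt0//; lra.
apply/ler_addgt0Pr => e e0.
have e2 : 0 < e / 2 by rewrite divr_gt0.
have e3 : 0 < e / 2 / (M * (1 + 4 * pi)) by rewrite divr_gt0.
set N := normLp _ _ _.
have aN : N < N + e / 2 / (M * (1 + 4 * pi)) by rewrite ltrDl.
have [n1 hn1] := riemann_sum_le p1 cf Lf uf st t0 s2 aN.
have [n2 hn2] := duhamel gf t0 tb e2.
have := hn2 (maxn n1 n2) s (leq_maxr _ _); have := hn1 (maxn n1 n2) (leq_maxl _ _).
set n := maxn n1 n2; set h := t / _; set z := _ *: _ => h1 h2.
have h0 : 0 < h by rewrite divr_gt0.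
have hN : n.+1%:R * h = t by rewrite mulrC divfK.
have : rnorm z <= M * ((N + e / 2 / (M * (1 + 4 * pi))) * (1 + 4 * pi)).
  apply: le_trans (_ : M * \sum_(j < n.+1) h * rnorm (f (s - j%:R * h)) <= _); last first.
    by rewrite ler_pM2l.
  rewrite rnormZr gtr0_norm// -mulr_sumr mulrCA ler_pM2l// mulr_sumr.
  apply: le_trans (rnorm_sum _ _ _) _; apply: ler_sum => j _.
  have jh : 0 <= j%:R * h by rewrite mulr_ge0// ltW.
  have jt : j%:R * h <= t by rewrite -hN ler_pM2r// ler_nat ltnW.
  exact: hM jh (le_trans jt tb).
have -> : M * ((N + e / 2 / (M * (1 + 4 * pi))) * (1 + 4 * pi)) = M * (1 + 4 * pi) * N + e / 2.
  have h14 : 1 + 4 * pi != 0 :> R by rewrite gt_eqF//; lra.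
  have Mn0 : M != 0 by rewrite gt_eqF.
  by move: (1 + 4 * pi) h14 => K K0'; field; rewrite ?K0' ?Mn0.
by have := ler_rnormB (S t (g (s - t)) - g s) z; lra.
Qed.

End duhamel.

(** * The evolution semigroup and Fourier multipliers *)

Section evolution.
Context (R : realType) (p : R) (p1 : 1 <= p) (X : completeNormedModType R[i]).
Variable S : R -> X -> X.
Hypothesis cS : c0_semigroup S.
Local Notation mu := (lebesgue_2pi R).
Local Notation T := (measurableTypeR R).
Local Notation in_Lp := (in_Lp mu p).
Local Notation normLp := (normLp mu p).
Implicit Types f g : R -> X.

(** The evolution semigroup on functions instead of classes, where identities such as [evol_add]
    hold at every point. *)
Definition evol (t : R) f : R -> X := fun s => S t (f (mod2pi (s - t))).

Lemma evol_add a b f : 0 <= a -> 0 <= b -> evol (a + b) f = evol a (evol b f).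
Proof.
move=> a0 b0; apply/funext => s; rewrite /evol (semigroupD cS)//.
by rewrite mod2pi_modB opprD addrA.
Qed.

Lemma evolB a f g : 0 <= a -> evol a (f - g) = evol a f - evol a g.
Proof. by move=> a0; apply/funext => s; rewrite /evol/= (linfB (semigroup_linear cS a0)). Qed.

Variables (b M : R) (M1 : 1 <= M).
Hypothesis hM : forall t x, 0 <= t -> t <= b -> rnorm (S t x) <= M * rnorm x.

Let M0 : 0 <= M. Proof. exact: le_trans M1. Qed.

Lemma evol_in_Lp t f : 0 <= t -> t <= b -> in_Lp f ->
  in_Lp (evol t f) /\ normLp (evol t f) <= M * normLp f.
Proof.
move=> t0 tb Lf; have [Ls <-] := in_Lp_shift t Lf.
exact: (in_Lp_linf p1 (semigroup_linear cS t0) M0 (fun x => hM x t0 tb) Ls).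
Qed.

Lemma evol_telescope h n f : 0 < h -> n.+1%:R * h <= b -> in_Lp f ->
  normLp (evol (n.+1%:R * h) f - f) <= n.+1%:R * (M * normLp (evol h f - f)).
Proof.
move=> h0; have h0' := ltW h0; elim: n => [|n ih] nb Lf.
  by rewrite !mul1r ler_peMl// normLp_ge0.
have nE : n.+2%:R * h = n.+1%:R * h + h by rewrite -natr1 mulrDl mul1r.
have nh0 : 0 <= n.+1%:R * h by rewrite mulr_ge0.
have nhb : n.+1%:R * h <= b by move: nb; rewrite nE; lra.
have hb : h <= b by apply: le_trans nb; rewrite nE lerDr.
have Lh := in_LpB p1 (evol_in_Lp h0' hb Lf).1 Lf.
have Ln := in_LpB p1 (evol_in_Lp nh0 nhb Lf).1 Lf.
have -> : evol (n.+2%:R * h) f - f =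
    evol (n.+1%:R * h) (evol h f - f) + (evol (n.+1%:R * h) f - f).
  by rewrite evolB// -evol_add// -nE subrKA.
apply: le_trans (normLpD p1 (evol_in_Lp nh0 nhb Lh).1 Ln) _.
have := (evol_in_Lp nh0 nhb Lh).2; have := ih nhb Lf.
by rewrite -[in X in _ <= X]natr1 mulrDl mul1r; lra.
Qed.

(* F is the right derivative of h |-> evol h G at 0 in L^p. *)
Definition evol_rderiv (G F : R -> X) := forall e : R, 0 < e ->
  exists2 d : R, 0 < d & forall h, 0 < h -> h < d ->
    normLp (evol h G - G - h%:C *: F) <= e * h.

(** Telescoping reduces time t to small steps h, each of which moves G by h |F| + o(h) in norm, at
    the cost of a factor M. *)
Lemma evol_lipschitz (G F : R -> X) t : in_Lp G -> in_Lp F -> evol_rderiv G F ->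
  0 < t -> t <= b -> normLp (evol t G - G) <= t * M * normLp F.
Proof.
move=> LG LF dG t0 tb; apply/ler_addgt0Pr => e e0.
have tM : 0 < t * M by rewrite mulr_gt0// (lt_le_trans ltr01).
have [d d0 hd] := dG _ (divr_gt0 e0 tM).
have db : 0 < Num.min d b by rewrite lt_min d0 (lt_le_trans t0).
pose n := Num.truncn (t / Num.min d b); pose h := t / n.+1%:R.
have h0 : 0 < h by rewrite divr_gt0.
have hN : n.+1%:R * h = t by rewrite mulrC divfK.
have : h < Num.min d b by rewrite ltr_pdivrMr// mulrC -ltr_pdivrMr//; exact: truncnS_gt.
rewrite lt_min => /andP[hd1 hb].
have Lh := in_LpB p1 (evol_in_Lp (ltW h0) (ltW hb) LG).1 LG.
have LhF := in_LpZ p1 h%:C LF.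
have := @evol_telescope h n G h0; rewrite hN => /(_ tb LG).
have : normLp (evol h G - G) <= e / (t * M) * h + h * normLp F.
  have -> : evol h G - G = (evol h G - G - h%:C *: F) + h%:C *: F by rewrite subrK.
  apply: le_trans (normLpD p1 (in_LpB p1 Lh LhF) LhF) _; apply: lerD; first exact: hd.
  by rewrite normLpZ// normc_def/= expr0n addr0 sqrtr_sqr gtr0_norm.
move=> h1 h2; apply: le_trans h2 _.
apply: le_trans (_ : n.+1%:R * (M * (e / (t * M) * h + h * normLp F)) <= _).
  by rewrite ler_wpM2l// ler_wpM2l.
have -> : n.+1%:R * (M * (e / (t * M) * h + h * normLp F)) =
    n.+1%:R * h * M * (e / (t * M) + normLp F) by ring.
by rewrite hN mulrDr [_ * (e / _)]mulrC divfK ?gt_eqF// addrC.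
Qed.

Lemma uniform_evol_rderiv (g f : R -> X) : 0 < b -> in_Lp g -> in_Lp f ->
  (forall s, g (mod2pi s) = g s) -> uniform_rderiv S g f -> evol_rderiv g f.
Proof.
move=> b0 Lg Lf g2 gf e e0; have w0 := w2pi_gt0 p.
have [d d0 hd] := gf _ (divr_gt0 e0 w0).
exists (Num.min d b) => [|h h0]; first by rewrite lt_min d0.
rewrite lt_min => /andP[hd1 /ltW hb].
have L := in_LpB p1 (in_LpB p1 (evol_in_Lp (ltW h0) hb Lg).1 Lg) (in_LpZ p1 h%:C Lf).
have -> : e * h = e / w2pi p * h * w2pi p by field; rewrite gt_eqF.
apply: (in_Lp_bounded p1 L.1 _ _).2.
  by rewrite mulr_ge0 ?divr_ge0// ltW.
by move=> s _; rewrite !fctE /evol g2; exact: hd.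
Qed.

End evolution.

Section periodic_multiplier.
Context (R : realType) (p : R) (p1 : 1 <= p) (X : completeNormedModType R[i]).
Variables (D : operator X X) (S : R -> X -> X).
Hypothesis gS : generates D S.
Local Notation mu := (lebesgue_2pi R).
Local Notation T := (measurableTypeR R).
Local Notation in_Lp := (in_Lp mu p).
Local Notation normLp := (normLp mu p).

Let cS : c0_semigroup S. Proof. by have [] := gS. Qed.

Definition fourier_res (v : int -> X) : int -> X := fun k => op_inv (op_shift D (ik k)) (v k).

(** The lower bound of (iii) cleared of denominators, so that it also covers the zero sequence. *)
Definition multiplier_bounded := exists2 C : R, 0 < C &
  forall N (w : int -> X), (forall k : int, (`|k| <= N)%N -> dom D (w k)) ->
  normLp (fourier_sum N w) <= C * normLp (fourier_sum N (fun k => op_shift D (ik k) (w k))).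

Lemma fourier_evol_rderiv N (w : int -> X) :
  (forall k : int, (`|k| <= N)%N -> dom D (w k)) ->
  evol_rderiv p S (fourier_sum N w) (fourier_sum N (fun k => op_shift D (ik k) (w k))).
Proof.
move=> dw; have [M M1 hM] := semigroup_bounded cS 1.
apply: (uniform_evol_rderiv p1 cS M1 hM ltr01) => //.
- exact: fourier_sum_in_Lp.
- exact: fourier_sum_in_Lp.
- by move=> s; exact: fourier_sum_mod2pi.
- exact: fourier_sum_rderiv.
Qed.

Theorem period_multiplier_bounded :
  invertible (total_op (fun x => x - S (2 * pi) x)) -> multiplier_bounded.
Proof.
move=> iS; have t0 : 0 < 2 * pi :> R by rewrite mulr_gt0 ?pi_gt0.
have [M M1 hM] := semigroup_bounded cS (2 * pi).
have [K K0 hK] := op_inv_bounded iS.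
have M0 : 0 < M by exact: lt_le_trans M1.
exists (K * (2 * pi * M)) => [|N w dw]; first by rewrite !mulr_gt0 ?pi_gt0.
have Lg := fourier_sum_in_Lp p1 N w.
have Lf := fourier_sum_in_Lp p1 N (fun k => op_shift D (ik k) (w k)).
have h := evol_lipschitz p1 cS M1 hM Lg Lf (fourier_evol_rderiv dw) t0 (lexx _).
have Le := in_LpB p1 (evol_in_Lp p1 cS M1 hM (ltW t0) (lexx _) Lg).1 Lg.
set Q := op_inv (total_op (fun x => x - S (2 * pi) x)) in hK.
have lQ : linear Q := op_inv_linear iS.
rewrite -mulrA; apply: le_trans
  (_ : K * normLp (evol S (2 * pi) (fourier_sum N w) - fourier_sum N w) <= _); last first.
  by rewrite ler_pM2l.
have [LQ hQ] := in_Lp_linf p1 lQ (ltW K0) hK Le.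
apply: le_trans hQ.
have E : fourier_sum N w = (-1) *: (Q \o (evol S (2 * pi) (fourier_sum N w) - fourier_sum N w)).
  apply/funext => s; rewrite !fctE/= /evol fourier_sum_mod2pi.
  have -> : fourier_sum N w (s - 2 * pi) = fourier_sum N w s.
    by have := fourier_sum_period N w s (-1); rewrite mulrN1.
  rewrite scaleN1r -(linfN lQ) opprB.
  exact/esym/(op_invE iS (x := fourier_sum N w s) I).
by rewrite [X in normLp X <= _]E normLpZ// normrN1 mul1r.
Qed.

Lemma generates_commute t x : 0 <= t -> dom D x -> dom D (S t x) /\ D (S t x) = S t (D x).
Proof.
move=> t0 dx; apply/(generatesP gS); apply/has_rderiv0P => e e0.
have lS := semigroup_linear cS t0.
have [h1 _ _ _] := cS; have [_ ct] := h1 t t0.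
have [K K0 hK] := continuous_linf_bounded lS ct.
have /has_rderiv0P /(_ _ (divr_gt0 e0 K0)) [d d0 hd] : has_rderiv0 S x (D x).
  exact/(generatesP gS).
exists d => // h h0 hdh.
have -> : S h (S t x) - S t x - h%:C *: S t (D x) = S t (S h x - x - h%:C *: D x).
  by rewrite !(linfB lS) (linfZ lS) -!(semigroupD cS) ?(ltW h0)// [h + t]addrC.
apply: le_trans (hK _) _; rewrite -ler_pdivlMl// mulrA [K^-1 * e]mulrC.
exact: hd.
Qed.

Section resolvent.
Hypothesis iD : forall k, invertible (op_shift D (ik k)).

Lemma fourier_resP v k : dom D (fourier_res v k) /\ op_shift D (ik k) (fourier_res v k) = v k.
Proof. exact: op_invP (iD k) (v k). Qed.

Lemma fourier_sum_resK N v s :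
  fourier_sum N (fun k => op_shift D (ik k) (fourier_res v k)) s = fourier_sum N v s.
Proof. by apply: eq_fourier_sum => k _; rewrite (fourier_resP v k).2. Qed.

(** Lets a trigonometric solution inherit invariance under S(2 pi) from its right-hand side. *)
Lemma fourier_res_commute t v k : 0 <= t -> S t (fourier_res v k) = fourier_res (S t \o v) k.
Proof.
move=> t0; have [d1 e1] := fourier_resP v k; have [d2 e2] := fourier_resP (S t \o v) k.
have [d3 e3] := generates_commute t0 d1.
apply: (invertible_injective (iD k)) => //.
rewrite e2 /= e3 -(linfZ (semigroup_linear cS t0)) -(linfB (semigroup_linear cS t0)).
by congr (S t _); exact: e1.
Qed.

Lemma fourier_res_comb N N' (v w : int -> X) (a : R[i]) :
  exists (N'' : nat) (u : int -> X),
    [/\ forall s, fourier_sum N'' u s = a *: fourier_sum N v s + fourier_sum N' w s &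
        forall s, fourier_sum N'' (fourier_res u) s =
          a *: fourier_sum N (fourier_res v) s + fourier_sum N' (fourier_res w) s].
Proof.
exists (maxn N N'), (fun k => a *: truncate N v k + truncate N' w k); split=> s.
  by rewrite fourier_sum_linear !fourier_sum_truncate ?leq_maxl ?leq_maxr.
have res_trunc n (x : int -> X) k : fourier_res (truncate n x) k = truncate n (fourier_res x) k.
  rewrite /truncate /fourier_res; case: ifP => // _.
  exact: (linf0 (op_inv_linear (iD k))).
rewrite (@eq_fourier_sum _ _ _ _ (fun k => a *: truncate N (fourier_res v) k +
  truncate N' (fourier_res w) k)).
  by rewrite fourier_sum_linear !fourier_sum_truncate ?leq_maxl ?leq_maxr.
move=> k _; rewrite -!res_trunc; exact: (op_inv_linear (iD k)).
Qed.

Lemma multiplier_bounded_res : multiplier_bounded -> exists2 C : R, 0 < C & forall N v,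
  normLp (fourier_sum N (fourier_res v)) <= C * normLp (fourier_sum N v).
Proof.
move=> [C C0 hC]; exists C => // N v.
have := hC N (fourier_res v) (fun k _ => (fourier_resP v k).1).
congr (_ <= C * normLp _); apply/funext => s; exact: fourier_sum_resK.
Qed.

Lemma fourier_res_rderiv N v : uniform_rderiv S (fourier_sum N (fourier_res v)) (fourier_sum N v).
Proof.
have := fourier_sum_rderiv cS gS (fun k (_ : (`|k| <= N)%N) => (fourier_resP v k).1).
by congr uniform_rderiv; apply/funext => s; exact: fourier_sum_resK.
Qed.

End resolvent.

End periodic_multiplier.

(** * From the multiplier bound to the inverse of 1 - S(2 pi) *)

Section periodic_converse.
Context (R : realType) (p : R) (p1 : 1 <= p) (X : completeNormedModType R[i]).
Variables (D : operator X X) (S : R -> X -> X).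
Hypothesis gS : generates D S.
Hypothesis iD : forall k, invertible (op_shift D (ik k)).
Hypothesis mD : multiplier_bounded p D.
Local Notation mu := (lebesgue_2pi R).
Local Notation T := (measurableTypeR R).
Local Notation in_Lp := (in_Lp mu p).
Local Notation normLp := (normLp mu p).
Local Notation res := (fourier_res D).

Let cS : c0_semigroup S. Proof. by have [] := gS. Qed.
Let t0 : 0 < 2 * pi :> R. Proof. by rewrite mulr_gt0 ?pi_gt0. Qed.

(* The L^p bound makes the sum small at some r in [0, 2 pi]; Duhamel's formula carries the
   estimate from r to 2 pi, which by periodicity is 0. *)
Lemma fourier_res_sup : exists2 C : R, 0 < C & forall N (v : int -> X) (c : R), 0 <= c ->
  (forall s, 0 <= s <= 2 * pi -> rnorm (fourier_sum N v s) <= c) ->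
  rnorm (fourier_sum N (res v) 0) <= C * c.
Proof.
have [C C0 hC] := multiplier_bounded_res iD mD.
have [M M1 hM] := semigroup_bounded cS (2 * pi).
have M0 : 0 < M by exact: lt_le_trans M1.
exists (M * C + 2 * pi * M) => [|N v c c0 hc]; first by rewrite addr_gt0 ?mulr_gt0 ?pi_gt0.
have w0 := w2pi_gt0 p.
apply/ler_addgt0Pr => e e0.
have eM : 0 < e / M by rewrite divr_gt0.
(* Otherwise the solution would exceed C c + e / M on all of [0, 2 pi], and its L^p norm would
   exceed the bound C c [w2pi p] given by the multiplier estimate. *)
have [r /andP[r0 r2] hr] : exists2 r, 0 <= r <= 2 * pi &
    rnorm (fourier_sum N (res v) r) <= C * c + e / M.
  apply: contrapT => h.
  have Lg := fourier_sum_in_Lp p1 N (res v).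
  have cc : 0 <= C * c + e / M by rewrite addr_ge0 ?(ltW eM)// mulr_ge0// ltW.
  suff : normLp (fourier_sum N (res v)) < (C * c + e / M) * w2pi p.
    rewrite ltNge => /negP; apply; apply: normLp_bounded_below => // s hs.
    by rewrite leNgt; apply/negP => h'; apply: h; exists s => //; exact: ltW.
  apply: le_lt_trans (hC N v) _.
  apply: le_lt_trans (_ : C * (c * w2pi p) < _).
    rewrite ler_pM2l//; apply: (in_Lp_bounded p1 _ c0 hc).2.
    exact: (fourier_sum_in_Lp p1 N v).1.
  by rewrite mulrA ltr_pM2r// ltrDl.
have tr : 0 <= 2 * pi - r by rewrite subr_ge0.
have rt : 2 * pi - r <= 2 * pi by rewrite gerBl.
have := @duhamel_sup _ _ _ cS _ _ M1 hM _ _ (2 * pi) _ c (fourier_res_rderiv gS iD N v) tr rt.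
rewrite opprB addrC subrK => H.
have {H} h1 : rnorm (S (2 * pi - r) (fourier_sum N (res v) r) - fourier_sum N (res v) (2 * pi))
    <= (2 * pi - r) * M * c.
  by apply: H => u u1 u2; apply: hc; rewrite u2 (le_trans r0).
have g2 : fourier_sum N (res v) (2 * pi) = fourier_sum N (res v) 0.
  by have := fourier_sum_period N (res v) 0 1; rewrite add0r mulr1.
rewrite -g2.
have h2 := hM _ (fourier_sum N (res v) r) tr rt.
have h3 : (2 * pi - r) * M * c <= 2 * pi * M * c.
  by rewrite !ler_wpM2r// ltW.
have h4 : M * rnorm (fourier_sum N (res v) r) <= M * (C * c + e / M) by rewrite ler_pM2l.
have h5 : M * (C * c + e / M) = M * C * c + e by field; rewrite gt_eqF.
have := ler_rnormB (fourier_sum N (res v) (2 * pi)) (S (2 * pi - r) (fourier_sum N (res v) r)).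
rewrite rnormB => h6.
rewrite [(M * C + _) * c]mulrDl; lra.
Qed.

(* The weight 1 - cos makes the orbit periodic and has integral 2 pi. *)
Definition orbit_profile (x : X) (s : R) : X := (1 - cos s)%:C *: S s x.

Lemma orbit_profile_modulus x : periodic_modulus (orbit_profile x).
Proof.
have [M M1 hM] := semigroup_bounded cS (2 * pi).
have M0 : 0 < M by exact: lt_le_trans M1.
have cos2 (s : R) : 0 <= 1 - cos s <= 2.
  by rewrite subr_ge0 cos_le1/=; have := cos_geN1 s; lra.
have bound s : 0 <= s <= 2 * pi -> rnorm (orbit_profile x s) <= 2 * (M * rnorm x).
  move=> /andP[s0 s2]; rewrite /orbit_profile rnormZr.
  have /andP[c0 c2] := cos2 s; rewrite ger0_norm//.
  by apply: ler_pM => //; [exact: rnorm_ge0|exact: hM].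
apply: uniform_periodic_modulus.
- move=> e e0; have x1 : 0 < M * rnorm x + 1.
    by rewrite ltr_wpDl// mulr_ge0 ?rnorm_ge0 ?ltW.
  have e1 : 0 < e / 2 / (M * rnorm x + 1) by rewrite !divr_gt0.
  have e2 : 0 < e / 2 / (2 * M) by rewrite !divr_gt0 ?mulr_gt0.
  have [d1 d10 hd1] := expik_continuous0 1 e1.
  have [d2 d20 hd2] := semigroup_cvg0 cS x e2.
  suff H s r : 0 <= s <= 2 * pi -> 0 <= r <= 2 * pi -> r <= s -> s - r < Num.min d1 d2 ->
      rnorm (orbit_profile x s - orbit_profile x r) <= e.
    exists (Num.min d1 d2 / 2) => [|s r hs hr srd]; first by rewrite divr_gt0// lt_min d10.
    have dm : 0 < Num.min d1 d2 by rewrite lt_min d10.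
    have [rs|/ltW sr] := leP r s.
      by apply: H => //; move: srd; rewrite ger0_norm ?subr_ge0//; lra.
    by rewrite rnormB; apply: H => //; move: srd; rewrite distrC ger0_norm ?subr_ge0//; lra.
  move=> /andP[s0 s2] /andP[r0 r2] rs; rewrite lt_min => /andP[sr1 sr2].
  have sr0 : 0 <= s - r by rewrite subr_ge0.
  have -> : orbit_profile x s - orbit_profile x r =
      (cos r - cos s)%:C *: S s x + (1 - cos r)%:C *: (S s x - S r x).
    rewrite /orbit_profile scalerBr addrA -scalerDl -rmorphD/=; congr (_%:C *: _ - _); ring.
  apply: le_trans (rnormD _ _) _; rewrite !rnormZr.
  have hc : `|cos r - cos s| <= e / 2 / (M * rnorm x + 1).
    have hz := hd1 (s - r) ltac:(by rewrite ger0_norm).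
    apply: le_trans hz; rewrite -lecR RRe_real ?normr_real//.
    have E : expik 1 r * (expik 1 (s - r) - 1) = expik 1 s - expik 1 r.
      by rewrite mulrBr mulr1 -expikD [r + _]addrC subrK.
    have -> : `|expik 1 (s - r) - 1| = `|expik 1 s - expik 1 r|.
      by rewrite -E normrM -[`|expik 1 r|]RRe_real ?normr_real// norm_expik mul1r.
    rewrite distrC; have := normc_ge_Re (expik 1 s - expik 1 r).
    by rewrite /= !mul1r.
  have hS : rnorm (S s x - S r x) <= M * (e / 2 / (2 * M)).
    have -> : S s x - S r x = S r (S (s - r) x - x).
      by rewrite (linfB (semigroup_linear cS r0)) -(semigroupD cS)// [r + _]addrC subrK.
    by apply: le_trans (hM _ _ r0 r2) _; rewrite ler_pM2l// hd2.
  have h1 : `|cos r - cos s| * rnorm (S s x) <= e / 2.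
    apply: le_trans (_ : e / 2 / (M * rnorm x + 1) * (M * rnorm x + 1) <= _).
      apply: ler_pM => //; first exact: rnorm_ge0.
      by apply: le_trans (hM _ _ s0 s2) _; rewrite lerDl.
    by rewrite divfK// gt_eqF.
  have h2 : `|1 - cos r| * rnorm (S s x - S r x) <= e / 2.
    apply: le_trans (_ : 2 * (M * (e / 2 / (2 * M))) <= _).
      have /andP[c0 c2] := cos2 r; apply: ler_pM => //; first exact: rnorm_ge0.
      by rewrite ger0_norm.
    by rewrite le_eqVlt; apply/orP; left; apply/eqP; field; rewrite gt_eqF.
  by lra.
- by exists (2 * (M * rnorm x)).
- by rewrite /orbit_profile mulr_natl cos2pi cos0 subrr !scale0r.
Qed.

Theorem multiplier_bounded_period : invertible (total_op (fun x => x - S (2 * pi) x)).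
Proof.
have [M M1 hM] := semigroup_bounded cS (2 * pi).
have M0 : 0 < M by exact: lt_le_trans M1.
have [C C0 hC] := fourier_res_sup.
have lS := semigroup_linear cS (ltW t0).
pose f x n := fourier_sum n (fejer n (orbit_profile x)).
pose g x n := fourier_sum n (res (fejer n (orbit_profile x))).
have fcvg x (e : R) : 0 < e -> exists n0 : nat, forall n s, (n0 <= n)%N -> 0 <= s <= 2 * pi ->
    rnorm (f x n s - orbit_profile x s) <= e.
  exact: fejer_uniform_cvg (orbit_profile_modulus x).
have prof_le x s : 0 <= s <= 2 * pi -> rnorm (orbit_profile x s) <= 2 * (M * rnorm x).
  move=> /andP[s0 s2]; rewrite /orbit_profile rnormZr ger0_norm ?subr_ge0 ?cos_le1//.
  apply: ler_pM; rewrite ?subr_ge0 ?cos_le1 ?rnorm_ge0//; last exact: hM.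
  by have := cos_geN1 s; lra.
(* Fejer makes f_n - f_m uniformly small, and [fourier_res_sup] carries this over to g_n(0) -
   g_m(0). *)
have lim_ex x : exists y : X, (fun n => g x n 0) @ \oo --> y.
  apply: rnorm_cauchy => e e0.
  have e1 : 0 < e / C / 2 by rewrite !divr_gt0.
  have [n0 hn0] := fcvg x _ e1; exists n0 => n m nn mm.
  have [N [u [hu1 hu2]]] := fourier_res_comb iD m n (fejer m (orbit_profile x))
    (fejer n (orbit_profile x)) (-1).
  have := hC N u (e / C) ltac:(by rewrite ltW// divr_gt0).
  rewrite hu2 scaleN1r addrC [C * _]mulrC divfK ?gt_eqF//; apply=> s hs.
  rewrite hu1 scaleN1r addrC.
  have := rnorm_triangle (f x n s) (orbit_profile x s) (f x m s).
  rewrite [in X in _ <= X](rnormB (orbit_profile x s)).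
  by have := hn0 n s nn hs; have := hn0 m s mm hs; rewrite /f; lra.
have gper x n : g x n (2 * pi) = g x n 0.
  by have := fourier_sum_period n (res (fejer n (orbit_profile x))) 0 1; rewrite add0r mulr1.
(* Duhamel over a full period, where g_n(2 pi) = g_n(0), passes to the limit. *)
have lim_eq x y : (fun n => g x n 0) @ \oo --> y -> S (2 * pi) y - y = (2 * pi)%:C *: S (2 * pi) x.
  move=> /rnorm_cvgnP gy; apply/eqP; rewrite -subr_eq0; apply/eqP; apply: rnorm_le0 => e e0.
  have k0 : 0 < M + 1 by lra.
  have e1 : 0 < e / 2 / (M + 1) by rewrite !divr_gt0.
  have e2 : 0 < e / 2 / (2 * pi * M) by rewrite !divr_gt0 ?mulr_gt0 ?pi_gt0.
  have [n1 h1] := gy _ e1; have [n2 h2] := fcvg x _ e2.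
  pose n := maxn n1 n2.
  have {h1} h1 := h1 n (leq_maxl _ _).
  have {h2} h2 s := h2 n s (leq_maxr _ _).
  have := duhamel_orbit cS M1 hM (fourier_res_rderiv gS iD n (fejer n (orbit_profile x)))
    (lexx _) h2.
  rewrite -/(g x n) gper.
  have -> : 2 * pi * M * (e / 2 / (2 * pi * M)) = e / 2.
    by rewrite mulrC divfK// gt_eqF// !mulr_gt0 ?pi_gt0.
  move=> h3.
  have -> : S (2 * pi) y - y - (2 * pi)%:C *: S (2 * pi) x =
     (S (2 * pi) (y - g x n 0) - (y - g x n 0)) +
     (S (2 * pi) (g x n 0) - g x n 0 - (2 * pi)%:C *: S (2 * pi) x).
    rewrite (linfB lS) opprB !addrA; congr (_ - _).
    by rewrite [RHS](AC 6 ((1*4)*((5*2)*(3*6))))/= !subrr !addr0.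
  apply: le_trans (rnormD _ _) _.
  have := rnormD (S (2 * pi) (y - g x n 0)) (- (y - g x n 0)); rewrite rnormN.
  have := hM (2 * pi) (y - g x n 0) (ltW t0) (lexx _).
  have : (M + 1) * rnorm (y - g x n 0) <= (M + 1) * (e / 2 / (M + 1)).
    by rewrite ler_pM2l// rnormB.
  have -> : (M + 1) * (e / 2 / (M + 1)) = e / 2 by field; rewrite gt_eqF.
  by rewrite mulrDl mul1r; lra.
have lim_le x y : (fun n => g x n 0) @ \oo --> y -> rnorm y <= C * (2 * (M * rnorm x)).
  move=> /rnorm_cvgnP gy; apply/ler_addgt0Pr => e e0.
  have e2 : 0 < e / 2 by rewrite divr_gt0.
  have e1 : 0 < e / 2 / C by rewrite divr_gt0.
  have [n1 h1] := gy _ e2; have [n2 h2] := fcvg x _ e1.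
  pose n := maxn n1 n2.
  have {h1} h1 := h1 n (leq_maxl _ _).
  have {h2} h2 s := h2 n s (leq_maxr _ _).
  have c0 : 0 <= 2 * (M * rnorm x) + e / 2 / C.
    by rewrite addr_ge0 ?(ltW e1)// !mulr_ge0 ?rnorm_ge0// ltW.
  have := hC n (fejer n (orbit_profile x)) _ c0.
  rewrite [C * (_ + _)]mulrDr [C * (e / 2 / C)]mulrC divfK ?gt_eqF// => H.
  have {H} : rnorm (g x n 0) <= C * (2 * (M * rnorm x)) + e / 2.
    apply: H => s hs; have := h2 s hs; have := prof_le x s hs.
    by have := ler_rnormB (f x n s) (orbit_profile x s); rewrite /f; lra.
  by have := ler_rnormB y (g x n 0); move: h1; rewrite rnormB; lra.
(* The preimage is x - y / (2 pi), with |y| <= 2 C M |x| by [lim_le]. *)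
apply: (invertible_bijective (K := 1 + (2 * pi)^-1 * (C * (2 * M)))).
- move=> a x y _ _; split=> //=.
  by rewrite (linfD lS) (linfZ lS) scalerBr opprD addrACA.
- move=> x _ /= /eqP; rewrite subr_eq0 => /eqP Sx.
  have [y gy] := lim_ex x.
  (* S(2 pi) fixes every sample of the weighted orbit, since x is fixed, and it commutes with the
     resolvents. *)
  have gfix n : S (2 * pi) (g x n 0) = g x n 0.
    rewrite /g (linf_fourier_sum _ _ _ lS); apply: eq_fourier_sum => k _ /=.
    rewrite (fourier_res_commute gS iD _ _ (ltW t0)) /fourier_res; congr (op_inv _ _).
    rewrite /= (linf_fejer _ _ _ lS); apply: eq_bigr => i _; congr (_ *: (_ *: _)).
    rewrite /= /orbit_profile (linfZ lS); set s := node _ _ _.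
    have s0 : 0 <= s by have /andP[] := node_itv R (ltn_ord i.2).
    by rewrite -(semigroupD cS) ?(ltW t0)// [2 * pi + _]addrC (semigroupD cS) ?(ltW t0)// -Sx.
  have Sy : S (2 * pi) y = y.
    apply/eqP; rewrite -subr_eq0; apply/eqP; apply: rnorm_le0 => e e0.
    have k0 : 0 < M + 1 by lra.
    have [n /(_ n (leqnn _)) hn] := (rnorm_cvgnP _ _).1 gy _ (divr_gt0 e0 k0).
    have -> : S (2 * pi) y - y = S (2 * pi) (y - g x n 0) - (y - g x n 0).
      by rewrite (linfB lS) gfix opprB addrA subrK.
    apply: le_trans (rnormD _ _) _; rewrite rnormN.
    have := hM (2 * pi) (y - g x n 0) (ltW t0) (lexx _).
    have : (M + 1) * rnorm (y - g x n 0) <= (M + 1) * (e / (M + 1)).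
      by rewrite ler_pM2l// rnormB.
    have -> : (M + 1) * (e / (M + 1)) = e by field; rewrite gt_eqF.
    by rewrite mulrDl mul1r; lra.
  have := lim_eq x y gy; rewrite Sy subrr => /esym/eqP.
  by rewrite scaler_eq0 eq_complex/= gt_eqF//= -Sx => /eqP.
move=> x; have [y gy] := lim_ex x; exists (x - (2 * pi)^-1%:C *: y); split=> //=.
  have := lim_eq x y gy; rewrite (linfB lS) (linfZ lS) => Sy.
  have E : S (2 * pi) x = (2 * pi)^-1%:C *: S (2 * pi) y - (2 * pi)^-1%:C *: y.
    by rewrite -scalerBr Sy scalerA -rmorphM/= mulVf ?gt_eqF// scale1r.
  by rewrite E [_ *: S _ _ - _ *: y]addrC addrK opprK subrK.
apply: le_trans (rnormD _ _) _; rewrite rnormN rnormZr gtr0_norm ?invr_gt0//.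
rewrite [(1 + _) * rnorm x]mulrDl mul1r lerD2l -mulrA ler_pM2l ?invr_gt0// -!mulrA.
exact: lim_le gy.
Qed.

End periodic_converse.

Section pointwise_maps.
Context (R : realType) (p : R) (p1 : 1 <= p) (V W : normedModType R[i]).
Variable L : V -> W.
Hypothesis lL : linear L.
Variable K : R.
Hypothesis K0 : 0 <= K.
Hypothesis hK : forall x, rnorm (L x) <= K * rnorm x.
Local Notation mu := (lebesgue_2pi R).
Local Notation T := (measurableTypeR R).

Lemma pointwise_class (f : R -> V) : in_Lp mu p (f : T -> V) ->
  pointwise p1 L (Lper_class p1 f) = Lper_class p1 (L \o f).
Proof.
move=> Lf; have LF := repr_in_Lp (Lper_class p1 f : Lp mu p1 V).
apply: Lp_class_eq.
- exact: (in_Lp_linf p1 lL K0 hK LF).1.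
- exact: (in_Lp_linf p1 lL K0 hK Lf).1.
- by apply: filterS (Lp_class_aeE p1 Lf) => s e; congr L; exact: e.
Qed.

Lemma pointwise_linear : linear (pointwise p1 L : Lper p1 V -> Lper p1 W).
Proof.
move=> a F G.
have LF := repr_in_Lp (F : Lp mu p1 V); have LG := repr_in_Lp (G : Lp mu p1 V).
have LLF := (in_Lp_linf p1 lL K0 hK LF).1; have LLG := (in_Lp_linf p1 lL K0 hK LG).1.
have E : a *: F + G = Lper_class p1 (a *: repr (F : Lp mu p1 V) + repr (G : Lp mu p1 V)).
  by rewrite [RHS](Lp_class_linear p1 a LF LG) !Lp_classK.
rewrite E pointwise_class; last by apply: in_LpD => //; exact: in_LpZ.
rewrite -[RHS](Lp_class_linear p1 a LLF LLG); congr Lper_class.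
by apply/funext => s; rewrite /= lL.
Qed.

Lemma rnorm_pointwise_le (F : Lper p1 V) : rnorm (pointwise p1 L F) <= K * rnorm F.
Proof.
have LF := repr_in_Lp (F : Lp mu p1 V); have [LLF h] := in_Lp_linf p1 lL K0 hK LF.
by rewrite [rnorm (pointwise _ _ _)](rnorm_Lp_class p1 LLF).
Qed.

End pointwise_maps.

(** * The generator of the evolution semigroup and its inverse *)

Section evolution_generator.
Context (R : realType) (p : R) (p1 : 1 <= p) (X : completeNormedModType R[i]).
Variables (A : operator X X) (S : R -> X -> X).
Hypothesis gS : generates A S.
Local Notation mu := (lebesgue_2pi R).
Local Notation T := (measurableTypeR R).
Local Notation in_Lp := (in_Lp mu p).
Local Notation normLp := (normLp mu p).
Local Notation cl := (@Lper_class R p p1 X).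
Local Notation res := (fourier_res A).

Let cS : c0_semigroup S. Proof. by have [] := gS. Qed.
Let t0 : 0 < 2 * pi :> R. Proof. by rewrite mulr_gt0 ?pi_gt0. Qed.

Lemma in_Lp_evol t (f : R -> X) : 0 <= t -> in_Lp f -> in_Lp (evol S t f).
Proof.
move=> t_ge0 Lf; have [M M1 hM] := semigroup_bounded cS t.
exact: (evol_in_Lp p1 cS M1 hM t_ge0 (lexx _) Lf).1.
Qed.

Lemma evolution_class t (f : R -> X) : 0 <= t -> in_Lp f ->
  evolution p1 S t (cl f) = cl (evol S t f).
Proof.
move=> t_ge0 Lf; apply: Lp_class_eq.
- exact: (in_Lp_evol t_ge0 (repr_in_Lp (cl f : Lp mu p1 X))).
- exact: in_Lp_evol.
- have h := @ae_mod2pi_shift R t (fun s => repr (cl f : Lp mu p1 X) s = f s) (Lp_class_aeE p1 Lf).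
  by apply: (@filterS _ _ (ae_filter_ringOfSetsType mu) _ _ _ h) => s e; congr (S t _); exact: e.
Qed.

Lemma evolution_linear t : 0 <= t -> linear (evolution p1 S t : Lper p1 X -> Lper p1 X).
Proof.
move=> t_ge0 a F G.
have LF := repr_in_Lp (F : Lp mu p1 X); have LG := repr_in_Lp (G : Lp mu p1 X).
have E : a *: F + G = cl (a *: repr (F : Lp mu p1 X) + repr (G : Lp mu p1 X)).
  by rewrite [RHS](Lp_class_linear p1 a LF LG) !Lp_classK.
rewrite E evolution_class//; last by apply: in_LpD => //; exact: in_LpZ.
rewrite -[RHS](Lp_class_linear p1 a (in_Lp_evol t_ge0 LF) (in_Lp_evol t_ge0 LG)); congr Lper_class.
by apply/funext => s; rewrite /evol /= (semigroup_linear cS t_ge0).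
Qed.

Lemma evolution_rderiv0P (G F : R -> X) : in_Lp G -> in_Lp F ->
  has_rderiv0 (evolution p1 S) (cl G) (cl F) <-> evol_rderiv p S G F.
Proof.
move=> LG LF; rewrite has_rderiv0P.
have E h : 0 < h -> rnorm (evolution p1 S h (cl G) - cl G - h%:C *: cl F) =
    normLp (evol S h G - G - h%:C *: F).
  move=> h0; have Le := in_Lp_evol (ltW h0) LG.
  have LB := in_LpB p1 Le LG.
  rewrite evolution_class ?(ltW h0)//.
  have LhF := in_LpZ p1 h%:C LF.
  rewrite -(rnorm_Lp_class p1 (in_LpB p1 LB LhF)); congr rnorm.
  by rewrite [RHS](Lp_classB p1 LB LhF) (Lp_classB p1 Le LG) (Lp_classZ p1 h%:C LF).
split=> h e /h [d d0 hd]; exists d => // k k0 kd; have := hd k k0 kd; by rewrite E.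
Qed.

Hypothesis iS : invertible (total_op (fun x => x - S (2 * pi) x)).

Let iA : forall k, invertible (op_shift A (ik k)) := period_resolvent gS iS.

(** Duhamel over a full period bounds (1 - S(2 pi)) g(0) by the L^p norm of f; inverting 1 - S(2 pi)
    bounds g(0), and Duhamel from 0 to s then bounds g(s). *)
Lemma fourier_res_sup_normLp : exists2 C : R, 0 < C & forall N (v : int -> X) s,
  rnorm (fourier_sum N (res v) s) <= C * normLp (fourier_sum N v).
Proof.
have [M M1 hM] := semigroup_bounded cS (2 * pi).
have M0 : 0 < M by exact: lt_le_trans M1.
have [K K0 hK] := op_inv_bounded iS.
pose C := M * (1 + 4 * pi); have C0 : 0 < C by rewrite mulr_gt0// addr_gt0// mulr_gt0 ?pi_gt0.
exists (M * (K * C) + C) => [|N v s]; first exact: addr_gt0 (mulr_gt0 M0 (mulr_gt0 K0 C0)) C0.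
pose g := fourier_sum N (res v); pose f := fourier_sum N v.
have H r t : 0 <= t -> t <= 2 * pi -> 0 <= r - t -> r <= 2 * pi ->
    rnorm (S t (g (r - t)) - g r) <= C * normLp f.
  move=> t_ge0 t2 rt r2.
  apply: (duhamel_normLp cS M1 hM p1 (fourier_res_rderiv gS iA N v)) => //.
  - exact: fourier_sum_continuous.
  - exact: fourier_sum_in_Lp.
  - by move=> e e0; exact: fourier_sum_uniform_continuous.
have n0 : 0 <= normLp f by exact: normLp_ge0.
have g0 : rnorm (g 0) <= K * C * normLp f.
  have g2 : g (2 * pi) = g 0 by have := fourier_sum_period N (res v) 0 1; rewrite add0r mulr1.
  have -> : g 0 = op_inv (total_op (fun x => x - S (2 * pi) x)) (g 0 - S (2 * pi) (g 0)).
    exact/esym/(op_invE iS (x := g 0) I).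
  apply: le_trans (hK _) _; rewrite -mulrA ler_pM2l// rnormB.
  by have := H (2 * pi) (2 * pi) (ltW t0) (lexx _); rewrite subrr g2; apply.
rewrite -/(g s) -[g s]fourier_sum_mod2pi -/(g (mod2pi s)).
have /andP[s0 s2] := mod2pi_itv s; set r := mod2pi s in s0 s2 *.
have := H r r s0 (ltW s2); rewrite subrr => /(_ (lexx _) (ltW s2)) h1.
have h2 := hM _ (g 0) s0 (ltW s2).
have h3 : M * rnorm (g 0) <= M * (K * C * normLp f) by rewrite ler_pM2l.
have := ler_rnormB (g r) (S r (g 0)); rewrite rnormB => h4.
rewrite [(_ + C) * _]mulrDl -mulrA; lra.
Qed.

Lemma harmonic_small (K e : R) : 0 < e -> exists n0 : nat, forall n, (n0 <= n)%N ->
  K / n.+1%:R <= e.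
Proof.
move=> e0; exists (Num.truncn (K / e)) => n hn; rewrite ler_pdivrMr// mulrC -ler_pdivrMr//.
by apply: ltW; apply: lt_le_trans (truncnS_gt _) _; rewrite ler_nat.
Qed.

(* The solutions for trigonometric approximants of f converge uniformly, not only in L^p. *)
Lemma evol_solution : exists C : R, forall f : R -> X, in_Lp f ->
  exists g : R -> X, [/\ in_Lp g, evol_rderiv p S g f & normLp g <= C * normLp f].
Proof.
have [C C0 hC] := multiplier_bounded_res iA (period_multiplier_bounded p1 gS iS).
have [C1 C10 hC1] := fourier_res_sup_normLp.
have [M M1 hM] := semigroup_bounded cS (2 * pi).
have M0 : 0 < M by exact: lt_le_trans M1.
have w0 := w2pi_gt0 p.
exists C => f Lf.
have happ n : exists Nv : nat * (int -> X), normLp (f - fourier_sum Nv.1 Nv.2) <= n.+1%:R^-1.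
  have n0 : (0 : R) < n.+1%:R^-1 by rewrite invr_gt0.
  by have [N [v hv]] := fourier_sum_dense p1 Lf n0; exists (N, v).
have [Nv hNv] := choice happ.
pose fn n : R -> X := fourier_sum (Nv n).1 (Nv n).2.
pose gn n : R -> X := fourier_sum (Nv n).1 (res (Nv n).2).
pose e n : R := n.+1%:R^-1.
have e_gt0 n : 0 < e n by rewrite invr_gt0.
have e_le n m : (n <= m)%N -> e m <= e n by move=> nm; rewrite lef_pV2 ?posrE// ler_nat.
have ffn n : normLp (f - fn n) <= e n by exact: hNv.
have Lfn n : in_Lp (fn n) by exact: fourier_sum_in_Lp.
have Lgn n : in_Lp (gn n) by exact: fourier_sum_in_Lp.
have fnm n m : normLp (fn n - fn m) <= e n + e m.
  apply: le_trans (normLp_triangle p1 (Lfn n) Lf (Lfn m)) _.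
  by rewrite (normLpBC p1 (Lfn n) Lf) lerD.
have comb n m : exists N u, (fourier_sum N u = fn n - fn m) /\ (fourier_sum N (res u) = gn n - gn m).
  have [N [u [h1 h2]]] := fourier_res_comb iA (Nv m).1 (Nv n).1 (Nv m).2 (Nv n).2 (-1).
  by exists N, u; split; apply/funext => s; rewrite ?h1 ?h2 scaleN1r addrC.
have gnm n m s : rnorm (gn n s - gn m s) <= C1 * (e n + e m).
  have [N [u [h1 h2]]] := comb n m; have := hC1 N u s; rewrite h1 h2 => h.
  by apply: le_trans h _; rewrite ler_pM2l.
have lim_ex s : exists y : X, (fun n => gn n s) @ \oo --> y.
  apply: rnorm_cauchy => d d0; have [n0 hn0] := harmonic_small (2 * C1) d0.
  exists n0 => n m nn mm; apply: le_trans (gnm n m s) _.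
  have := hn0 n0 (leqnn _); rewrite -/(e n0).
  have : C1 * (e n + e m) <= C1 * (e n0 + e n0) by rewrite ler_pM2l// lerD// e_le.
  lra.
have [g hg] := choice lim_ex.
have ggn n s : rnorm (g s - gn n s) <= 2 * C1 * e n.
  apply/ler_addgt0Pr => d d0; have /rnorm_cvgnP /(_ d d0) [m0 hm0] := hg s.
  pose m := maxn n m0; have := hm0 m (leq_maxr _ _); rewrite rnormB => h1.
  have := rnorm_triangle (g s) (gn m s) (gn n s); have := gnm m n s.
  have : C1 * (e m + e n) <= C1 * (e n + e n) by rewrite ler_pM2l// lerD// e_le ?leq_maxl.
  lra.
have cg : continuous g.
  move=> s; apply/rnorm_cvgP => d d0.
  have d3 : 0 < d / 3 by rewrite divr_gt0.
  have [n0 /(_ n0 (leqnn _)) hn0] := harmonic_small (2 * C1) d3; rewrite -/(e n0) in hn0.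
  have [r r0 hr] := fourier_sum_uniform_continuous (Nv n0).1 (res (Nv n0).2) d3.
  exists r => // t /=; rewrite distrC => /ltW tr.
  have h1 : rnorm (gn n0 t - gn n0 s) <= d / 3 := hr t s tr.
  have h2 : rnorm (gn n0 s - g s) <= 2 * C1 * e n0 by rewrite rnormB.
  have h3 := ggn n0 t.
  have := rnorm_triangle (g t) (gn n0 t) (g s).
  have := rnorm_triangle (gn n0 t) (gn n0 s) (g s).
  lra.
have Lggn n : in_Lp (g - gn n) /\ normLp (g - gn n) <= 2 * C1 * e n * w2pi p.
  have sgn : strongly_measurable (g - gn n : T -> X).
    have sg := continuous_strongly_measurable cg; have sn := (in_LpZ p1 (-1) (Lgn n)).1.
    by rewrite -[- gn n]scaleN1r; exact: strongly_measurableD.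
  have b0 : 0 <= 2 * C1 * e n by exact: mulr_ge0 (mulr_ge0 (ler0n _ 2) (ltW C10)) (ltW (e_gt0 n)).
  have := in_Lp_bounded p1 sgn b0; apply=> s _; exact: ggn.
have Lg : in_Lp g.
  rewrite -(subrK (gn 0%N) g); apply: in_LpD => //; exact: (Lggn 0%N).1.
exists g; split=> //.
- move=> d d0.
  have d2 : 0 < d / 2 by rewrite divr_gt0.
  have [n /(_ n (leqnn _)) hn] := harmonic_small (2 * M + 1) d2; rewrite -/(e n) in hn.
  have hrd : evol_rderiv p S (gn n) (fn n).
    have := fourier_evol_rderiv p1 gS (fun k (_ : (`|k| <= (Nv n).1)%N) => (fourier_resP iA (Nv n).2 k).1).
    by congr evol_rderiv; apply/funext => s; exact: fourier_sum_resK.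
  have [r r0 hr] := hrd _ d2.
  exists (Num.min r (2 * pi)) => [|h h0]; first by rewrite lt_min r0.
  rewrite lt_min => /andP[hhr /ltW h2].
  have Le k : in_Lp k -> in_Lp (evol S h k) by move=> Lk; exact: in_Lp_evol (ltW h0) Lk.
  have eB k l : evol S h (k - l) = evol S h k - evol S h l by exact: evolB (ltW h0).
  pose k := g - gn n; have Lk : in_Lp k := (Lggn n).1.
  have Lffn := in_LpB p1 Lf (Lfn n).
  have E : evol S h g - g - h%:C *: f = (evol S h (gn n) - gn n - h%:C *: fn n) +
      ((evol S h k - k) - h%:C *: (f - fn n)).
    rewrite /k eB scalerBr !opprB !addrA.
    set a := evol S h (gn n); set b := evol S h g.
    by rewrite [RHS](AC 9 ((4*7*9)*((1*5)*((2*6)*(3*8)))))/= subrr addNr addNr !addr0.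
  have L1 := in_LpB p1 (in_LpB p1 (Le _ (Lgn n)) (Lgn n)) (in_LpZ p1 h%:C (Lfn n)).
  have L2 := in_LpB p1 (Le _ Lk) Lk; have L3 := in_LpZ p1 h%:C Lffn.
  rewrite E; apply: le_trans (normLpD p1 L1 (in_LpB p1 L2 L3)) _.
  have b1 := hr h h0 hhr.
  (* The derivative of k = g - gn is what has to be established, but gm - gn has the derivative fm -
     fn, of norm at most 2 e_n for m >= n. [evol_lipschitz] applies to it, and for fixed h the
     contribution of g - gm vanishes as m grows. *)
  have b2 : normLp (evol S h k - k) <= 2 * M * e n * h.
    apply/ler_addgt0Pr => d' d'0.
    have [m0 hm0] := harmonic_small ((M + 1) * (2 * C1 * w2pi p)) d'0.
    pose m := maxn n m0; have hm := hm0 m (leq_maxr _ _); rewrite -/(e m) in hm.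
    have [N [u [hu1 hu2]]] := comb m n.
    have hrd' : evol_rderiv p S (gn m - gn n) (fn m - fn n).
      rewrite -hu1 -hu2.
      have := fourier_evol_rderiv p1 gS (fun k (_ : (`|k| <= N)%N) => (fourier_resP iA u k).1).
      by congr evol_rderiv; apply/funext => s; exact: fourier_sum_resK.
    have Lgmn := in_LpB p1 (Lgn m) (Lgn n).
    have b3 := evol_lipschitz p1 cS M1 hM Lgmn (in_LpB p1 (Lfn m) (Lfn n)) hrd' h0 h2.
    have Lgm := (Lggn m).1.
    have [Leg b4] := evol_in_Lp p1 cS M1 hM (ltW h0) h2 Lgm.
    have E' : evol S h k - k = (evol S h (gn m - gn n) - (gn m - gn n)) +
        (evol S h (g - gn m) - (g - gn m)).
      rewrite /k !eB !opprB !addrA.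
      set a := evol S h (gn n); set b := evol S h g; set c := evol S h (gn m).
      by rewrite [RHS](AC 8 ((5*2*3*8)*((1*6)*(4*7))))/= subrr addNr !addr0.
    rewrite E'; apply: le_trans (normLpD p1 (in_LpB p1 (Le _ Lgmn) Lgmn) (in_LpB p1 Leg Lgm)) _.
    have b5 : normLp (evol S h (g - gn m) - (g - gn m)) <= (M + 1) * normLp (g - gn m).
      by apply: le_trans (normLpB p1 Leg Lgm) _; rewrite mulrDl mul1r lerD.
    have b6 : h * M * normLp (fn m - fn n) <= h * M * (e n + e n).
      rewrite ler_pM2l ?mulr_gt0//; apply: le_trans (fnm m n) _.
      by rewrite lerD// e_le// leq_maxl.
    have b7 : (M + 1) * normLp (g - gn m) <= (M + 1) * (2 * C1 * e m * w2pi p).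
      by rewrite ler_wpM2l ?addr_ge0 ?(ltW M0)//; exact: (Lggn m).2.
    have b8 : (M + 1) * (2 * C1 * e m * w2pi p) = (M + 1) * (2 * C1 * w2pi p) * e m by ring.
    have b9 : h * M * (e n + e n) = 2 * M * e n * h by ring.
    by move: hm b7 b6 b3; rewrite b8 b9; lra.
  have b10 : normLp (h%:C *: (f - fn n)) <= e n * h.
    rewrite normLpZ// normc_def/= expr0n addr0 sqrtr_sqr gtr0_norm// mulrC ler_pM2r//.
  have b11 := normLpB p1 L2 L3.
  have b12 : (2 * M + 1) * e n * h <= d / 2 * h by rewrite ler_pM2r.
  by rewrite !mulrDl mul1r in b12; lra.
- apply/ler_addgt0Pr => d d0.
  have [n /(_ n (leqnn _)) hn] := harmonic_small (2 * C1 * w2pi p + C) d0; rewrite -/(e n) in hn.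
  have [Lk b1] := Lggn n.
  have b2 : normLp g <= normLp (g - gn n) + normLp (gn n).
    by rewrite -{1}(subrK (gn n) g); exact: normLpD.
  have b3 : normLp (fn n) <= normLp f + e n.
    rewrite -(subrK f (fn n)) addrC; apply: le_trans (normLpD p1 Lf (in_LpB p1 (Lfn n) Lf)) _.
    by rewrite lerD2l normLpBC.
  have b4 : C * normLp (fn n) <= C * (normLp f + e n) by rewrite ler_pM2l.
  have b5 : normLp (gn n) <= C * normLp (fn n) := hC _ _.
  have b6 : 2 * C1 * e n * w2pi p = 2 * C1 * w2pi p * e n by ring.
  move: hn b1 b4; rewrite b6 mulrDl mulrDr; lra.
Qed.

Theorem evolution_generator_invertible : invertible (generator (evolution p1 S)).
Proof.
have [C hC] := evol_solution.
apply: (invertible_bijective (K := C)).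
- move=> a F G dF dG; apply: generator_linear => // t /ltW; exact: evolution_linear.
- move=> F dF GF.
  pose f := repr (F : Lp mu p1 X); have Lf : in_Lp f by exact: repr_in_Lp.
  have FE : cl f = F by exact: Lp_classK.
  have L0 : in_Lp (0 : R -> X) by have := in_LpZ p1 0 Lf; rewrite scale0r.
  have c0 : cl 0 = 0 by have := Lp_classZ p1 0 Lf; rewrite !scale0r.
  have : evol_rderiv p S f 0.
    by apply/(evolution_rderiv0P Lf L0); rewrite FE c0; apply/generatorP.
  have [M M1 hM] := semigroup_bounded cS (2 * pi).
  (* A zero derivative makes f invariant at time 2 pi, where the rotation is trivial: S(2 pi) f(s) =
     f(s) for almost every s, and so f(s) = 0. *)
  move=> /(evol_lipschitz p1 cS M1 hM Lf L0) /(_ t0 (lexx _)).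
  have -> : normLp (0 : R -> X) = 0.
    by have := normLpZ p1 0 Lf; rewrite scale0r normr0/= mul0r.
  rewrite mulr0 => h.
  have Le := in_LpB p1 (in_Lp_evol (ltW t0) Lf) Lf.
  have h0 : normLp (evol S (2 * pi) f - f) = 0.
    by apply/eqP; rewrite eq_le h normLp_ge0.
  have ae0 := normLp_eq0 p1 Le h0.
  have aei : {ae mu, forall s : T, mod2pi (s - 2 * pi) = s}.
    apply: ae_2pi => s s0 s2; have := mod2pi_period s (-1); rewrite mulrN1 => ->.
    exact: mod2pi_small.
  have aef : {ae mu, forall s : T, f s = 0}.
    apply: filterS2 ae0 aei => s; rewrite !fctE /evol => + e; rewrite e => /eqP.
    rewrite subr_eq0 => /eqP e'.
    have lS := semigroup_linear cS (ltW t0).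
    by apply: (invertible_injective iS) => //=; rewrite e' (linf0 lS) !subrr.
  by rewrite -FE -c0; apply: Lp_class_eq.
- move=> F; pose f := repr (F : Lp mu p1 X); have Lf : in_Lp f by exact: repr_in_Lp.
  have FE : cl f = F by exact: Lp_classK.
  have [g [Lg dg hg]] := hC f Lf; exists (cl g).
  have [d1 d2] : dom (generator (evolution p1 S)) (cl g) /\ generator (evolution p1 S) (cl g) = F.
    by apply/generatorP; rewrite -FE; apply/(evolution_rderiv0P Lg Lf).
  split=> //; rewrite (rnorm_Lp_class p1 Lg); apply: le_trans hg _.
  by rewrite -(rnorm_Lp_class p1 Lf) [Lp_class _ _ _]FE.
Qed.

Lemma evolution_generator_fourier N (v : int -> X) :
  op_inv (generator (evolution p1 S)) (cl (fourier_sum N v)) = cl (fourier_sum N (res v)).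
Proof.
have Lv := fourier_sum_in_Lp p1 N v; have Lr := fourier_sum_in_Lp p1 N (res v).
have [d1 <-] : dom (generator (evolution p1 S)) (cl (fourier_sum N (res v))) /\
    generator (evolution p1 S) (cl (fourier_sum N (res v))) = cl (fourier_sum N v).
  apply/generatorP/(evolution_rderiv0P Lr Lv).
  have := fourier_evol_rderiv p1 gS (fun k (_ : (`|k| <= N)%N) => (fourier_resP iA v k).1).
  by congr evol_rderiv; apply/funext => s; exact: fourier_sum_resK.
by apply: op_invE => //; exact: evolution_generator_invertible.
Qed.

End evolution_generator.

(** * The quotients over nonzero sequences *)

Section fourier_quotients.
Context (R : realType) (p : R) (p1 : 1 <= p).
Implicit Types V W : normedModType R[i].
Local Notation mu := (lebesgue_2pi R).
Local Notation T := (measurableTypeR R).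
Local Notation normLp := (normLp mu p).

Lemma rnorm_fourier_sum V N (v : int -> V) :
  rnorm (Lper_class p1 (fourier_sum N v)) = normLp (fourier_sum N v).
Proof. exact: (rnorm_Lp_class p1 (fourier_sum_in_Lp p1 N v)). Qed.

(** A nonzero value at s < 2 pi persists on some [s, s + e[ inside [0, 2 pi[, which has positive
    measure. *)
Lemma continuous_ae_eq0 V (f : R -> V) : continuous f -> {ae mu, forall s, f s = 0} ->
  forall s, 0 <= s -> s < 2 * pi -> f s = 0.
Proof.
move=> cf ae0 s s0 s2; apply: contrapT => fs; have {}fs : 0 < rnorm (f s).
  by rewrite lt_neqAle rnorm_ge0 andbT; apply/eqP => /esym/rnorm_eq0.
have [d /= d0 hd] : exists2 d : R, 0 < d & forall t, `|s - t| < d -> f t <> 0.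
  have f2 : 0 < rnorm (f s) / 2 by rewrite divr_gt0.
  have := cf s; move/rnorm_cvgP => /(_ _ f2) /nbhs_ballP[d /= d0 hd]; exists d => // t /hd /= h ft0.
  by move: h; rewrite ft0 sub0r rnormN; lra.
pose e := Num.min d (2 * pi - s); have e0 : 0 < e by rewrite lt_min d0 subr_gt0.
pose I : set T := `[s, s + e[%classic; have mI : measurable I by exact: measurable_itv.
have /negP[] : mu I != 0%E.
  rewrite lebesgue_2pi_co// (_ : _ `&` _ = I); last first.
    apply/seteqP; split=> [t []//|t It]; split=> //; move: It.
    rewrite /I/= !in_itv/= => /andP[st te]; rewrite (le_trans s0 st)/=; apply: lt_le_trans te _.
    by rewrite -lerBrDl ge_min lexx orbT.
  by rewrite lebesgue_measure_itv/= lte_fin ltrDl e0 -EFinB addrC addKr gt_eqF.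
apply/eqP; apply: measure_negligible => //.
apply: negligibleS ae0 => t; rewrite /I/= in_itv/= => /andP[st te]; apply: hd.
rewrite distrC ger0_norm ?subr_ge0// ltrBlDl; apply: lt_le_trans te _.
by rewrite lerD2l ge_min lexx.
Qed.

Lemma fourier_sum_normLp_gt0 V N (v : int -> V) : (exists2 k : int, (`|k| <= N)%N & v k != 0) ->
  0 < normLp (fourier_sum N v).
Proof.
move=> [k kN]; rewrite lt_neqAle normLp_ge0 andbT; apply: contra => /eqP/esym h.
have ae0 := normLp_eq0 p1 (fourier_sum_in_Lp p1 N v) h.
have z := continuous_ae_eq0 (@fourier_sum_continuous R V N v) ae0.
by apply/eqP; exact: fourier_sum_inj z k kN.
Qed.

End fourier_quotients.

Section multiplier_criterion.
Context (R : realType) (p : R) (p1 : 1 <= p) (X : completeNormedModType R[i]).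
Variables (D : operator X X) (S : R -> X -> X).
Hypothesis gS : generates D S.
Local Notation mu := (lebesgue_2pi R).
Local Notation normLp := (normLp mu p).
Local Notation res := (fourier_res D).

Lemma range_ik_resolventP : range ik `<=` resolvent_set D <->
  forall k, invertible (op_shift D (ik k)).
Proof.
split=> [h k|h _ [k _ <-]]; last exact/resolvent_setP.
by apply/resolvent_setP; apply: h; exists k.
Qed.

Lemma multiplier_bounded_sup : (forall k, invertible (op_shift D (ik k))) ->
  multiplier_bounded p D ->
  (ge0_sup (fourier_quotients p1 [set: X] (fun k => op_inv (op_shift D (ik k)))) < +oo)%E.
Proof.
move=> iD mD; have [C C0 hC] := multiplier_bounded_res iD mD.
apply: (@le_lt_trans _ _ C%:E); last exact: ltry.
apply: ge_ereal_sup => _ [->|[N [v [_ v0 ->]]]]; first by rewrite lee_fin ltW.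
rewrite lee_fin !rnorm_fourier_sum ler_pdivrMr; last exact: fourier_sum_normLp_gt0 v0.
exact: hC.
Qed.

(** Substituting u_k = (D - ik) v_k turns each quotient of (iii) into the reciprocal of one of (ii);
    u is nonzero because D - ik is injective. *)
Lemma sup_inf_gt0 : (forall k, invertible (op_shift D (ik k))) ->
  (ge0_sup (fourier_quotients p1 [set: X] (fun k => op_inv (op_shift D (ik k)))) < +oo)%E ->
  (0 < ereal_inf (fourier_quotients p1 (dom D) (fun k => op_shift D (ik k))))%E.
Proof.
move=> iD; set s := ge0_sup _ => soo.
have s0 : (0 <= s)%E by apply: ereal_sup_ubound; left.
have sE : s = (fine s)%:E by rewrite fineK// ge0_fin_numE.
have f0 : 0 <= fine s by rewrite -lee_fin -sE.
(* The added 1 keeps the bound invertible when the supremum is 0. *)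
have f1 : 0 < fine s + 1 by rewrite ltr_wpDl.
apply: (@lt_le_trans _ _ ((fine s + 1)^-1)%:E); first by rewrite lte_fin invr_gt0.
apply: le_ereal_inf_tmp => _ [N [v [dv [k kN vk] ->]]].
pose u k := op_shift D (ik k) (v k).
have dD0 : dom D 0 /\ D 0 = 0.
  have [x [dx ex]] : exists x, dom D x /\ D x = D x.
    by exists (v k); split=> //; exact: dv.
  have := generates_linear gS (-1) dx dx.
  by rewrite !scaleN1r !addNr.
have uk : u k != 0.
  apply: contra vk => /eqP e; apply/eqP; apply: (invertible_injective (iD k)) => //=.
  - exact: dv.
  - exact: dD0.1.
  - by rewrite dD0.2 scaler0 subrr; exact: e.
have g0 : 0 < normLp (fourier_sum N u) by apply: (fourier_sum_normLp_gt0 p1); exists k.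
have h0 : 0 < normLp (fourier_sum N v) by apply: (fourier_sum_normLp_gt0 p1); exists k.
have : ((normLp (fourier_sum N v) / normLp (fourier_sum N u))%:E <= s)%E.
  apply: ereal_sup_ubound; right; exists N, u; split=> //; first by exists k.
  rewrite !rnorm_fourier_sum; congr (normLp _ / _)%:E; apply/funext => t.
  by apply: eq_fourier_sum => j jN; rewrite op_invE//; exact: dv.
rewrite sE lee_fin ler_pdivrMr// => h.
rewrite lee_fin !rnorm_fourier_sum ler_pdivlMr// mulrC ler_pdivrMr// mulrC.
by apply: le_trans h _; rewrite ler_pM2r// lerDl.
Qed.

Lemma inf_gt0_multiplier_bounded :
  (0 < ereal_inf (fourier_quotients p1 (dom D) (fun k => op_shift D (ik k))))%E ->
  multiplier_bounded p D.
Proof.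
move=> i0.
have [c c0 hc] : exists2 c : R, 0 < c &
    (c%:E <= ereal_inf (fourier_quotients p1 (dom D) (fun k => op_shift D (ik k))))%E.
  case: (ereal_inf _) i0 => [r| |] //; first by exists r.
  (* The quotients are finite, so an infinite infimum means that there are none and any constant
     will do. *)
  by move=> _; exists 1 => //; exact: leey.
exists c^-1 => [|N w dw]; first by rewrite invr_gt0.
have [[k kN wk]|w0] := pselect (exists2 k : int, (`|k| <= N)%N & w k != 0).
  have h0 : 0 < normLp (fourier_sum N w) by apply: (fourier_sum_normLp_gt0 p1); exists k.
  rewrite mulrC ler_pdivlMr// mulrC -ler_pdivlMr// -lee_fin; apply: le_trans hc _.
  apply: ereal_inf_lbound; exists N, w; split=> //; first by exists k.
  by rewrite !rnorm_fourier_sum.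
have -> : fourier_sum N w = 0 :> (R -> X).
  apply/funext => s; rewrite (@eq_fourier_sum _ _ N w (fun=> 0)) ?fourier_sum0// => k kN.
  by apply/eqP; apply: contrapT => /negP h; apply: w0; exists k.
have -> : normLp (0 : R -> X) = 0.
  have L0 := fourier_sum_in_Lp p1 0 (fun=> 0 : X).
  have := normLpZ p1 0 L0; rewrite scale0r normr0/= mul0r; exact.
by rewrite mulr_ge0 ?normLp_ge0// invr_ge0 ltW.
Qed.

End multiplier_criterion.

(** * The norm of the input-output operator *)

Section input_output_norm.
Context (R : realType) (p : R) (p1 : 1 <= p) (V W : normedModType R[i]).
Variables (M : Lper p1 V -> Lper p1 W) (N : int -> V -> W).
Hypothesis lM : linear M.
Variable K : R.
Hypothesis hM : forall F, rnorm (M F) <= K * rnorm F.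
Hypothesis MN : forall n v, M (Lper_class p1 (fourier_sum n v)) =
  Lper_class p1 (fourier_sum n (fun k => N k (v k))).

(** The quotients are the ratios |M F| / |F| over classes of nonzero trigonometric polynomials;
    these are dense and M is bounded, so they determine the norm. *)
Lemma opnorm_fourier_quotients : opnorm M = ge0_sup (fourier_quotients p1 [set: V] N).
Proof.
apply/eqP; rewrite eq_le; apply/andP; split; last first.
  apply: ge_ereal_sup => _ [->|[n [v [_ v0 ->]]]].
    apply: ereal_sup_ubound; exists 0 => /=; first by rewrite rnorm0.
    by rewrite (linf0 lM) rnorm0.
  set F := Lper_class p1 (fourier_sum n v).
  have F0 : 0 < rnorm F by rewrite rnorm_fourier_sum; exact: fourier_sum_normLp_gt0 v0.
  apply: ereal_sup_ubound; exists (((rnorm F)^-1)%:C *: F).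
    by rewrite /= rnormZr ger0_norm ?invr_ge0 ?rnorm_ge0// mulVf ?gt_eqF.
  rewrite (linfZ lM) rnormZr ger0_norm ?invr_ge0 ?rnorm_ge0// mulrC.
  by congr (_ / _)%:E; rewrite /F MN.
set s := ge0_sup _.
have s0 : (0 <= s)%E by apply: ereal_sup_ubound; left.
have [soo|] := boolP (s \is a fin_num); last first.
  by rewrite ge0_fin_numE// ltey negbK => /eqP ->; exact: leey.
rewrite -(fineK soo); have f0 : 0 <= fine s by rewrite -lee_fin fineK.
have hs n v : rnorm (M (Lper_class p1 (fourier_sum n v))) <=
    fine s * rnorm (Lper_class p1 (fourier_sum n v)).
  have [v0|v0] := pselect (exists2 k : int, (`|k| <= n)%N & v k != 0).
    have F0 := fourier_sum_normLp_gt0 p1 v0.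
    rewrite -ler_pdivrMr ?rnorm_fourier_sum// -lee_fin fineK//.
    by apply: ereal_sup_ubound; right; exists n, v; split=> //; rewrite MN !rnorm_fourier_sum.
  have -> : fourier_sum n v = fourier_sum n (fun=> 0 : V).
    apply/funext => t; apply: eq_fourier_sum => k kn.
    by apply/eqP; apply: contrapT => /negP h; apply: v0; exists k.
  have -> : Lper_class p1 (fourier_sum n (fun=> 0 : V)) = 0.
    have L0 := fourier_sum_in_Lp p1 n (fun=> 0 : V).
    have := Lp_classZ p1 0 L0; rewrite !scale0r => <-; congr Lper_class.
    by apply/funext => t; rewrite fourier_sum0.
  by rewrite (linf0 lM) !rnorm0 mulr0.
apply: ge_ereal_sup => _ [F /= F1 <-]; rewrite lee_fin.
apply/ler_addgt0Pr => e e0.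
(* Replacing F by a polynomial G costs at most |K| |F - G| through M and [fine s] |F - G| through
   the norm of G; the 1 keeps [K'] positive. *)
pose K' := `|K| + fine s + 1.
have K'0 : 0 < K' by rewrite ltr_wpDl// addr_ge0.
have d0 : 0 < e / K' by rewrite divr_gt0.
have LF := repr_in_Lp (F : Lp (lebesgue_2pi R) p1 V).
have [n [v hv]] := fourier_sum_dense p1 LF d0.
pose G := Lper_class p1 (fourier_sum n v).
have FG : rnorm (F - G) <= e / K'.
  pose f : measurableTypeR R -> V := repr (F : Lp (lebesgue_2pi R) p1 V).
  pose g : measurableTypeR R -> V := fourier_sum n v.
  have -> : F - G = Lper_class p1 (f - g).
    by rewrite [RHS](Lp_classB p1 LF (fourier_sum_in_Lp p1 n v)) Lp_classK.
  by rewrite [rnorm _](rnorm_Lp_class p1 (in_LpB p1 LF (fourier_sum_in_Lp p1 n v))).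
have h1 : rnorm (M F) <= rnorm (M G) + rnorm (M (F - G)).
  have -> : M F = M G + M (F - G) by rewrite -(linfD lM) addrC subrK.
  exact: rnormD.
have h2 : rnorm (M (F - G)) <= `|K| * (e / K').
  apply: le_trans (hM _) _; apply: (@le_trans _ _ (`|K| * rnorm (F - G))).
    by rewrite ler_wpM2r ?rnorm_ge0 ?ler_norm.
  by rewrite ler_wpM2l.
have h3 : rnorm G <= 1 + e / K'.
  have := rnormD F (G - F); rewrite addrCA subrr addr0 rnormB; lra.
have h4 : fine s * rnorm G <= fine s * (1 + e / K') by rewrite ler_wpM2l.
have h5 : K' * (e / K') = e by rewrite mulrC divfK ?gt_eqF.
have h6 := hs n v; rewrite -/G in h6.
rewrite /K' [(_ + _ + 1) * _]mulrDl [(_ + fine s) * _]mulrDl mul1r -/K' in h5.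
rewrite mulrDr mulr1 in h4; lra.
Qed.

End input_output_norm.

Theorem theorem4p3 (R : realType) (X U Y : completeNormedModType R[i])
  (p : R) (p1 : 1 <= p)
  (A : operator X X) (T : R -> X -> X) (hT : generates A T)
  (B : {linear U -> X}) (hB : continuous B)
  (C : {linear X -> Y}) (hC : continuous C)
  (Delta : {linear Y -> U}) (hDelta : continuous Delta)
  (S : R -> X -> X) (hS : generates (op_add A (B \o Delta \o C)) S) :
  [<-> resolvent_set (total_op (S (2 * pi))) 1;
       range ik `<=` resolvent_set (op_add A (B \o Delta \o C)) /\
       (ge0_sup (fourier_quotients p1 [set: X] (fun k =>
          op_inv (op_add (op_shift A (ik k)) (B \o Delta \o C)))) < +oo)%E;
       range ik `<=` resolvent_set (op_add A (B \o Delta \o C)) /\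
       (0 < ereal_inf (fourier_quotients p1 (dom A) (fun k =>
          op_add (op_shift A (ik k)) (B \o Delta \o C))))%E] /\
  (resolvent_set (total_op (T (2 * pi))) 1 ->
   let Gamma := generator (evolution p1 T) in
   let M := pointwise p1 C \o op_inv Gamma \o pointwise p1 B in
   [/\ invertible Gamma, linear M, continuous M &
       opnorm M = ge0_sup (fourier_quotients p1 [set: U] (fun k =>
                    C \o op_inv (op_shift A (ik k)) \o B))]).
Proof.
set K := B \o Delta \o C.
(* Moves the shift outside, so that A + B Delta C can be treated as one generator. *)
have shiftE : (fun k => op_add (op_shift A (ik k)) K) = (fun k => op_shift (op_add A K) (ik k)).
  by apply/funext => k; congr Operator; apply/funext => x; exact: addrAC.
split.
  have -> : (fun k => op_inv (op_add (op_shift A (ik k)) K)) =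
      (fun k => op_inv (op_shift (op_add A K) (ik k))).
    by apply/funext => k; congr op_inv; exact: (congr1 (@^~ k) shiftE).
  have -> : (fun k => op_fun (op_add (op_shift A (ik k)) K)) =
      (fun k => op_fun (op_shift (op_add A K) (ik k))).
    by apply/funext => k; congr op_fun; exact: (congr1 (@^~ k) shiftE).
  split=> [/resolvent_set1P iS|].
    have iD := period_resolvent hS iS; split; first exact/range_ik_resolventP.
    exact: (multiplier_bounded_sup p1 iD (period_multiplier_bounded p1 hS iS)).
  split=> [[/range_ik_resolventP iD soo]|[/range_ik_resolventP iD i0]].
    split; first exact/range_ik_resolventP.
    exact: (sup_inf_gt0 hS iD soo).
  apply/resolvent_set1P; apply: (multiplier_bounded_period p1 hS iD).
  exact: (inf_gt0_multiplier_bounded (D := op_add A K) i0).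
move=> /resolvent_set1P iT Gamma M.
have iG : invertible Gamma := evolution_generator_invertible p1 hT iT.
have lB : linear B by move=> a x y; rewrite linearP.
have lC : linear C by move=> a x y; rewrite linearP.
have [KB KB0 bB] := continuous_linf_bounded lB hB.
have [KC KC0 bC] := continuous_linf_bounded lC hC.
have [KG KG0 bG] := op_inv_bounded iG.
have lM : linear M.
  move=> a F G; rewrite /M/= (pointwise_linear lB (ltW KB0) bB).
  by rewrite (op_inv_linear iG) (pointwise_linear lC (ltW KC0) bC).
have bM F : rnorm (M F) <= KC * (KG * KB) * rnorm F.
  have h1 : rnorm (M F) <= KC * rnorm (op_inv Gamma (pointwise p1 B F)).
    exact: (rnorm_pointwise_le lC (ltW KC0) bC).
  have h2 : rnorm (pointwise p1 B F) <= KB * rnorm F.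
    exact: (rnorm_pointwise_le lB (ltW KB0) bB).
  apply: le_trans h1 _; rewrite -!mulrA ler_pM2l//.
  by apply: le_trans (bG _) _; rewrite ler_pM2l.
split=> //; first exact: (bounded_linf_continuous lM bM).
apply: (opnorm_fourier_quotients lM bM) => n v.
rewrite /M/= (pointwise_class p1 lB (ltW KB0) bB); last exact: fourier_sum_in_Lp.
have -> : B \o fourier_sum n v = fourier_sum n (B \o v).
  by apply/funext => s; exact: linf_fourier_sum.
rewrite (evolution_generator_fourier p1 hT iT).
rewrite (pointwise_class p1 lC (ltW KC0) bC); last exact: fourier_sum_in_Lp.
by congr Lper_class; apply/funext => s; exact: linf_fourier_sum.
Qed.
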